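(* For every invariant rank one uniserial domain $R$ there is a commutative rank one valuation domain $S$ such that $\mathrm{Zg}_R$ and $\mathrm{Zg}_S$ are homeomorphic.
   Context: A ring is uniserial if its right ideals are totally ordered by inclusion and its left ideals are totally ordered by inclusion; $J(R)$ is its Jacobson radical (its set of non-units). A (proper) two-sided ideal $P$ is completely prime if $xy\in P$ implies $x\in P$ or $y\in P$. A uniserial domain $R$ has rank one if $J(R)$ is its only non-zero completely prime ideal. $R$ is invariant if $aR=Ra$ for all $a\in R$. A commutative valuation domain is a commutative domain whose ideals are totally ordered by inclusion. A pp-$n$-formula over $R$ is a formula $\exists\bar y\,(\bar y,\bar x)A=0$ with $A$ a matrix over $R$; $\varphi(M)$ is its solution set in a right module $M$. A module $N$ is pure-injective if every pure-embedding (embedding reflecting solution sets of pp-formulae) out of $N$ splits. $\mathrm{Zg}_R$ is the space of isomorphism classes of indecomposable pure-injective right $R$-modules, with basis of open sets $(\varphi/\psi)=\{N:\varphi(N)\supsetneq\varphi(N)\cap\psi(N)\}$ for pp-$1$-formulae $\varphi,\psi$. *)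

(* Defs.v *)
From HB Require Import structures.
From mathcomp Require Import all_boot all_order all_algebra.
From mathcomp Require Import boolp classical_sets.

Set Implicit Arguments.
Unset Strict Implicit.
Unset Printing Implicit Defensive.

Import GRing.Theory.

Local Open Scope classical_set_scope.
Local Open Scope ring_scope.

Section Rings.
Variable R : nzRingType.
Implicit Types (I J P : set R) (a r x y : R).

Definition right_ideal I : Prop :=
  [/\ I 0, (forall x y, I x -> I y -> I (x - y))
    & (forall x r, I x -> I (x * r))].

Definition left_ideal I : Prop :=
  [/\ I 0, (forall x y, I x -> I y -> I (x - y))
    & (forall x r, I x -> I (r * x))].

Definition two_sided_ideal I : Prop := right_ideal I /\ left_ideal I.

Definition uniserial : Prop :=
  (forall I J, right_ideal I -> right_ideal J -> I `<=` J \/ J `<=` I) /\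
  (forall I J, left_ideal I -> left_ideal J -> I `<=` J \/ J `<=` I).

(* [R] is nonzero since it is an [nzRingType]. *)
Definition domain : Prop := forall x y, x * y = 0 -> x = 0 \/ y = 0.

Definition maximal_right_ideal I : Prop :=
  [/\ right_ideal I, I <> setT
    & forall J, right_ideal J -> I `<=` J -> J = I \/ J = setT].

Definition jacobson : set R :=
  [set x | forall I, maximal_right_ideal I -> I x].

Definition is_unit x : Prop := exists y, x * y = 1 /\ y * x = 1.

Definition completely_prime P : Prop :=
  [/\ two_sided_ideal P, P <> setT
    & forall x y, P (x * y) -> P x \/ P y].

(* "J(R) is the only non-zero completely prime ideal of R"; in particular
   J(R) <> 0, so a division ring does not have rank one. *)
Definition rank_one : Prop :=
  forall P, (completely_prime P /\ P <> [set 0]) <-> P = jacobson.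

Definition invariant_ring : Prop :=
  forall a, range (fun r => a * r) = range (fun r => r * a).

(* In a uniserial domain the Jacobson radical is the set of non-units. *)
Lemma jacobson_nonunit : domain -> uniserial ->
  jacobson = [set x | ~ is_unit x].
Proof.
move=> dom [uniR _].
have rideal x : right_ideal (range (fun r => x * r)).
  split; first by exists 0; rewrite // mulr0.
    by move=> _ _ [a _ <-] [b _ <-]; exists (a - b); rewrite // mulrBr.
  by move=> _ r [a _ <-]; exists (a * r); rewrite // mulrA.
have unit_of x y : x * y = 1 -> is_unit x.
  move=> xy1; exists y; split=> //.
  have y0 : y <> 0 by move=> y0; move/eqP: xy1; rewrite y0 mulr0 eq_sym oner_eq0.
  have : y * (x * y - 1) = 0 by rewrite xy1 subrr mulr0.
  have /dom[/eqP|//] : (y * x - 1) * y = 0.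
    by rewrite mulrBl -mulrA xy1 mulr1 mul1r subrr.
  by rewrite subr_eq0 => /eqP.
have idT I : right_ideal I -> I 1 -> I = setT.
  by move=> [_ _ Im] I1; apply/seteqP; split=> // z _; rewrite -[z]mul1r; exact: Im.
have nuM x r : ~ is_unit x -> ~ is_unit (x * r).
  by move=> nx [y [xry _]]; apply/nx/(unit_of _ (r * y)); rewrite mulrA.
have nu_ideal : right_ideal [set x | ~ is_unit x].
  split=> /=.
  - by move=> [y [/eqP]]; rewrite mul0r eq_sym oner_eq0.
  - move=> x y nx ny.
    have self z : range (fun r => z * r) z by exists 1; rewrite // mulr1.
    have [xy|yx] := uniR _ _ (rideal x) (rideal y).
      have [r _ <-] := xy _ (self x).
      by rewrite -[X in _ - X]mulr1 -mulrBr; exact: nuM.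
    have [r _ <-] := yx _ (self y).
    by rewrite -[X in X - _]mulr1 -mulrBr; exact: nuM.
  - exact: nuM.
have unit_sub I x : right_ideal I -> I <> setT -> I x -> ~ is_unit x.
  by move=> Ii InT Ix [y [xy1 _]]; apply/InT/idT => //; rewrite -xy1; case: Ii => _ _; apply.
have unit1 : is_unit 1 by exists 1; rewrite mulr1.
apply/seteqP; split=> x /=.
  move=> /(_ [set z | ~ is_unit z]); apply; split=> //.
    by move=> nuT; have : [set: R] 1 by []; rewrite -nuT /=; apply.
  move=> J Ji sub; have [JT|JnT] := pselect (J = setT); [by right|left].
  by apply/seteqP; split=> // z; exact: unit_sub.
move=> nx I [Ii InT Imax].
have [|e|e] := Imax _ nu_ideal; first by move=> z; exact: unit_sub.
  by rewrite -e.
by have : [set: R] 1 by []; rewrite -e /=.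
Qed.

End Rings.

(* Commutativity and absence of zero divisors are part of [idomainType]. *)
Definition valuation_domain (S : idomainType) : Prop :=
  forall I J : set S, two_sided_ideal I -> two_sided_ideal J ->
    I `<=` J \/ J `<=` I.

(* Right R-modules are left modules over the converse ring: for
   [M : lmodType R^c] and [a : R], the right action m a is
   [(a : R^c) *: m]. *)
Notation rmodType R := (lmodType R^c).

Section Modules.
Variable R : nzRingType.

(* The pp-n-formula "exists y, (y, x) A = 0", with y of length
   [pp_bound] and [pp_eqs] equations. *)
Record pp_formula (n : nat) := PPFormula {
  pp_bound : nat;
  pp_eqs : nat;
  pp_mx : 'M[R]_(pp_bound + n, pp_eqs) }.

Definition row_mulmx (M : rmodType R) (p q : nat) (v : 'rV[M]_p)
    (A : 'M[R]_(p, q)) : 'rV[M]_q :=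
  \row_j \sum_i (A i j : R^c) *: v 0 i.

Definition pp_sol (n : nat) (phi : pp_formula n) (M : rmodType R) :
    set 'rV[M]_n :=
  [set x | exists y : 'rV[M]_(pp_bound phi),
             row_mulmx (row_mx y x) (pp_mx phi) = 0].

Definition pure_embedding (M N : rmodType R) (f : {linear M -> N}) : Prop :=
  injective f /\
  forall (n : nat) (phi : pp_formula n) (x : 'rV[M]_n),
    pp_sol phi (map_mx f x) -> pp_sol phi x.

Definition splits (M N : rmodType R) (f : {linear M -> N}) : Prop :=
  exists g : {linear N -> M}, forall x, g (f x) = x.

Definition pure_injective (N : rmodType R) : Prop :=
  forall (M : rmodType R) (f : {linear N -> M}), pure_embedding f -> splits f.

Definition submodule (N : rmodType R) (A : set N) : Prop :=
  [/\ A 0, (forall x y, A x -> A y -> A (x + y))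
    & (forall (r : R^c) x, A x -> A (r *: x))].

Definition indecomposable (N : rmodType R) : Prop :=
  [set: N] <> [set 0] /\
  forall A B : set N, submodule A -> submodule B ->
    A `&` B = [set 0] ->
    (forall x, exists a b, [/\ A a, B b & x = a + b]) ->
    A = [set 0] \/ B = [set 0].

Definition isomorphic (M N : rmodType R) : Prop :=
  exists f : {linear M -> N}, bijective f.

(* A point of Zg_R: an isomorphism class of indecomposable pure-injective
   right R-modules. *)
Record zg := Zg {
  zg_class : rmodType R -> Prop;
  zg_classP : exists N : rmodType R,
    [/\ indecomposable N, pure_injective N & zg_class = isomorphic N] }.

(* The basic open set (phi / psi). *)
Definition zg_basic (phi psi : pp_formula 1) (p : zg) : Prop :=
  exists N : rmodType R,
    zg_class p N /\ pp_sol phi (M := N) `&` pp_sol psi (M := N)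
                    `<` pp_sol phi (M := N).

(* U is a union of basic open sets.  That the sets (phi / psi) do form a
   basis, i.e. that finite intersections of them are open, is a theorem of
   Ziegler; it is not needed to state openness, but it would be needed to
   package [zg R] as a [topologicalType]. *)
Definition zg_open (U : zg -> Prop) : Prop :=
  forall p, U p -> exists phi psi : pp_formula 1,
    zg_basic phi psi p /\ forall q, zg_basic phi psi q -> U q.

End Modules.

Definition zg_homeomorphic (R S : nzRingType) : Prop :=
  exists (f : zg R -> zg S) (g : zg S -> zg R),
    [/\ cancel f g, cancel g f,
        (forall V, zg_open V -> zg_open (fun p => V (f p)))
      & (forall U, zg_open U -> zg_open (fun q => U (g q)))].

(* Main.v *)
(** Let [v] send an element of [R] to the principal ideal it generates.  Since [R] is
    archimedean, its value monoid is commutative (Hoelder), and localising a monoid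
    algebra gives a commutative valuation domain [S] with the same value monoid.
    Pure-injective modules are the algebraically compact ones, and over a valued ring
    every pp-1-formula is a conjunction of conditions "[x] lies in [M d + ann t]"; so an
    element [x] of an indecomposable pure-injective module is governed by the pair
    [(I, J)] of value sets of its annihilators and of its non-divisors.  Nonzero
    elements with the same pair force isomorphic modules, every proper pair occurs, and
    the pairs occurring in one module form a single class under the shifts
    [(I, J) -> (I - g, J + g)].  Hence the points of the spectrum, and the basic open
    sets, depend on the value monoid only.

    Locality of the endomorphism rings and the existence of indecomposable summands
    both come from the Ellis-Numakura lemma, applied to closed semigroups of
    endomorphisms of an algebraically compact module. *)

Require Import Defs.
From Stdlib Require List.
From HB Require Import structures.
From mathcomp Require Import all_boot all_order all_algebra.
From mathcomp Require Import boolp classical_sets functions.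
From mathcomp Require Import finmap monalg.

Set Implicit Arguments.
Unset Strict Implicit.
Unset Printing Implicit Defensive.

Import GRing.Theory Num.Theory.

Local Open Scope classical_set_scope.
Local Open Scope ring_scope.

(** * Quotients and divisible groups *)

(** The proof uses no functor between modules over [R] and over [S], which share only their values.
    A point is handled through the pairs that it realises: they are sets of values, so they make
    sense over both rings. The module theory is therefore done for an abstract [valued_ring] and
    applied to each ring in turn.

    Two facts reduce a module to its pairs. The subgroups [M d] and [ann t] form two chains, which
    generate a distributive lattice, so a decomposition of an element can respect finitely many
    conditions at once. In an indecomposable algebraically compact module, local endomorphism rings
    then make each condition prime: an element of [M d + ann t] lies in [M d] or in [ann t].

    Algebraic compactness replaces a topology: projections of solution sets have the finite
    intersection property, and composition on the right with a fixed map preserves them, as the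
    semigroup argument requires.

    Rank one enters because no nonzero element is divisible by all powers of a nonunit. This makes
    values commute, and the same property of the value monoid gives [S] rank one. *)

Section LinearMaps.
Variable A : nzRingType.
Implicit Types M N P : lmodType A.

Definition lin M N (f : M -> N) : Prop :=
  forall a u v, f (a *: u + v) = a *: f u + f v.

Definition is_submod M (K : set M) : Prop :=
  [/\ K 0, (forall x y, K x -> K y -> K (x + y)) & (forall a x, K x -> K (a *: x))].

Lemma linear_lin M N (f : {linear M -> N}) : lin f.
Proof. by move=> a u v; rewrite linearP. Qed.

Lemma lin_linear M N (f : M -> N) : lin f -> exists g : {linear M -> N}, g =1 f.
Proof.
move=> lf; pose m := GRing.isLinear.Build A M N _ f lf.
by exists (HB.pack_for {linear M -> N} f m).
Qed.

Lemma lin0 M N (f : M -> N) : lin f -> f 0 = 0.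
Proof. by move=> /lin_linear[g gE]; rewrite -gE linear0. Qed.

Lemma linD M N (f : M -> N) : lin f -> {morph f : x y / x + y}.
Proof. by move=> /lin_linear[g gE] x y; rewrite -!gE linearD. Qed.

Lemma linB M N (f : M -> N) : lin f -> {morph f : x y / x - y}.
Proof. by move=> /lin_linear[g gE] x y; rewrite -!gE linearB. Qed.

Lemma linZ M N (f : M -> N) a : lin f -> {morph f : x / a *: x}.
Proof. by move=> /lin_linear[g gE] x; rewrite -!gE linearZ. Qed.

Lemma lin_sum M N (f : M -> N) I (r : seq I) (P : pred I) (F : I -> M) :
  lin f -> f (\sum_(i <- r | P i) F i) = \sum_(i <- r | P i) f (F i).
Proof.
by move=> /lin_linear[g gE]; rewrite -gE linear_sum; apply: eq_bigr => i _.
Qed.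

Lemma lin_id M : lin (@id M). Proof. by []. Qed.

Lemma lin_comp M N P (f : M -> N) (g : N -> P) : lin f -> lin g -> lin (g \o f).
Proof. by move=> lf lg a u v; rewrite /= lf lg. Qed.

Lemma lin_sub M N (f g : M -> N) : lin f -> lin g -> lin (fun x => f x - g x).
Proof.
by move=> lf lg a u v; rewrite lf lg scalerBr opprD addrACA.
Qed.

Lemma lin_add M N (f g : M -> N) : lin f -> lin g -> lin (fun x => f x + g x).
Proof. by move=> lf lg a u v; rewrite lf lg scalerDr addrACA. Qed.

Lemma lin_bij M N (f : M -> N) (g : N -> M) : lin f -> cancel f g -> cancel g f -> lin g.
Proof. by move=> lf fg gf a u v; apply: (can_inj fg); rewrite lf !gf. Qed.

Lemma submodN M (K : set M) x : is_submod K -> K x -> K (- x).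
Proof. by move=> [_ _ KZ] Kx; rewrite -scaleN1r; exact: KZ. Qed.

Lemma submodB M (K : set M) x y : is_submod K -> K x -> K y -> K (x - y).
Proof. by move=> sK Kx Ky; case: (sK) => _ KD _; apply: KD => //; exact: submodN. Qed.

End LinearMaps.

Section Quotient.
Variables (A : nzRingType) (V : lmodType A).

Record submod := Submod { submod_set :> V -> Prop; submodP : is_submod submod_set }.

Variable K : submod.

(** Congruent elements define the same set of candidates, hence the same choice; the quotient is
    then the subtype of chosen representatives. *)
Definition coset_rep (x : V) : V := xget 0 [set y | K (x - y)].

Lemma coset_repP x : K (x - coset_rep x).
Proof.
rewrite /coset_rep; case: xgetP => [y _ //|/(_ x)/=]; rewrite subrr => nK.
by case: nK; case: (submodP K).
Qed.

Lemma eq_coset_rep x y : K (x - y) <-> coset_rep x = coset_rep y.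
Proof.
have sK := submodP K; split=> [Kxy|e].
  congr xget; apply/seteqP; split=> z /= Kz.
    have -> : y - z = (x - z) - (x - y) by rewrite opprB addrCA addrAC subrr add0r addrC.
    exact: submodB.
  have -> : x - z = (x - y) + (y - z) by rewrite addrA subrK.
  by case: sK => _ KD _; exact: KD.
have := submodB sK (coset_repP x) (coset_repP y).
by rewrite e opprB addrA subrK.
Qed.

Lemma coset_rep_idem x : coset_rep (coset_rep x) = coset_rep x.
Proof.
apply/eq_coset_rep; rewrite -opprB; apply: submodN; first exact: submodP.
exact: coset_repP.
Qed.

Definition quot := {x : V | coset_rep x == x}.
HB.instance Definition _ := Choice.on quot.

Definition to_quot (x : V) : quot := exist _ (coset_rep x) (introT eqP (coset_rep_idem x)).

Lemma to_quotK (q : quot) : to_quot (sval q) = q.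
Proof. by apply: val_inj => /=; exact/eqP/(svalP q). Qed.

Lemma eq_to_quot x y : K (x - y) <-> to_quot x = to_quot y.
Proof.
rewrite eq_coset_rep; split=> [e|/(congr1 val)//].
exact: val_inj.
Qed.

Definition quot_add (p q : quot) := to_quot (sval p + sval q).
Definition quot_opp (p : quot) := to_quot (- sval p).
Definition quot_scale a (p : quot) := to_quot (a *: sval p).

Lemma to_quotD x y : to_quot (x + y) = quot_add (to_quot x) (to_quot y).
Proof.
apply/eq_to_quot; rewrite opprD addrACA; case: (submodP K) => _ KD _.
by apply: KD; exact: coset_repP.
Qed.

Lemma to_quotN x : to_quot (- x) = quot_opp (to_quot x).
Proof.
apply/eq_to_quot; rewrite -opprD.
by apply: submodN; [exact: submodP|exact: coset_repP].
Qed.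

Lemma to_quotZ a x : to_quot (a *: x) = quot_scale a (to_quot x).
Proof.
apply/eq_to_quot; rewrite -scalerBr; case: (submodP K) => _ _ KZ.
by apply: KZ; exact: coset_repP.
Qed.

Lemma quot_addA : associative quot_add.
Proof.
move=> p q r; rewrite -(to_quotK p) -(to_quotK q) -(to_quotK r).
by rewrite -!to_quotD addrA.
Qed.
Lemma quot_addC : commutative quot_add.
Proof. by move=> p q; rewrite /quot_add addrC. Qed.
Lemma quot_add0 : left_id (to_quot 0) quot_add.
Proof. by move=> p; rewrite -(to_quotK p) -to_quotD add0r. Qed.
Lemma quot_addN : left_inverse (to_quot 0) quot_opp quot_add.
Proof. by move=> p; rewrite -(to_quotK p) -to_quotN -to_quotD addNr. Qed.
HB.instance Definition _ :=
  GRing.isZmodule.Build quot quot_addA quot_addC quot_add0 quot_addN.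

Lemma quot_scaleA a b p : quot_scale a (quot_scale b p) = quot_scale (a * b) p.
Proof. by rewrite -(to_quotK p) -!to_quotZ scalerA. Qed.
Lemma quot_scale1 : left_id 1 quot_scale.
Proof. by move=> p; rewrite -(to_quotK p) -!to_quotZ scale1r. Qed.
Lemma quot_scaleDr : right_distributive quot_scale +%R.
Proof.
move=> a p q; rewrite -(to_quotK p) -(to_quotK q) -[to_quot _ + _]to_quotD -!to_quotZ.
by rewrite scalerDr to_quotD.
Qed.
Lemma quot_scaleDl p : {morph quot_scale^~ p : a b / a + b}.
Proof. by move=> a b; rewrite -(to_quotK p) -!to_quotZ scalerDl to_quotD. Qed.
HB.instance Definition _ := GRing.Zmodule_isLmodule.Build A quot
  quot_scaleA quot_scale1 quot_scaleDr quot_scaleDl.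

Lemma to_quot_lin : lin (to_quot : V -> quot).
Proof. by move=> a u v; rewrite to_quotD to_quotZ. Qed.

End Quotient.

Lemma exists_quotient (A : nzRingType) (V : lmodType A) (K : set V) : is_submod K ->
  exists (Q : lmodType A) (p : V -> Q),
    [/\ lin p, (forall q, exists x, p x = q) & forall x, p x = 0 <-> K x].
Proof.
move=> sK; pose K' := Submod sK; exists (quot K'), (@to_quot A V K'); split.
- exact: to_quot_lin.
- by move=> q; exists (sval q); rewrite to_quotK.
- move=> x; rewrite -[0](lin0 (@to_quot_lin A V K')) -eq_to_quot /= subr0.
  by [].
Qed.

Definition divisible_group (T : zmodType) : Prop :=
  forall (n : nat) (t : T), exists u : T, u *+ n.+1 = t.

(* The witness is [rat / int]. *)
Lemma exists_divisible_cogenerator : exists T : zmodType,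
  [/\ divisible_group T, (exists t : T, t <> 0)
    & forall n, (1 < n)%N -> exists t : T, t <> 0 /\ t *+ n = 0].
Proof.
pose K : set (zmodule rat) := [set x | exists m : int, (x : rat) = m%:~R].
have sK : is_submod K.
  split=> /=; first by exists 0.
    by move=> x y [m xE] [n yE]; exists (m + n); rewrite rmorphD /= -xE -yE.
  by move=> a x [m xE]; exists (m * a); rewrite rmorphM /= -xE mulrzr.
have [T [p [lp sp kp]]] := exists_quotient sK.
have pMn n (x : rat) : p ((x *+ n) : rat) = p x *+ n.
  elim: n => [|n IH]; first by rewrite !mulr0n -[RHS](lin0 lp).
  by rewrite !mulrSr -IH -(linD lp).
have nz n : (1 < n)%N -> p ((n%:R)^-1 : rat) <> 0.
  move=> n1 /kp/= [z zE].
  have n0 : (n%:R : rat) != 0 by rewrite pnatr_eq0; case: n n1 {zE}.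
  have : 1 = (z * n%:Z) :> int.
    by apply: (@intr_inj rat); rewrite rmorphM /= -zE mulVf.
  move=> /esym/(congr1 absz); rewrite abszM /= => /eqP.
  by rewrite muln_eq1 => /andP[_ /eqP n1']; move: n1; rewrite n1'.
exists T; split.
- move=> n t; have [x <-] := sp t; exists (p ((x : rat) / n.+1%:R : rat)).
  have := @divfK rat n.+1%:R; rewrite pnatr_eq0 => /(_ isT x).
  by rewrite mulr_natr -pMn => ->.
- by exists (p ((2%:R)^-1 : rat)); exact: nz.
- move=> n n1; exists (p ((n%:R)^-1 : rat)); split; first exact: nz.
  have := @mulVf rat n%:R; rewrite pnatr_eq0 mulr_natr -lt0n => /(_ (ltnW n1)).
  by rewrite -pMn => ->; apply/kp; exists 1.
Qed.

Definition additive_map (G T : zmodType) (f : G -> T) : Prop :=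
  forall x y, f (x + y) = f x + f y.

Section AdditiveMap.
Variables (G T : zmodType) (f : G -> T).
Hypothesis fD : additive_map f.

Lemma additive_map0 : f 0 = 0.
Proof. by apply: (@addIr _ (f 0)); rewrite -fD !add0r. Qed.

Lemma additive_map_sum I (r : seq I) (P : pred I) (F : I -> G) :
  f (\sum_(i <- r | P i) F i) = \sum_(i <- r | P i) f (F i).
Proof. by apply: (big_morph f fD additive_map0). Qed.

End AdditiveMap.

(** Division with remainder by the least positive element; [n = 0] covers the zero subgroup. It is
    applied to the integers [k] for which [k g] lies in a given domain or subgroup. *)
Lemma int_subgroup (D : int -> Prop) : D 0 -> (forall j k, D j -> D k -> D (j - k)) ->
  exists n : nat, D n%:Z /\ forall k, D k -> exists q, k = q * n%:Z.
Proof.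
move=> D0 DB.
have DN k : D k -> D (- k) by move=> Dk; rewrite -sub0r; exact: DB.
have DD j k : D j -> D k -> D (j + k).
  by move=> Dj Dk; rewrite -[k]opprK; apply: DB => //; exact: DN.
have DMn k (n : nat) : D k -> D (k *+ n).
  by move=> Dk; elim: n => [|n IH]; rewrite ?mulr0n // mulrS; exact: DD.
have DM k (q : int) : D k -> D (q * k).
  move=> Dk; rewrite mulrC -mulrzz; case: (intP q) => [//|m|m]; first exact: DMn.
  by rewrite mulrNz; apply: DN; exact: DMn.
have [[n [n0 Dn]]|noD] := pselect (exists n : nat, (0 < n)%N /\ D n%:Z); last first.
  exists 0%N; split=> // k Dk; exists 0; rewrite mul0r; apply: contrapT => k0.
  apply: noD; exists `|k|%N; split; first by rewrite absz_gt0; apply/eqP.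
  by rewrite abszE; case: ger0P => // _; exact: DN.
have exn : exists n, (0 < n)%N && `[< D n%:Z >].
  by exists n; rewrite n0; apply/asboolP.
case: (ex_minnP exn) => m /andP[m0 /asboolP Dm] min_m.
exists m; split=> // k Dk; exists (k %/ m)%Z.
have mz : m%:Z != 0 by case: m m0 {Dm min_m}.
suff r0 : (k %% m)%Z = 0 by rewrite [LHS](divz_eq k m) r0 addr0.
have Dr : D (k %% m)%Z.
  have -> : (k %% m)%Z = k - (k %/ m)%Z * m by rewrite {2}(divz_eq k m) addrC addKr.
  by apply: DB => //; exact: DM.
have r_ge0 := modz_ge0 k mz; have r_lt : (k %% m < m)%Z by apply: ltz_pmod; case: m m0 {mz Dm min_m Dr r_ge0}.
case: (k %% m)%Z Dr r_ge0 r_lt => // r Dr _ r_lt; have [->//|r0] := posnP r.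
have := min_m r; rewrite r0 /= => /(_ (asboolT Dr)) mr.
by move: r_lt; rewrite ltz_nat ltnNge mr.
Qed.

Lemma pairB (G T : zmodType) (x x' : G) (y y' : T) :
  (x - x', y - y') = (x, y) - (x', y').
Proof. by []. Qed.

(** * Extension and separation by homomorphisms into a divisible group *)

Section Extension.
Variables G T : zmodType.
Hypothesis T_div : divisible_group T.

(** Partial homomorphisms are kept as graphs, so that the upper bound of a chain is just a union. *)
Definition partial_additive (X : set (G * T)) : Prop :=
  [/\ X (0, 0), (forall x y, X x -> X y -> X (x - y))
    & forall t, X (0, t) -> t = 0].

Lemma partial_additive_extend1 X g : partial_additive X ->
  exists Y, [/\ partial_additive Y, X `<=` Y & exists t, Y (g, t)].
Proof.
move=> [X0 XB Xf].
have XN x : X x -> X (- x) by move=> ?; rewrite -sub0r; exact: XB.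
have XD x y : X x -> X y -> X (x + y).
  by move=> ? ?; rewrite -[y]opprK; apply: XB => //; exact: XN.
have XMn x (n : nat) : X x -> X (x *+ n).
  by move=> ?; elim: n => [|n IH]; rewrite ?mulr0n // mulrS; exact: XD.
have XM x (k : int) : X x -> X (x *~ k).
  by move=> ?; case: (intP k) => [|m|m]; rewrite ?mulr0z ?mulrNz //; [|apply: XN]; exact: XMn.
have pairMz (x : G) (y : T) (k : int) : (x, y) *~ k = (x *~ k, y *~ k).
  have pMn (n : nat) : (x, y) *+ n = (x *+ n, y *+ n).
    by elim: n => [//|n IH]; rewrite !mulrS IH.
  by case: (intP k) => [//|m|m]; rewrite ?mulrNz -?pmulrn pMn.
(* [t'] is the future image of [g]. The multiples of [g] in the domain are those of some [n g], so
   it suffices to divide the value at [n g] by [n]; for [n = 0] there is no constraint. *)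
have [t' t'P] : exists t', forall k w, X (g *~ k, w) -> w = t' *~ k.
  have [||n [[w Xw] nP]] := @int_subgroup (fun k => exists w, X (g *~ k, w)).
  - by exists 0; rewrite mulr0z.
  - move=> j k [w Xw] [w' Xw']; exists (w - w').
    by rewrite mulrzBr; exact: (XB _ _ Xw Xw').
  have [t' t'E] : exists t', n%:Z != 0 -> t' *~ n = w.
    by case: n {Xw nP} => [|n]; [exists 0|have [t' <-] := T_div n w; exists t'].
  exists t' => k u Xu; have [|q kE] := nP k; first by exists u.
  have [n0|nn0] := eqVneq n%:Z 0.
    move: Xu; rewrite kE n0 !mulr0 mulr0z => /Xf ->; exact: (esym (mulr0z _)).
  rewrite kE mulrC mulrzA t'E //; apply/eqP; rewrite -subr_eq0; apply/eqP/Xf.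
  have := XB _ _ Xu (XM _ q Xw).
  by rewrite pairMz -mulrzA mulrC -kE -pairB subrr.
exists [set x | exists y k, X y /\ x = y + (g *~ k, t' *~ k)]; split; last 2 first.
- by move=> x Xx; exists x, 0; split; rewrite ?mulr0z ?addr0.
- exists t', (0, 0), 1; split=> //; rewrite !mulr1z; exact: (esym (add0r _)).
split.
- by exists (0, 0), 0; split; rewrite ?mulr0z ?addr0.
- move=> _ _ [x [k [Xx ->]]] [y [l [Xy ->]]]; exists (x - y), (k - l); split; first exact: XB.
  by rewrite opprD addrACA !mulrzBr.
- move=> t [[h u] [k [Xx [e ->]]]]; have := t'P (- k) u.
  rewrite !mulrNz => ->; first by rewrite addNr.
  by have -> : - (g *~ k) = h by apply/eqP; rewrite eq_sym -addr_eq0 -e.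
Qed.

Theorem additive_extension X : partial_additive X ->
  exists f : G -> T, additive_map f /\ forall g t, X (g, t) -> f g = t.
Proof.
move=> pX.
(* Sets are tested after adjoining [X], so that the empty chain, whose union is empty, has an
   admissible bound. *)
have [|A [PA Amax]] := @Zorn_bigcup (G * T)%type [set Y | partial_additive (Y `|` X)].
  move=> F FP Ftot /=; case: (pX) => X0 XB Xf.
  have ub x y : (\bigcup_(Y in F) Y `|` X) x -> (\bigcup_(Y in F) Y `|` X) y ->
      (exists Y, [/\ F Y, (Y `|` X) x & (Y `|` X) y]) \/ (X x /\ X y).
    move=> [[Y FY Yx]|Xx] [[Z FZ Zy]|Xy]; last by right.
    - have [YZ|ZY] := Ftot _ _ FY FZ; left.
        by exists Z; split=> //; left => //; exact: YZ.
      by exists Y; split=> //; left => //; exact: ZY.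
    - by left; exists Y; split=> //; [left|right].
    - by left; exists Z; split=> //; [right|left].
  split; first by right.
    move=> x y /ub h /h [[Y [FY Yx Yy]]|[Xx Xy]]; last by right; exact: XB.
    have [_ YB _] := FP _ FY; have [Yxy|Xxy] := YB _ _ Yx Yy; last by right.
    by left; exists Y.
  move=> t Xt; have [[Y [FY Yx _]]|[Xx _]] := ub _ _ Xt Xt; last exact: Xf.
  by have [_ _ Yf] := FP _ FY; exact: Yf.
have tot g : exists t, (A `|` X) (g, t).
  have [Y [pY AY [t Yt]]] := partial_additive_extend1 g PA.
  exists t; left; apply: contrapT => nA.
  apply: (Amax Y).
    split; first by move=> x Ax; apply: AY; left.
    by move=> /(_ _ Yt).
  by rewrite /= setUidl // => x Xx; apply: AY; right.
have [f fP] := choice tot; case: PA => A0 AB Af.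
have uniq_t g t : (A `|` X) (g, t) -> f g = t.
  move=> gt; apply/eqP; rewrite -subr_eq0; apply/eqP/Af.
  by have := AB _ _ (fP g) gt; rewrite -pairB subrr.
exists f; split; last by move=> g t Xgt; apply: uniq_t; right.
move=> x y; apply: uniq_t.
have := AB _ _ (fP x) (AB _ _ A0 (fP y)).
by rewrite -[(0,0) - _]pairB -pairB !sub0r !opprK.
Qed.

Hypothesis T_ne : exists t : T, t <> 0.
Hypothesis T_tor : forall n, (1 < n)%N -> exists t : T, t <> 0 /\ t *+ n = 0.

(** Let [n] generate the integers [k] with [k g] in [H]. Since [n = 1] is excluded, some nonzero [t]
    is killed by [n], and [h + k g] can be sent to [k t]. *)
Theorem additive_separation (H : set G) g : H 0 -> (forall x y, H x -> H y -> H (x - y)) ->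
  ~ H g -> exists f : G -> T, [/\ additive_map f, (forall h, H h -> f h = 0) & f g <> 0].
Proof.
move=> H0 HB nHg.
have [t [t0 tP]] : exists t : T, t <> 0 /\ forall k, H (g *~ k) -> t *~ k = 0.
  have [||n [Dn nP]] := @int_subgroup (fun k => H (g *~ k)).
  - by rewrite mulr0z.
  - by move=> j k Hj Hk; rewrite mulrzBr; exact: HB.
  have [t [t0 tn]] : exists t : T, t <> 0 /\ t *+ n = 0.
    case: n Dn nP => [|[|n]] Dn nP; last exact: T_tor.
      by have [t t0] := T_ne; exists t.
    by rewrite mulr1z in Dn.
  exists t; split=> // k /nP [q ->]; rewrite mulrC mulrzA.
  by rewrite -pmulrn tn mul0rz.
have [|f [fD fX]] := @additive_extension
    [set x | exists h k, H h /\ x = (h + g *~ k, t *~ k)].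
  split.
  - by exists 0, 0; rewrite !mulr0z addr0.
  - move=> _ _ [h [k [Hh ->]]] [h' [k' [Hh' ->]]]; exists (h - h'), (k - k').
    by split; [exact: HB|rewrite !mulrzBr -pairB opprD addrACA].
  - move=> _ [h [k [Hh [e ->]]]]; apply: tP.
    have -> : g *~ k = 0 - h by rewrite sub0r; apply/eqP; rewrite -addr_eq0 addrC -e.
    exact: HB.
exists f; split=> //.
  by move=> h Hh; apply: fX; exists h, 0; rewrite !mulr0z addr0.
by rewrite (fX g t) //; exists 0, 1; rewrite !mulr1z add0r.
Qed.

End Extension.

(** * Algebraically compact modules *)

Lemma sum_by_key (V : eqType) (A : Type) (B : nmodType) (L : seq (V * A))
    (F : V * A -> B) (vs : seq V) : uniq vs -> {subset map fst L <= vs} ->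
  \sum_(p <- L) F p = \sum_(v <- vs) \sum_(p <- L | p.1 == v) F p.
Proof.
move=> uvs; rewrite (exchange_big_dep xpredT) //=.
elim: L => [|p L IH] sub; first by rewrite !big_nil.
rewrite !big_cons IH; last by move=> v vL; apply: sub; rewrite inE vL orbT.
congr (_ + _); rewrite -(big_filter _ (fun v => p.1 == v)).
have -> : [seq v <- vs | p.1 == v] = [:: p.1].
  rewrite (eq_filter (a2 := pred1 p.1)); last by move=> v; rewrite /= eq_sym.
  by rewrite filter_pred1_uniq //; apply: sub; rewrite inE eqxx.
by rewrite big_seq1.
Qed.

Lemma In_cat (X : Type) (e : X) (s t : seq X) :
  List.In e (s ++ t) -> List.In e s \/ List.In e t.
Proof. by elim: s => [|x s IH] /=; [right|case=> [|/IH]; tauto]. Qed.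

Lemma In_map (X Y : Type) (f : X -> Y) (s : seq X) y :
  List.In y (map f s) <-> exists x, f x = y /\ List.In x s.
Proof.
elim: s => [|x s IH] /=; first by split=> // -[x []].
rewrite IH; split=> [[<-|[z [<- zs]]]|[z [<- [->|zs]]]].
- by exists x; split=> //; left.
- by exists z; split=> //; right.
- by left.
- by right; exists z.
Qed.

Section Systems.
Variable A : nzRingType.
Implicit Types M N : lmodType A.

(** A list of pairs is a finite linear form in which variables may repeat; the type of variables is
    arbitrary, whence [List.In] for membership in systems. *)
Definition lin_eval (V : Type) M (s : V -> M) (l : seq (V * A)) : M :=
  \sum_(p <- l) p.2 *: s p.1.

Definition alg_compact M : Prop :=
  forall (V : Type) (E : set (seq (V * A) * M)),
    (forall F : seq (seq (V * A) * M), (forall e, List.In e F -> E e) ->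
      exists s : V -> M, forall e, List.In e F -> lin_eval s e.1 = e.2) ->
  exists s : V -> M, forall e, E e -> lin_eval s e.1 = e.2.

Lemma lin_eval_lin M N (f : M -> N) (V : Type) (s : V -> M) l :
  lin f -> lin_eval (f \o s) l = f (lin_eval s l).
Proof.
by move=> lf; rewrite /lin_eval lin_sum //; apply: eq_bigr => p _; rewrite linZ.
Qed.

Lemma alg_compact_retract M N (i : M -> N) (p : N -> M) :
  lin i -> lin p -> cancel i p -> alg_compact N -> alg_compact M.
Proof.
move=> li lp ip cN V E finE.
have [|s sE] := cN V [set e | exists e', E e' /\ e = (e'.1, i e'.2)].
  move=> F FE; have [F' F'E ->] : exists2 F', (forall e, List.In e F' -> E e)
      & F = map (fun e => (e.1, i e.2)) F'.
    elim: F FE => [|e F IH] FE; first by exists [::].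
    have [|F' F'E ->] := IH; first by move=> e' e'F; apply: FE; right.
    have [|e' [Ee' ->]] := FE e; first by left.
    by exists (e' :: F') => // e'' /= [<-|/F'E].
  have [s sF'] := finE F' F'E; exists (i \o s) => e /In_map[e' [<- e'F]] /=.
  by rewrite lin_eval_lin // sF'.
exists (p \o s) => -[l c] Elc /=.
have := sE (l, i c); rewrite lin_eval_lin // => /= ->; first exact: ip.
by exists (l, c).
Qed.

Definition solvable M p q (B : 'I_p -> 'I_q -> A) (w : 'I_q -> M) : Prop :=
  exists y : 'I_p -> M, forall j, \sum_i B i j *: y i = w j.

Definition pure_map M N (f : M -> N) : Prop :=
  forall p q (B : 'I_p -> 'I_q -> A) (w : 'I_q -> M), solvable B (f \o w) -> solvable B w.

Lemma pure_map_inj M N (f : M -> N) : lin f -> pure_map f -> injective f.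
Proof.
move=> lf pf x y fxy; apply/eqP; rewrite -subr_eq0; apply/eqP.
(* The system without unknowns whose only equation is [0 = x - y]. *)
have [|z] := pf 0%N 1%N (fun _ _ => 0) (fun _ => x - y).
  by exists (fun _ => 0) => j; rewrite big_ord0 /= linB // fxy subrr.
by move=> /(_ ord0); rewrite big_ord0.
Qed.

End Systems.

(** * The character bidual *)

Section Bidual.
Variables (A : nzRingType) (T : zmodType) (M : lmodType A).

Definition char_group := {h : M -> T | additive_map h}.

Lemma char_ext (h k : char_group) : sval h =1 sval k -> h = k.
Proof. by move=> /funext; exact: eq_sig_hprop (fun _ _ _ => Prop_irrelevance _ _) _ _. Qed.

Lemma char_act_subproof a (h : char_group) : additive_map (fun m => sval h (a *: m)).
Proof. by move=> x y; rewrite scalerDr (svalP h). Qed.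
Definition char_act a (h : char_group) : char_group := exist _ _ (char_act_subproof a h).

Lemma char_add_subproof (h k : char_group) : additive_map (fun m => sval h m + sval k m).
Proof. by move=> x y; rewrite (svalP h) (svalP k) addrACA. Qed.
Definition char_add (h k : char_group) : char_group := exist _ _ (char_add_subproof h k).

Lemma char_zero_subproof : additive_map (fun _ : M => 0 : T).
Proof. by move=> x y; rewrite addr0. Qed.
Definition char_zero : char_group := exist _ _ char_zero_subproof.

Lemma char_opp_subproof (h : char_group) : additive_map (fun m => - sval h m).
Proof. by move=> x y; rewrite (svalP h) opprD. Qed.
Definition char_opp (h : char_group) : char_group := exist _ _ (char_opp_subproof h).

(** Additivity is spelled out through [char_add], so the character group itself needs no structure
    instance. *)
Definition bidual := {xi : char_group -> T |
  forall h k, xi (char_add h k) = xi h + xi k}.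

HB.instance Definition _ := gen_eqMixin bidual.
HB.instance Definition _ := gen_choiceMixin bidual.

Definition bidual_eval (xi : bidual) : char_group -> T := sval xi.
Coercion bidual_eval : bidual >-> Funclass.

Lemma bidualD (xi : bidual) h k : xi (char_add h k) = xi h + xi k.
Proof. exact: (svalP xi). Qed.

Lemma bidual_ext (xi eta : bidual) : xi =1 eta -> xi = eta.
Proof. by move=> /funext; exact: eq_sig_hprop (fun _ _ _ => Prop_irrelevance _ _) _ _. Qed.

Lemma bidual0 (xi : bidual) : xi char_zero = 0.
Proof.
apply: (@addIr _ (xi char_zero)); rewrite -bidualD add0r; congr (xi _).
by apply: char_ext => m /=; rewrite addr0.
Qed.

Lemma bidualN (xi : bidual) h : xi (char_opp h) = - xi h.
Proof.
apply: (@addrI _ (xi h)); rewrite -bidualD subrr -(bidual0 xi); congr (xi _).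
by apply: char_ext => m /=; rewrite subrr.
Qed.

Lemma bidual_sum (xi : bidual) I (r : seq I) (P : pred I) (F : I -> char_group) h :
  (forall m, sval h m = \sum_(i <- r | P i) sval (F i) m) ->
  xi h = \sum_(i <- r | P i) xi (F i).
Proof.
elim: r h => [|i r IH] h hE.
  rewrite big_nil -(bidual0 xi); congr (xi _).
  by apply: char_ext => m /=; rewrite hE big_nil.
rewrite big_cons; case: ifPn => Pi; last first.
  by apply: IH => m; rewrite hE big_cons (negPf Pi).
rewrite -(IH (char_add h (char_opp (F i)))); last first.
  by move=> m; rewrite /= hE big_cons Pi addrC addKr.
rewrite -bidualD; congr (xi _); apply: char_ext => m /=.
by rewrite addrC subrK.
Qed.

Lemma bidual_add_subproof (xi eta : bidual) h k :
  xi (char_add h k) + eta (char_add h k) = (xi h + eta h) + (xi k + eta k).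
Proof. by rewrite !bidualD addrACA. Qed.
Definition bidual_add (xi eta : bidual) : bidual :=
  exist _ (fun h => xi h + eta h) (bidual_add_subproof xi eta).

Lemma bidual_zero_subproof (h k : char_group) : (0 : T) = 0 + 0.
Proof. by rewrite addr0. Qed.
Definition bidual_zero : bidual := exist _ (fun _ => 0) bidual_zero_subproof.

Lemma bidual_opp_subproof (xi : bidual) h k : - xi (char_add h k) = - xi h - xi k.
Proof. by rewrite bidualD opprD. Qed.
Definition bidual_opp (xi : bidual) : bidual := exist _ (fun h => - xi h) (bidual_opp_subproof xi).

Lemma bidual_scale_subproof a (xi : bidual) h k :
  xi (char_act a (char_add h k)) = xi (char_act a h) + xi (char_act a k).
Proof. by rewrite -bidualD; congr (xi _); apply: char_ext. Qed.
Definition bidual_scale a (xi : bidual) : bidual :=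
  exist _ (fun h => xi (char_act a h)) (bidual_scale_subproof a xi).

Lemma bidual_addA : associative bidual_add.
Proof. by move=> x y z; apply: bidual_ext => h; exact: addrA. Qed.
Lemma bidual_addC : commutative bidual_add.
Proof. by move=> x y; apply: bidual_ext => h; exact: addrC. Qed.
Lemma bidual_add0 : left_id bidual_zero bidual_add.
Proof. by move=> x; apply: bidual_ext => h; exact: add0r. Qed.
Lemma bidual_addN : left_inverse bidual_zero bidual_opp bidual_add.
Proof. by move=> x; apply: bidual_ext => h; exact: addNr. Qed.
HB.instance Definition _ :=
  GRing.isZmodule.Build bidual bidual_addA bidual_addC bidual_add0 bidual_addN.

Lemma bidual_scaleA a b xi : bidual_scale a (bidual_scale b xi) = bidual_scale (a * b) xi.
Proof.
apply: bidual_ext => h; rewrite /bidual_eval /=; congr (sval xi _).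
by apply: char_ext => m /=; rewrite scalerA.
Qed.
Lemma bidual_scale1 : left_id 1 bidual_scale.
Proof.
move=> xi; apply: bidual_ext => h; rewrite /bidual_eval /=; congr (sval xi _).
by apply: char_ext => m /=; rewrite scale1r.
Qed.
Lemma bidual_scaleDr : right_distributive bidual_scale +%R.
Proof. by move=> a x y; apply: bidual_ext. Qed.
Lemma bidual_scaleDl xi : {morph bidual_scale^~ xi : a b / a + b}.
Proof.
move=> a b; apply: bidual_ext => h; rewrite [RHS]/bidual_eval /=.
rewrite -[RHS]bidualD; congr (sval xi _).
by apply: char_ext => m /=; rewrite scalerDl (svalP h).
Qed.
HB.instance Definition _ := GRing.Zmodule_isLmodule.Build A bidual
  bidual_scaleA bidual_scale1 bidual_scaleDr bidual_scaleDl.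

Lemma bidual_evalD (xi eta : bidual) h : bidual_eval (xi + eta) h = xi h + eta h.
Proof. by []. Qed.

Lemma bidual_eval_sum I (r : seq I) (P : pred I) (F : I -> bidual) h :
  bidual_eval (\sum_(i <- r | P i) F i) h = \sum_(i <- r | P i) F i h.
Proof. exact: (big_morph (fun xi : bidual => xi h)). Qed.

Lemma bidual_evalZ a (xi : bidual) h : bidual_eval (a *: xi) h = xi (char_act a h).
Proof. by []. Qed.

Lemma to_bidual_subproof x (h k : char_group) : sval (char_add h k) x = sval h x + sval k x.
Proof. by []. Qed.
Definition to_bidual (x : M) : bidual :=
  exist _ (fun h => sval h x) (to_bidual_subproof x).

Lemma to_bidual_lin : lin to_bidual.
Proof.
move=> a u v; apply: bidual_ext => h.
by rewrite bidual_evalD bidual_evalZ /bidual_eval /= (svalP h).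
Qed.

Hypothesis T_div : divisible_group T.

(** A family of bidual elements indexed by [V] amounts to one additive map on the direct sum of [V]
    copies of the character group, which [dl] embeds in [G]. Each equation, tested on each
    character, prescribes this map at one point [ge]. Finite solvability makes the prescription
    single-valued, and divisibility of [T] extends it. *)
Theorem bidual_alg_compact : alg_compact bidual.
Proof.
move=> V E finE.
pose G : zmodType := V -> (M -> T).
pose dl (v : V) (h : char_group) : G := fun u => if `[< u = v >] then sval h else 0.
pose ge (e : (seq (V * A) * bidual) * char_group) : G :=
  \sum_(p <- e.1.1) dl p.1 (char_act p.2 e.2).
pose X : set (G * T) := [set x | exists F : seq ((seq (V * A) * bidual) * char_group),
  (forall e, List.In e F -> E e.1) /\
  x = (\sum_(e <- F) ge e, \sum_(e <- F) e.1.2 e.2)].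
have dlN v h : dl v (char_opp h) = - dl v h.
  apply/funext => u; apply/funext => m; rewrite /dl [RHS]/GRing.opp /=.
  by case: asboolP => _ //=; rewrite /GRing.opp /= oppr0.
have [|f [fD fX]] := @additive_extension G T T_div X.
  split.
  - by exists [::]; rewrite !big_nil.
  - move=> _ _ [F [FE ->]] [F' [F'E ->]].
    exists (F ++ map (fun e => (e.1, char_opp e.2)) F'); split.
      move=> e eFF; have [eF|eF] := In_cat eFF; first exact: FE.
      move/In_map: eF => [e' [<- e'F]].
      exact: (F'E e').
    rewrite -pairB !big_cat !big_map /= -!sumrN; congr (_ + _, _ + _); apply: eq_bigr => e _.
      rewrite /ge -sumrN; apply: eq_bigr => p _; rewrite /= -dlN; congr (dl _ _).
      by apply: char_ext.
    by rewrite bidualN.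
  - move=> _ [F [FE [geF ->]]].
    have [|s sE] := finE (map fst F).
      by move=> d /In_map[e [<- eF]]; exact: FE.
    pose L : seq ({classic V} * char_group) :=
      flatten [seq [seq (p.1 : {classic V}, char_act p.2 e.2) | p <- e.1.1] | e <- F].
    have -> : \sum_(e <- F) e.1.2 e.2 = \sum_(q <- L) bidual_eval (s q.1) q.2.
      rewrite big_flatten big_map /=.
      have: forall e, List.In e F -> lin_eval s e.1.1 = e.1.2.
        by move=> e eF; apply: (sE e.1); apply/In_map; exists e.
      elim: {FE geF sE L} F => [|e F IH] eF; first by rewrite !big_nil.
      rewrite !big_cons IH; last by move=> e' e'F; apply: eF; right.
      congr (_ + _); rewrite -eF; last by left.
      by rewrite /lin_eval bidual_eval_sum big_map.
    (* Read at the coordinate [v], this says that the characters attached to [v] add up to zero;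
       hence [s v] contributes nothing to the prescribed value. *)
    have dL : \sum_(q <- L) dl q.1 q.2 = 0.
      rewrite big_flatten big_map /= [RHS]geF; apply: eq_bigr => e _.
      by rewrite big_map.
    rewrite (@sum_by_key _ _ _ _ _ (undup (map fst L))) ?undup_uniq //; last first.
      by move=> v; rewrite mem_undup.
    rewrite big1 // => v _.
    transitivity (\sum_(p <- L | p.1 == v) bidual_eval (s v) p.2).
      by apply: eq_bigr => p /eqP ->.
    rewrite -(@bidual_sum (s v) _ L (fun p => p.1 == v) snd char_zero) ?bidual0 // => m /=.
    transitivity (\sum_(q <- L) dl q.1 q.2 v m).
      by have := congr1 (fun g : G => g v m) dL; rewrite /= !fct_sumE => ->.
    rewrite [RHS]big_mkcond /=; apply: eq_bigr => p _; rewrite /dl.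
    by rewrite eq_sym; case: eqP => vp; [rewrite asboolT|rewrite asboolF].
have sP v (h k : char_group) : f (dl v (char_add h k)) = f (dl v h) + f (dl v k).
  rewrite -fD; congr (f _); apply/funext => u; apply/funext => m; rewrite /dl.
  rewrite [RHS]/GRing.add /= [RHS]/GRing.add /=.
  by case: asboolP => // _; rewrite /GRing.zero /= addr0.
exists (fun v => exist _ (fun h => f (dl v h)) (sP v) : bidual) => -[l c] Elc /=.
apply: bidual_ext => h; rewrite /lin_eval bidual_eval_sum /=.
transitivity (f (ge ((l, c), h))).
  by rewrite /ge additive_map_sum.
apply: fX; exists [:: ((l, c), h)]; by rewrite !big_seq1; split=> // e [<-|[]].
Qed.

Hypothesis T_ne : exists t : T, t <> 0.
Hypothesis T_tor : forall n, (1 < n)%N -> exists t : T, t <> 0 /\ t *+ n = 0.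

(** Otherwise a character [f] of the group of right-hand sides kills the solvable ones but not [w].
    Its components [h j] satisfy, for each [i], that the [h j] acted on by [B i j] sum to zero;
    pairing them with a solution in the bidual forces [f w = 0]. *)
Theorem to_bidual_pure : pure_map to_bidual.
Proof.
move=> p q B w [y yw]; apply: contrapT => nw.
pose G : zmodType := 'I_q -> M.
pose H : set G := [set v | solvable B v].
have [||f [fD fH fw]] := additive_separation T_div T_ne T_tor (H := H) (g := w) _ _ nw.
- by exists (fun _ => 0) => j; rewrite big1 // => i _; rewrite scaler0.
- move=> u v [x xu] [z zv]; exists (fun i => x i - z i) => j.
  rewrite [RHS]/GRing.add /= [X in _ = _ + X]/GRing.opp /= -xu -zv -sumrB.
  by apply: eq_bigr => i _; rewrite scalerBr.
pose dl (j : 'I_q) (m : M) : G := fun k => if k == j then m else 0.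
have dlD j : additive_map (fun m => f (dl j m)).
  move=> m n; rewrite -fD; congr (f _); apply/funext => k; rewrite /dl [RHS]/GRing.add /=.
  by case: ifP => // _; rewrite addr0.
pose h j : char_group := exist _ _ (dlD j).
have f_dl (u : G) : f u = \sum_j f (dl j (u j)).
  rewrite -additive_map_sum //; congr (f _); apply/funext => k.
  rewrite fct_sumE (bigD1 k) //= /dl eqxx big1 ?addr0 // => j jk.
  by rewrite eq_sym (negPf jk).
apply: fw; rewrite f_dl.
transitivity (\sum_j \sum_i bidual_eval (y i) (char_act (B i j) (h j))).
  apply: eq_bigr => j _.
  have := congr1 (fun xi : bidual => bidual_eval xi (h j)) (yw j).
  by rewrite /= bidual_eval_sum => ->.
rewrite exchange_big big1 //= => i _.
rewrite -(@bidual_sum (y i) _ _ xpredT _ char_zero) ?bidual0 // => m /=.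
rewrite -(f_dl (fun j => B i j *: m)) fH //.
exists (fun k => if k == i then m else 0) => j.
rewrite (bigD1 i) //= eqxx big1 ?addr0 // => k ki.
by rewrite (negPf ki) scaler0.
Qed.

End Bidual.

Theorem exists_pure_alg_compact (A : nzRingType) (M : lmodType A) :
  exists (N : lmodType A) (j : M -> N), [/\ alg_compact N, lin j & pure_map j].
Proof.
have [T [T_div T_ne T_tor]] := exists_divisible_cogenerator.
exists (bidual T M), (@to_bidual A T M); split.
- exact: bidual_alg_compact.
- exact: to_bidual_lin.
- exact: to_bidual_pure.
Qed.

(** * Linear maps with prescribed values *)

Section HomLemma.
Variable A : nzRingType.
Implicit Types M N : lmodType A.

Lemma lin_eval_vars M (V : eqType) (s : V -> M) (l : seq (V * A)) v0 (vs : seq V) :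
  uniq vs -> {subset map fst l <= vs} ->
  lin_eval s l =
  \sum_(i < size vs) (\sum_(p <- l | p.1 == nth v0 vs i) p.2) *: s (nth v0 vs i).
Proof.
move=> uvs sub; rewrite /lin_eval (@sum_by_key _ _ _ _ _ vs) // (big_nth v0) big_mkord.
by apply: eq_bigr => i _; rewrite scaler_suml; apply: eq_bigr => p /eqP ->.
Qed.

(** The elements of [N] occurring in finitely many relations become the unknowns of a matrix system,
    which they solve themselves; the hypothesis carries its solvability over to [y]. *)
Lemma solution_of_finite M N (K : Type) (x : K -> N) (y : K -> M) :
  (forall p q (B : 'I_p -> 'I_q -> A) (D : 'I_q -> seq (K * A)),
     solvable B (fun j => lin_eval x (D j)) -> solvable B (fun j => lin_eval y (D j))) ->
  forall F : seq (seq (N * A) * seq (K * A)),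
    (forall e, List.In e F -> lin_eval id e.1 = lin_eval x e.2) ->
    exists s : N -> M, forall e, List.In e F -> lin_eval s e.1 = lin_eval y e.2.
Proof.
move=> xy F FE.
pose vs := undup (flatten [seq map fst e.1 | e <- F]).
have sub e : List.In e F -> {subset map fst e.1 <= vs}.
  rewrite /vs => eF v ve; rewrite mem_undup; elim: {FE vs} F eF => //= d F IH.
  by rewrite mem_cat => -[->|/IH ->]; rewrite ?ve ?orbT.
have uvs : uniq vs by exact: undup_uniq.
pose e0 : seq (N * A) * seq (K * A) := ([::], [::]).
have nth_In (j : 'I_(size F)) : List.In (nth e0 F j) F.
  case: j => j /=; elim: F {FE vs sub uvs} j => //= e F IH [|j] jF; [by left|right].
  exact: IH.
have [|z zE] := @xy (size vs) (size F)
    (fun i j => \sum_(p <- (nth e0 F j).1 | p.1 == nth 0 vs i) p.2)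
    (fun j => (nth e0 F j).2).
  exists (fun i => nth 0 vs i) => j; rewrite -FE //.
  by rewrite (@lin_eval_vars _ _ _ _ 0 vs) //; exact: sub.
pose s n : M := if insub (index n vs) is Some i then z i else 0.
have sE (i : 'I_(size vs)) : s (nth 0 vs i) = z i.
  by rewrite /s index_uniq // valK.
have idx e : exists j, List.In e F -> (j < size F)%N /\ nth e0 F j = e.
  have [eF|] := pselect (List.In e F); last by exists 0%N.
  elim: F eF {FE vs sub uvs nth_In z zE s sE} => //= d F IH [->|eF]; first by exists 0%N.
  by have [j jP] := IH eF; exists j.+1 => _; exact: jP.
have [j_of j_ofP] := choice idx.
exists s => e eF; have [jF jE] := j_ofP e eF.
rewrite -jE -(zE (Ordinal jF)) /= jE (@lin_eval_vars _ _ _ _ 0 vs) //; last exact: sub.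
by apply: eq_bigr => i _; rewrite sE.
Qed.

(** Take one unknown in [M] for each element of [N], and one equation for each linear relation
    between elements of [N] and the parameters [x]. The hypothesis, that pp-conditions true of [x]
    hold of [y], makes this system finitely solvable. Linearity and the prescribed values are among
    its equations. *)
Theorem exists_lin M N (K : Type) (x : K -> N) (y : K -> M) : alg_compact M ->
  (forall p q (B : 'I_p -> 'I_q -> A) (D : 'I_q -> seq (K * A)),
     solvable B (fun j => lin_eval x (D j)) -> solvable B (fun j => lin_eval y (D j))) ->
  exists f : N -> M, lin f /\ forall k, f (x k) = y k.
Proof.
move=> cM xy.
have [|s sE] := cM N [set e | exists d, lin_eval id e.1 = lin_eval x d /\ e.2 = lin_eval y d].
  move=> F FE.
  have [F' F'E ->] : exists2 F' : seq (seq (N * A) * seq (K * A)),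
      (forall e, List.In e F' -> lin_eval id e.1 = lin_eval x e.2)
      & F = map (fun e => (e.1, lin_eval y e.2)) F'.
    elim: F FE => [|[l c] F IH] FE; first by exists [::].
    have [|F' F'E ->] := IH; first by move=> e' e'F; apply: FE; right.
    have [|d /= [ld ->]] := FE (l, c); first by left.
    by exists ((l, d) :: F') => // e'' /= [<-|/F'E].
  have [s sF'] := solution_of_finite xy F'E.
  by exists s => e /In_map[e' [<- e'F]] /=; rewrite sF'.
exists s; split.
- move=> a u v.
  have := sE ([:: (a *: u + v, 1); (u, - a); (v, -1)], 0).
  rewrite /lin_eval !big_cons !big_nil /= !addr0 !scaleN1r !scale1r !scaleNr.
  move=> e; apply/eqP; rewrite -subr_eq0 opprD; apply/eqP/e; exists [::].
  rewrite /lin_eval !big_cons !big_nil /= addr0 !scaleN1r scale1r scaleNr.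
  by rewrite -opprD subrr.
- move=> k; have := sE ([:: (x k, 1)], y k).
  rewrite /lin_eval big_seq1 /= scale1r; apply.
  by exists [:: (k, 1)]; rewrite /lin_eval !big_seq1 /= !scale1r.
Qed.

End HomLemma.

(** * Pure-injective modules are the algebraically compact ones *)

Section PureInjective.
Variable R : nzRingType.
Implicit Types M N : rmodType R.

Lemma pp_solP n (phi : pp_formula R n) M (x : 'rV[M]_n) :
  pp_sol phi x <->
  solvable (A := R^c) (M := M) (fun i j => pp_mx phi (lshift n i) j)
    (fun j => - \sum_k (pp_mx phi (rshift _ k) j : R^c) *: x 0 k).
Proof.
have E (y : 'rV[M]_(pp_bound phi)) j : row_mulmx (row_mx y x) (pp_mx phi) 0 j =
    \sum_i (pp_mx phi (lshift n i) j : R^c) *: y 0 i +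
    \sum_k (pp_mx phi (rshift _ k) j : R^c) *: x 0 k.
  rewrite mxE big_split_ord /=; congr (_ + _); apply: eq_bigr => i _.
    by rewrite row_mxEl.
  by rewrite row_mxEr.
split=> [[y y0]|[y yE]].
  exists (fun i => y 0 i) => j; apply/eqP; rewrite -addr_eq0 -E y0.
  by rewrite mxE.
exists (\row_i y i); apply/rowP => j; rewrite E mxE.
apply/eqP; rewrite addr_eq0 -yE; apply/eqP/eq_bigr => i _.
by rewrite mxE.
Qed.

Lemma pure_embeddingP M N (f : {linear M -> N}) : pure_embedding f <-> pure_map f.
Proof.
split=> [[_ pf] p q B w sw|pf].
  (* The block [-1] turns the free variables into the right-hand sides of the system. *)
  pose phi := @PPFormula R q p q (col_mx (\matrix_(i, j) B i j) (- 1%:M)).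
  have phiE (L : rmodType R) (u : 'rV[L]_q) : pp_sol phi u <-> solvable (M := L) B (u 0).
    rewrite pp_solP /=.
    have -> : (fun i j => col_mx (\matrix_(i, j) B i j) (- 1%:M) (lshift q i) j) = B.
      by apply/funext => i; apply/funext => j; rewrite col_mxEu mxE.
    have -> // : (fun j => - \sum_k (col_mx (\matrix_(i, j) B i j) (- 1%:M) (rshift p k) j
        : R^c) *: u 0 k) = (u 0 : 'I_q -> L).
      apply/funext => j; rewrite (bigD1 j) //= big1 => [|k kj].
        by rewrite addr0 col_mxEd !mxE eqxx scaleN1r opprK.
      by rewrite col_mxEd !mxE (negPf kj) oppr0 scale0r.
  have := pf q phi (\row_j w j).
  rewrite !phiE.
  have -> : (map_mx f (\row_j w j) 0 : 'I_q -> N) = f \o w.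
    by apply/funext => j; rewrite !mxE.
  have -> : ((\row_j w j) 0 : 'I_q -> M) = w by apply/funext => j; rewrite !mxE.
  exact.
split; first exact: pure_map_inj (linear_lin f) pf.
move=> n phi x; rewrite !pp_solP => sx; apply: pf; move: sx.
have -> // : (fun j => - \sum_k (pp_mx phi (rshift (pp_bound phi) k) j : R^c) *: map_mx f x 0 k) =
    f \o (fun j => - \sum_k (pp_mx phi (rshift (pp_bound phi) k) j : R^c) *: x 0 k).
apply/funext => j /=; rewrite linearN; congr (- _); rewrite linear_sum.
by apply: eq_bigr => k _; rewrite mxE linearZ.
Qed.

(** Forward, a pure embedding into an algebraically compact module splits, and compactness passes to
    retracts. Backward, the retraction is the map sending [f x] to [x], obtained from [exists_lin];
    purity is exactly its hypothesis. *)
Theorem pure_injectiveP N : pure_injective N <-> alg_compact N.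
Proof.
split=> [pN|cN M f /pure_embeddingP pf].
  have [D [j [cD lj pj]]] := exists_pure_alg_compact N.
  have [j' j'E] := lin_linear lj.
  have [|g gj] := pN D j'.
    by apply/pure_embeddingP; have -> : (j' : N -> D) = j by apply/funext.
  exact: (alg_compact_retract (linear_lin j') (linear_lin g) gj cD).
have [|g [lg gf]] := @exists_lin _ N M N f id cN.
  move=> p q B D sB; apply: pf; move: sB.
  have -> // : (fun j => lin_eval f (D j)) = f \o (fun j => lin_eval id (D j)).
  by apply/funext => j /=; rewrite -(lin_eval_lin _ _ (linear_lin f)).
by have [g' g'E] := lin_linear lg; exists g' => x; rewrite g'E gf.
Qed.

End PureInjective.

(** * Compactness of solution sets and idempotent endomorphisms *)

Lemma dep_choice (K : Type) (T : K -> Type) (P : forall k, T k -> Prop) :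
  (forall k, exists x, P k x) -> exists f : forall k, T k, forall k, P k (f k).
Proof. by move=> ex; exists (fun k => projT1 (cid (ex k))) => k; case: (cid _). Qed.

Section Closed.
Variables (A : nzRingType) (M : lmodType A).

Definition sum_fun (V W : Type) (s : V -> M) (t : W -> M) (z : V + W) : M :=
  match z with inl v => s v | inr w => t w end.

(* Projections of solution sets of linear systems play the role of compact sets. *)
Definition lin_closed (V : Type) (S : set (V -> M)) : Prop :=
  exists (W : Type) (E : set (seq ((V + W) * A) * M)), forall s,
    S s <-> exists t : W -> M, forall e, E e -> lin_eval (sum_fun s t) e.1 = e.2.

Definition lin_rename (V W : Type) (u : V -> W) (l : seq (V * A)) : seq (W * A) :=
  map (fun p => (u p.1, p.2)) l.

Lemma lin_eval_rename (V W : Type) (u : V -> W) (s : W -> M) l :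
  lin_eval s (lin_rename u l) = lin_eval (s \o u) l.
Proof. by rewrite /lin_eval big_map. Qed.

Lemma lin_closed_ext (V : Type) (S S' : set (V -> M)) :
  (forall s, S s <-> S' s) -> lin_closed S -> lin_closed S'.
Proof.
by move=> SS' [W [E SE]]; exists W, E => s; rewrite -SS'.
Qed.

Lemma lin_closed_eq (V : Type) (l : seq (V * A)) c : lin_closed [set s | lin_eval s l = c].
Proof.
exists void, [set (lin_rename inl l, c)] => s /=; split=> [sl|[t /(_ _ erefl)]].
  exists (fun v : void => match v with end) => _ -> /=.
  by rewrite lin_eval_rename.
by rewrite /= lin_eval_rename.
Qed.

Lemma lin_closed_bigcap (V K : Type) (S : K -> set (V -> M)) :
  (forall k, lin_closed (S k)) -> lin_closed [set s | forall k, S k s].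
Proof.
move=> clS; have [W WP] := dep_choice clS; have [E EP] := dep_choice WP.
(* Each condition keeps its own auxiliary variables, tagged by [k]; only the variables in [V] are
   shared. *)
pose u k (z : V + W k) : V + {k & W k} :=
  match z with inl v => inl v | inr w => inr (existT _ k w) end.
exists {k & W k}, [set e | exists k e', E k e' /\ e = (lin_rename (u k) e'.1, e'.2)] => s /=.
split=> [sS|[t tE] k].
  have /dep_choice[t tE] k := (EP k s).1 (sS k).
  exists (fun z => t (projT1 z) (projT2 z)) => _ [k [e [Ee ->]]] /=.
  rewrite lin_eval_rename -(tE k e) //; congr lin_eval.
  by apply/funext => -[].
apply/(EP k s); exists (fun w => t (existT _ k w)) => e Ee.
have := tE (lin_rename (u k) e.1, e.2); rewrite /= lin_eval_rename => <-; last by exists k, e.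
by congr lin_eval; apply/funext => -[].
Qed.

Lemma lin_closedI (V : Type) (S S' : set (V -> M)) :
  lin_closed S -> lin_closed S' -> lin_closed [set s | S s /\ S' s].
Proof.
move=> cS cS'.
have cb : lin_closed [set s | forall b : bool, (if b then S else S') s].
  by apply: lin_closed_bigcap => -[].
apply: (lin_closed_ext _ cb).
by move=> s; split=> [SS'|[Ss S's] []//]; split; [exact: (SS' true)|exact: (SS' false)].
Qed.

Lemma lin_closed_preim (V V' : Type) (u : V' -> V) (S : set (V' -> M)) :
  lin_closed S -> lin_closed [set s : V -> M | S (s \o u)].
Proof.
move=> [W [E SE]].
pose r (z : V' + W) : V + W := match z with inl v => inl (u v) | inr w => inr w end.
have rE (s : V -> M) (t : W -> M) : sum_fun s t \o r = sum_fun (s \o u) t.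
  by apply/funext => -[].
exists W, [set e | exists e', E e' /\ e = (lin_rename r e'.1, e'.2)] => s /=.
rewrite SE; split=> -[t tE]; exists t.
  by move=> _ [e [Ee ->]] /=; rewrite lin_eval_rename rE tE.
move=> e Ee; have := tE (lin_rename r e.1, e.2).
by rewrite /= lin_eval_rename rE; apply; exists e.
Qed.

Lemma lin_closed_proj (V U : Type) (S : set (V + U -> M)) :
  lin_closed S -> lin_closed [set s : V -> M | exists t : U -> M, S (sum_fun s t)].
Proof.
move=> [W [E SE]].
pose r (z : (V + U) + W) : V + (U + W) :=
  match z with inl (inl v) => inl v | inl (inr u) => inr (inl u) | inr w => inr (inr w) end.
have rE (s : V -> M) (t : U -> M) (w : W -> M) :
    sum_fun s (sum_fun t w) \o r = sum_fun (sum_fun s t) w.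
  by apply/funext => -[[]|].
exists (U + W)%type, [set e | exists e', E e' /\ e = (lin_rename r e'.1, e'.2)] => s /=.
split=> [[t /SE[w wE]]|[t' tE]].
  exists (sum_fun t w) => _ [e [Ee ->]] /=.
  by rewrite lin_eval_rename rE wE.
exists (t' \o inl); apply/SE; exists (t' \o inr) => e Ee.
have := tE (lin_rename r e.1, e.2); rewrite /= lin_eval_rename => <-; last by exists e.
by congr lin_eval; apply/funext => -[[]|].
Qed.

Hypothesis cM : alg_compact M.

(** All the defining systems together form one system. As auxiliary variables are not shared, a
    common [s] for finitely many indices solves any finite part of it. *)
Theorem lin_closed_compact (V K : Type) (S : K -> set (V -> M)) :
  (forall k, lin_closed (S k)) ->
  (forall ks : seq K, exists s, forall k, List.In k ks -> S k s) ->
  exists s, forall k, S k s.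
Proof.
move=> clS finS; have [W WP] := dep_choice clS; have [E EP] := dep_choice WP.
pose u k (z : V + W k) : V + {k & W k} :=
  match z with inl v => inl v | inr w => inr (existT _ k w) end.
have [|t tE] := cM (E := [set e | exists k e', E k e' /\ e = (lin_rename (u k) e'.1, e'.2)]).
  move=> F FE.
  have [ks ksP] : exists ks : seq K, forall e, List.In e F ->
      exists k e', [/\ List.In k ks, E k e' & e = (lin_rename (u k) e'.1, e'.2)].
    elim: F FE => [|e F IH] FE; first by exists [::].
    have [|ks ksP] := IH; first by move=> e' e'F; apply: FE; right.
    have [|k [e' [Ee' eE]]] := FE e; first by left.
    exists (k :: ks) => e'' /= [<-|/ksP[k' [e3 [k'ks Ee3 ->]]]].
      by exists k, e'; split=> //; left.
    by exists k', e3; split=> //; right.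
  have [s sP] := finS ks.
  (* Membership of [s] in [S k] is known only for [k] in [ks]; for other [k] the auxiliary values
     may be junk. *)
  have ex k : exists t : W k -> M, S k s ->
      forall e, E k e -> lin_eval (sum_fun s t) e.1 = e.2.
    have [/(EP k s)[t tE]|nS] := pselect (S k s); first by exists t.
    by exists (fun _ => 0).
  have [t tE] := dep_choice ex.
  exists (sum_fun s (fun z => t (projT1 z) (projT2 z))) => e /ksP[k [e' [kks Ee' ->]]] /=.
  rewrite lin_eval_rename -(tE k (sP k kks) e') //; congr lin_eval.
  by apply/funext => -[].
exists (t \o inl) => k; apply/(EP k); exists (fun w => t (inr (existT _ k w))) => e Ee.
have := tE (lin_rename (u k) e.1, e.2); rewrite /= lin_eval_rename => <-; last by exists k, e.
by congr lin_eval; apply/funext => -[].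
Qed.

(** Zorn for reverse inclusion: compactness keeps the intersection of a nonempty chain inhabited.
    [Phi] will be closure under composition, or being a left ideal. *)
Lemma exists_minimal_lin_closed (V : Type) (Phi : set (V -> M) -> Prop) (S0 : set (V -> M)) :
  (forall F : set (set (V -> M)), (exists S, F S) -> (forall S, F S -> Phi S) ->
     Phi [set s | forall S, F S -> S s]) ->
  lin_closed S0 -> S0 !=set0 -> Phi S0 ->
  exists S, [/\ lin_closed S, S !=set0, Phi S, S `<=` S0
    & forall S', lin_closed S' -> S' !=set0 -> Phi S' -> S' `<=` S -> S' = S].
Proof.
move=> Phi_cap clS0 neS0 PS0.
pose good (S : set (V -> M)) := [/\ lin_closed S, S !=set0, Phi S & S `<=` S0].
pose X := {S | good S}.
have gS0 : good S0 by split.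
pose le (S S' : X) := `[< sval S' `<=` sval S >].
have [|||F Ftot|S Smin] := @Zorn X le.
- by move=> S; apply/asboolP.
- by move=> S S' S'' /asboolP h /asboolP k; apply/asboolP => s /k /h.
- move=> [S gS] [S' gS'] /asboolP /= h /asboolP /= k.
  by apply/eq_exist/seteqP; split.
- have [[C0 FC0]|F0] := pselect (exists C, F C); last first.
    by exists (exist _ S0 gS0) => S FS; case: F0; exists S.
  pose I := {C : X | F C}.
  have lower (ks : seq I) : exists k0 : I, forall k, List.In k ks ->
      sval (sval k0) `<=` sval (sval k).
    elim: ks => [|k ks [k0 k0P]]; first by exists (exist _ C0 FC0).
    have [/asboolP h|/asboolP h] := Ftot _ _ (svalP k) (svalP k0).
      by exists k0 => k' [<-//|/k0P].
    exists k => k' [<-//|/k0P]; exact: subset_trans.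
  have clC (k : I) : lin_closed (sval (sval k)) by case: (svalP (sval k)).
  have capE : [set s | forall k : I, sval (sval k) s] =
      [set s | forall S, [set sval (C : X) | C in F] S -> S s].
    apply/seteqP; split=> s /= sk; first by move=> _ [C FC <-]; exact: (sk (exist _ C FC)).
    by move=> [C FC]; apply: sk; exists C.
  have gC : good [set s | forall k : I, sval (sval k) s].
    split.
    - exact: lin_closed_bigcap.
    - apply: lin_closed_compact => // ks; have [k0 k0P] := lower ks.
      by have [_ [s k0s] _ _] := svalP (sval k0); exists s => k /k0P; exact.
    - rewrite capE; apply: Phi_cap; first by exists (sval C0), C0.
      by move=> _ [C _ <-]; case: (svalP C).
    - move=> s /(_ (exist _ C0 FC0)) /=; by case: (svalP C0) => _ _ _; apply.
  exists (exist _ _ gC) => C FC; apply/asboolP => s /=.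
  exact: (fun h => h (exist _ C FC)).
case: S Smin => S gS Smin; case: (gS) => clS neS PS SS0; exists S; split=> // S' clS' neS' PS' S'S.
have gS' : good S' by split=> // s /S'S /SS0.
have := Smin (exist _ S' gS'); rewrite /le /= => /(_ (asboolT S'S)).
by move=> /(congr1 sval).
Qed.

Definition comp_closed (S : set (M -> M)) : Prop := forall f g, S f -> S g -> S (f \o g).

(** The variables are the values of a map, and [s \o a] at [m] is the value of [s] at [a m]; so
    right composition acts on linear systems even for nonlinear [a]. Left composition is not of this
    form, which is why left ideals [S \o a] are used below. *)
Lemma lin_closed_comp (S : set (M -> M)) (a : M -> M) :
  lin_closed S -> lin_closed [set t : M -> M | exists2 s, S s & t = s \o a].
Proof.
move=> cS.
have cp : lin_closed [set t | exists s : M -> M, S (sum_fun t s \o inr) /\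
    (forall m, lin_eval (sum_fun t s) [:: (inl m, 1); (inr (a m), -1)] = 0)].
  apply: (lin_closed_proj (V := M) (U := M) (S := [set z : M + M -> M | S (z \o inr) /\
    (forall m, lin_eval z [:: (inl m, 1); (inr (a m), -1)] = 0)])).
  apply: lin_closedI; first exact: lin_closed_preim.
  by apply: lin_closed_bigcap => m; exact: lin_closed_eq.
apply: (lin_closed_ext _ cp).
move=> t /=; split=> [[s [Ss st]]|[s Ss ->]].
  exists s => //; apply/funext => m; have := st m.
  rewrite /lin_eval !big_cons big_nil /= addr0 scale1r scaleN1r => /eqP.
  by rewrite subr_eq0 => /eqP.
exists s; split=> // m.
by rewrite /lin_eval !big_cons big_nil /= addr0 scale1r scaleN1r subrr.
Qed.

Lemma lin_closed_fix (S : set (M -> M)) (a b : M -> M) :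
  lin_closed S -> lin_closed [set s : M -> M | S s /\ s \o a = b].
Proof.
move=> cS; have := lin_closedI cS (@lin_closed_bigcap M M
  (fun m => [set s | lin_eval s [:: (a m, 1)] = b m]) (fun m => lin_closed_eq _ _)).
apply/lin_closed_ext => s /=.
have E m : lin_eval s [:: (a m, 1)] = s (a m) by rewrite /lin_eval big_seq1 scale1r.
split=> -[Ss sa]; split=> //; first by apply/funext => m; rewrite -sa E.
by move=> m; rewrite E -sa.
Qed.

(* The Ellis-Numakura lemma. *)
Theorem exists_idempotent (S : set (M -> M)) : lin_closed S -> S !=set0 -> comp_closed S ->
  exists2 e, S e & e \o e = e.
Proof.
move=> cS neS SS.
have [||||B [cB [a Ba] BB BS Bmin]] := @exists_minimal_lin_closed M comp_closed S => //.
  by move=> F _ Fcomp f g Ff Fg C FC; apply: Fcomp => //; [exact: Ff|exact: Fg].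
(* Minimality gives [B \o a = B], so some [s] in [B] satisfies [s \o a = a]. Such [s] form a closed
   subsemigroup, hence all of [B], and [a] itself is one of them. *)
have BaB : [set t | exists2 s, B s & t = s \o a] = B.
  apply: Bmin; first exact: lin_closed_comp.
  - by exists (a \o a), a.
  - move=> _ _ [s Bs ->] [t Bt ->]; exists (s \o a \o t) => //.
    by apply: (BB) => //; exact: BB.
  - by move=> _ [s Bs ->]; exact: BB.
have fixB : [set s | B s /\ s \o a = a] = B.
  apply: Bmin; first exact: lin_closed_fix.
  - have : B a := Ba.
    by rewrite -{1}BaB => -[s Bs sa]; exists s.
  - move=> s t [Bs sa] [Bt ta]; split; first exact: BB.
    by rewrite -[RHS]sa -[in RHS]ta.
  - by move=> s [].
exists a; first exact: BS.
have : B a := Ba.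
by rewrite -{1}fixB => -[].
Qed.

(* An idempotent in a minimal left ideal. *)
Theorem exists_minimal_idempotent (S : set (M -> M)) :
  lin_closed S -> S !=set0 -> comp_closed S ->
  exists e, [/\ S e, e \o e = e & forall h, S h -> exists2 r, S r & r \o h \o e = e].
Proof.
move=> cS neS SS.
pose ideal (L : set (M -> M)) := L `<=` S /\ forall s l, S s -> L l -> L (s \o l).
have [||||L [cL neL [LS SL] _ Lmin]] := @exists_minimal_lin_closed M ideal S => //.
- move=> F [C FC] Fid; split; first by move=> s /(_ _ FC); case: (Fid _ FC) => CS _; exact: CS.
  by move=> s l Ss Fl C' FC'; case: (Fid _ FC') => _; apply => //; exact: Fl.
- by split=> // s l; exact: SS.
have [e Le ee] : exists2 e, L e & e \o e = e.
  by apply: exists_idempotent => // f g Lf Lg; apply: SL => //; exact: LS.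
exists e; split=> //; first exact: LS.
move=> h Sh.
(* The left ideal generated by [h \o e] lies in the minimal one, so it contains [e]. *)
have : [set t | exists2 s, S s & t = s \o (h \o e)] = L.
  apply: Lmin; first exact: lin_closed_comp.
  - by case: neS => s Ss; exists (s \o (h \o e)), s.
  - split; first by move=> _ [s Ss ->]; apply: SS => //; apply: LS; exact: SL.
    by move=> s _ Ss [t St ->]; exists (s \o t) => //; exact: SS.
  - by move=> _ [s Ss ->]; apply: (SL) => //; exact: SL.
by move=> LE; move: (Le); rewrite -LE => -[r Sr re]; exists r.
Qed.

End Closed.

(** * Endomorphisms of indecomposable algebraically compact modules *)

Section Endomorphisms.
Variables (A : nzRingType) (M : lmodType A).

Lemma lin_closed_lin (N : lmodType A) : lin_closed [set f : N -> M | lin f].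
Proof.
have cb : lin_closed [set f : N -> M | forall k : A * N * N,
    lin_eval f [:: (k.1.1 *: k.1.2 + k.2, 1); (k.1.2, - k.1.1); (k.2, -1)] = 0].
  by apply: lin_closed_bigcap => k; exact: lin_closed_eq.
apply: (lin_closed_ext _ cb) => f /=.
have E a u v : lin_eval f [:: (a *: u + v, 1); (u, - a); (v, -1)] =
    f (a *: u + v) - (a *: f u + f v).
  by rewrite /lin_eval !big_cons big_nil /= addr0 scale1r scaleN1r scaleNr opprD.
split=> [h a u v|h [[a u] v]].
  by apply/eqP; rewrite -subr_eq0 -E; apply/eqP/(h (a, u, v)).
by rewrite E h subrr.
Qed.

Definition indec : Prop := (exists x : M, x <> 0) /\
  forall e : M -> M, lin e -> e \o e = e -> (forall x, e x = 0) \/ (forall x, e x = x).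

Hypothesis cM : alg_compact M.

(* The exchange property of [End M]: the maps [a] in the left ideal of [f] with
   [1 - a] in the left ideal of [1 - f] form a closed semigroup, since
   [1 - a a' = (1 - a) + a (1 - a')]. *)
Theorem exchange_idempotent (f : M -> M) : lin f -> exists s t : M -> M,
  [/\ lin s, lin t, (s \o f) \o (s \o f) = s \o f & forall x, x - s (f x) = t (x - f x)].
Proof.
move=> lf.
pose X := [set a : M -> M | exists s t : M -> M,
  [/\ lin s, lin t, a = s \o f & forall x, x - a x = t (x - f x)]].
have cX : lin_closed X.
  have cb : lin_closed [set a : M -> M | exists st : M + M -> M,
      (lin (sum_fun a st \o (inr \o inl)) /\ lin (sum_fun a st \o (inr \o inr))) /\
      ((forall x, lin_eval (sum_fun a st) [:: (inl x, 1); (inr (inl (f x)), -1)] = 0) /\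
       (forall x, lin_eval (sum_fun a st) [:: (inl x, 1); (inr (inr (x - f x)), 1)] = x))].
    apply: (lin_closed_proj (V := M) (U := M + M) (S := [set z : M + (M + M) -> M |
      (lin (z \o (inr \o inl)) /\ lin (z \o (inr \o inr))) /\
      ((forall x, lin_eval z [:: (inl x, 1); (inr (inl (f x)), -1)] = 0) /\
       (forall x, lin_eval z [:: (inl x, 1); (inr (inr (x - f x)), 1)] = x))])).
    do 2 apply: lin_closedI.
    - exact: (lin_closed_preim (S := [set f : M -> M | lin f]) _ (@lin_closed_lin M)).
    - exact: (lin_closed_preim (S := [set f : M -> M | lin f]) _ (@lin_closed_lin M)).
    - by apply: lin_closed_bigcap => m; exact: lin_closed_eq.
    - by apply: lin_closed_bigcap => m; exact: lin_closed_eq.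
  apply: (lin_closed_ext _ cb) => a /=; split.
    move=> [st [[ls lt] [sE tE]]]; exists (st \o inl), (st \o inr); split=> //.
      apply/funext => x; have := sE x.
      rewrite /lin_eval !big_cons big_nil /= addr0 scale1r scaleN1r => /eqP.
      by rewrite subr_eq0 => /eqP.
    move=> x; have := tE x; rewrite /lin_eval !big_cons big_nil /= addr0 !scale1r => {1}<-.
    by rewrite addrC addKr.
  move=> [s [t [ls lt aE tE]]]; exists (sum_fun s t); split=> //; split=> x.
    by rewrite /lin_eval !big_cons big_nil /= addr0 scale1r scaleN1r aE subrr.
  by rewrite /lin_eval !big_cons big_nil /= addr0 !scale1r -tE addrC subrK.
have [||e [s [t [ls lt eE te]]] ee] := exists_idempotent cM cX.
- by exists f, id, id; split.
- move=> a a' [s [t [ls lt aE ta]]] [s' [t' [ls' lt' aE' ta']]].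
  exists (a \o s'), (fun x => t x + a (t' x)); split.
  + by apply: lin_comp => //; rewrite aE; exact: lin_comp.
  + apply: lin_add => //; apply: lin_comp => //; rewrite aE; exact: lin_comp.
  + by rewrite aE'.
  + move=> x; rewrite -ta -ta' /=.
    have -> : a (x - a' x) = a x - a (a' x) by apply: linB; rewrite aE; exact: lin_comp.
    by rewrite addrA subrK.
by rewrite eE in ee te; exists s, t; split.
Qed.

Hypothesis iM : indec.

(** The idempotent [s \o f] of the exchange property is 0 or 1. If it is 1, [s] is a left inverse of
    [f]; if it is 0, [t] is one of [1 - f]. *)
Theorem indec_local (f : M -> M) : lin f -> exists g, lin g /\
  ((forall x, g (f x) = x) \/ (forall x, g (x - f x) = x)).
Proof.
move=> lf; have [s [t [ls lt ee te]]] := exchange_idempotent lf.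
have [e0|e1] := iM.2 _ (lin_comp lf ls) ee; last by exists s; split=> //; left.
by exists t; split=> //; right=> x; rewrite -te [s _](e0 x) subr0.
Qed.

(** [f \o g] is idempotent, and it cannot vanish because [f] is injective on a nonzero module. *)
Lemma indec_left_inverse (f g : M -> M) : lin f -> lin g -> cancel f g -> cancel g f.
Proof.
move=> lf lg fg; have [|e0|e1 x] := iM.2 _ (lin_comp lg lf); last exact: e1.
  by apply/funext => x /=; rewrite fg.
have [x x0] := iM.1; case: x0.
by have := e0 (f x); rewrite /= fg => fx0; rewrite -(fg x) fx0 lin0.
Qed.

(** [1 - f] kills [x], so it has no left inverse, and locality leaves only [f]. *)
Theorem indec_fix_bij (f : M -> M) x : lin f -> f x = x -> x <> 0 ->
  exists g, [/\ lin g, cancel f g & cancel g f].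
Proof.
move=> lf fx x0; have [g [lg [fg|fg]]] := indec_local lf.
  by exists g; split=> //; exact: indec_left_inverse.
by have := fg x; rewrite fx subrr lin0 // => /esym.
Qed.

End Endomorphisms.

Section Indecomposable.
Variable R : nzRingType.
Implicit Type M : rmodType R.

Lemma indecomposableP M : indecomposable M <-> indec M.
Proof.
split=> [[M0 Mi]|[[x x0] Mi]].
  split.
    apply: contrapT => nx; apply: M0; apply/seteqP; split=> x //= _.
    by apply: contrapT => x0; apply: nx; exists x.
  move=> e le ee.
  have eE x : e (e x) = e x by exact: (congr1 (fun f => f x) ee).
  have [|||x|e0|e1] := Mi [set x | e x = x] [set x | e x = 0].
  - split=> [|x y /= ex ey|r x /= ex]; first exact: (lin0 le).
      by rewrite (linD le) ex ey.
    by rewrite (linZ _ le) ex.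
  - split=> [|x y /= ex ey|r x /= ex]; first exact: (lin0 le).
      by rewrite (linD le) ex ey addr0.
    by rewrite (linZ _ le) ex scaler0.
  - apply/seteqP; split=> x /=; first by move=> [ex e0]; rewrite -ex.
    by move=> ->; rewrite lin0.
  - by exists (e x), (x - e x); split=> /=; rewrite ?(linB le) ?eE ?subrr // addrC subrK.
  - by left=> x; have : [set x | e x = x] (e x) := eE x; rewrite e0.
  - right=> x; have : [set x | e x = 0] (x - e x) by rewrite /= linB // eE subrr.
    by rewrite e1 /= => /eqP; rewrite subr_eq0 => /eqP.
split; first by move=> M0; have : [set: M] x by []; rewrite M0.
move=> P Q sP sQ PQ sumPQ.
have [P0 PD PZ] := sP; have [Q0 QD QZ] := sQ.
have QN y : Q y -> Q (- y) by move=> Qy; rewrite -scaleN1r; exact: QZ.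
have PN y : P y -> P (- y) by move=> Py; rewrite -scaleN1r; exact: PZ.
have uniq_dec a b a' b' : P a -> Q b -> P a' -> Q b' -> a + b = a' + b' -> a = a'.
  move=> Pa Qb Pa' Qb' e; apply/eqP; rewrite -subr_eq0; apply/eqP.
  have ab : a - a' = b' - b.
    by apply/eqP; rewrite subr_eq addrAC eq_sym subr_eq e addrC.
  have : (P `&` Q) (a - a').
    by split; [apply: PD => //; exact: PN|rewrite ab; apply: QD => //; exact: QN].
  by rewrite PQ.
have ex y : exists a, P a /\ Q (y - a).
  by have [a [b [Pa Qb ->]]] := sumPQ y; exists a; split=> //; rewrite addrC addKr.
have [e eP] := choice ex.
have eE a b : P a -> Q b -> e (a + b) = a.
  move=> Pa Qb; have [Pe Qe] := eP (a + b).
  by apply: (@uniq_dec _ ((a + b) - e (a + b)) _ b) => //; rewrite addrC subrK.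
have le : lin e.
  move=> r u v; have [Pu Qu] := eP u; have [Pv Qv] := eP v.
  rewrite -[u in LHS](subrK (e u)) -[v in LHS](subrK (e v)).
  have -> : r *: (u - e u + e u) + (v - e v + e v) =
      (r *: e u + e v) + (r *: (u - e u) + (v - e v)).
    by rewrite scalerDr addrACA addrC.
  by apply: eE; [apply: PD => //; exact: PZ|apply: QD => //; exact: QZ].
have ee : e \o e = e.
  by apply/funext => y /=; rewrite -[X in e X]addr0 eE //; case: (eP y).
have [e0|e1] := Mi _ le ee; [left|right]; apply/seteqP; split=> y /=; try by move=> ->.
  by move=> Py; rewrite -(eE y 0 Py Q0) addr0 e0.
by move=> Qy; rewrite -(e1 y) -[X in e X]add0r eE.
Qed.

End Indecomposable.

(** * Modules over a valued ring *)

Definition ract (R : nzRingType) (M : rmodType R) (x : M) (a : R) : M := (a : R^c) *: x.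
Notation "x \@ a" := (ract x a) (at level 40, left associativity).

Section RightAction.
Variable R : nzRingType.
Implicit Types (M N : rmodType R) (a b : R).

Lemma ractA M (x : M) a b : x \@ a \@ b = x \@ (a * b).
Proof. by rewrite /ract scalerA. Qed.
Lemma ract1 M (x : M) : x \@ 1 = x.
Proof. exact: scale1r. Qed.
Lemma ract0 M (x : M) : x \@ 0 = 0.
Proof. exact: scale0r. Qed.
Lemma ract0l M a : (0 : M) \@ a = 0.
Proof. exact: scaler0. Qed.
Lemma ractDl M (x y : M) a : (x + y) \@ a = x \@ a + y \@ a.
Proof. exact: scalerDr. Qed.
Lemma ractNl M (x : M) a : (- x) \@ a = - (x \@ a).
Proof. exact: scalerN. Qed.
Lemma ractNr M (x : M) a : x \@ (- a) = - (x \@ a).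
Proof. exact: scaleNr. Qed.
Lemma ractBl M (x y : M) a : (x - y) \@ a = x \@ a - y \@ a.
Proof. exact: scalerBr. Qed.
Lemma ractBr M (x : M) a b : x \@ (a - b) = x \@ a - x \@ b.
Proof. exact: scalerBl. Qed.
Lemma ract_suml M I (r : seq I) (P : pred I) (F : I -> M) a :
  (\sum_(i <- r | P i) F i) \@ a = \sum_(i <- r | P i) F i \@ a.
Proof. exact: scaler_sumr. Qed.
Lemma ract_sumr M I (r : seq I) (P : pred I) (x : M) (F : I -> R) :
  x \@ (\sum_(i <- r | P i) F i) = \sum_(i <- r | P i) x \@ F i.
Proof. exact: scaler_suml. Qed.
Lemma lin_ract M N (f : M -> N) a x : lin f -> f (x \@ a) = f x \@ a.
Proof. by move=> lf; rewrite /ract linZ. Qed.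

(* [x] lies in the sum of [M d] and the annihilator of [t] in [M]. *)
Definition div_ann M (x : M) (d t : R) : Prop := exists z, (x - z \@ d) \@ t = 0.

Lemma div_ann_lin M N (f : M -> N) x d t : lin f -> div_ann x d t -> div_ann (f x) d t.
Proof.
by move=> lf [z xz]; exists (f z); rewrite -(lin_ract d z lf) -(linB lf) -(lin_ract _ _ lf) xz (lin0 lf).
Qed.

Lemma div_annD M (x y : M) d t : div_ann x d t -> div_ann y d t -> div_ann (x + y) d t.
Proof.
move=> [z xz] [w yw]; exists (z + w).
by rewrite [(z + w) \@ d]ractDl opprD addrACA ractDl xz yw addr0.
Qed.

Lemma div_annB M (x y : M) d t : div_ann x d t -> div_ann y d t -> div_ann (x - y) d t.
Proof.
move=> [z xz] [w yw]; exists (z - w).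
by rewrite [(z - w) \@ d]ractBl opprD addrACA -opprD ractBl xz yw subr0.
Qed.

Lemma div_ann_of_div M (z : M) d t : div_ann (z \@ d) d t.
Proof. by exists z; rewrite subrr ract0l. Qed.

Lemma div_ann_of_ann M (x : M) d t : x \@ t = 0 -> div_ann x d t.
Proof. by move=> xt; exists 0; rewrite ract0l subr0. Qed.

Lemma div_ann_mono M (x : M) d t a b : div_ann x (a * d) t -> div_ann x d (t * b).
Proof.
move=> [z xz]; exists (z \@ a).
by rewrite ractA -ractA xz ract0l.
Qed.

Lemma div_ann_pure M N (f : M -> N) x d t : lin f -> pure_map f ->
  div_ann (f x) d t -> div_ann x d t.
Proof.
move=> lf pf [z fz].
(* The condition is solvability of the single equation [z (d t) = x t]. *)
have [|y yE] := pf 1%N 1%N (fun _ _ => d * t) (fun _ => x \@ t).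
  exists (fun _ => z) => j /=; rewrite big_ord1 -[LHS]/(z \@ (d * t)) lin_ract // -ractA.
  by apply/eqP; rewrite eq_sym -subr_eq0 -ractBl fz.
exists (y ord0); rewrite ractBl ractA; apply/eqP; rewrite subr_eq0; apply/eqP/esym.
by have := yE ord0; rewrite big_ord1.
Qed.

End RightAction.

(** [val_ler] and [val_lel] together make the right and left multiples of an element coincide, and
    [le] is divisibility, so the value of 0 is the greatest. [le] and [add] are bare parameters, to
    be shared verbatim by two rings. *)
Record valued_ring (G : Type) (le : G -> G -> Prop) (add : G -> G -> G) (R : nzRingType)
    (v : R -> G) : Prop := ValuedRing {
  val_dom : domain R;
  val_surj : forall g, exists a, v a = g;
  val_mulE : forall a b, v (a * b) = add (v a) (v b);
  val_ler : forall a b, le (v a) (v b) <-> exists c, b = a * c;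
  val_lel : forall a b, le (v a) (v b) <-> exists c, b = c * a;
  val_total : forall g h, le g h \/ le h g;
  val_anti : forall g h, le g h -> le h g -> g = h;
  val_addC : forall g h, add g h = add h g }.

Section Valued.
Variables (G : Type) (le : G -> G -> Prop) (add : G -> G -> G).
Variables (R : nzRingType) (v : R -> G).
Hypothesis vR : valued_ring le add v.
Implicit Types (M N : rmodType R) (a b c d t : R).

Lemma val_refl g : le g g.
Proof. by case: (val_total vR g g). Qed.

Lemma val_trans g h k : le g h -> le h k -> le g k.
Proof.
have [a <-] := val_surj vR g; have [b <-] := val_surj vR h; have [c <-] := val_surj vR k.
move=> /(val_ler vR)[r ->] /(val_ler vR)[s ->]; apply/(val_ler vR).
by exists (r * s); rewrite mulrA.
Qed.

Lemma exists_le_min (T : finType) (f : T -> G) (u0 : T) : exists m, forall u, le (f m) (f u).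
Proof.
suff [m mP] : exists m, forall u, u \in u0 :: enum T -> le (f m) (f u).
  by exists m => u; apply: mP; rewrite inE mem_enum orbT.
elim: (enum T) => [|w s [m mP]].
  by exists u0 => u; rewrite inE => /eqP ->; exact: val_refl.
have [mw|wm] := val_total vR (f m) (f w).
  exists m => u; rewrite !inE => /or3P[/eqP->|/eqP->//|us]; apply: mP.
    by rewrite inE eqxx.
  by rewrite inE us orbT.
exists w => u; rewrite !inE => /or3P[/eqP->|/eqP->|us].
- by apply: val_trans wm _; apply: mP; rewrite inE eqxx.
- exact: val_refl.
- by apply: val_trans wm _; apply: mP; rewrite inE us orbT.
Qed.

(* Diagonalisation by row and column operations, pivoting on an entry of least value. *)
Theorem solvable_diag p q (B : 'I_p -> 'I_q -> R) :
  exists (I : finType) (d : I -> R) (c : I -> 'I_q -> R), forall M (w : 'I_q -> M),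
    solvable (A := R^c) B w <-> forall i, exists z, z \@ d i = \sum_j w j \@ c i j.
Proof.
elim: p q B => [|p IH] [|q] B.
- exists void, (fun _ => 0), (fun _ _ => 0) => M w; split=> [_ []|_].
  by exists (fun _ => 0) => -[].
(* Without unknowns every right-hand side must vanish, which is expressed as divisibility by 0. *)
- exists 'I_q.+1, (fun _ => 0), (fun i j => (i == j)%:R) => M w.
  have E i : \sum_j w j \@ (i == j)%:R = w i.
    rewrite (bigD1 i) //= eqxx ract1 big1 ?addr0 // => j ji.
    by rewrite eq_sym (negPf ji) ract0.
  split=> [[y yE] i|h].
    by exists 0; rewrite ract0 E -yE big_ord0.
  by exists (fun _ => 0) => j; have [z] := h j; rewrite ract0 E big_ord0.
- exists void, (fun _ => 0), (fun _ _ => 0) => M w; split=> [_ []|_].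
  by exists (fun _ => 0) => -[].
have [[i0 j0] piv] := exists_le_min (fun k : 'I_p.+1 * 'I_q.+1 => v (B k.1 k.2)) (ord0, ord0).
have {}piv i j : le (v (B i0 j0)) (v (B i j)) by exact: (piv (i, j)).
set a := B i0 j0 in piv *.
have /choice[e eE] i : exists e, B i j0 = e * a by apply/(val_lel vR).
have /choice[f fE] j : exists f, B i0 j = a * f by apply/(val_ler vR).
(* The Schur complement of the pivot [a]. The index [None] below stands for the pivot condition, and
   [c'] rewrites the reduced right-hand sides [w'] in terms of [w]. *)
pose B' i j := B (lift i0 i) (lift j0 j) - B (lift i0 i) j0 * f (lift j0 j).
have [I [d [c dcE]]] := IH q B'.
pose d' k := if k is Some i then d i else a.
pose c' (k : option I) j := match k with
  | Some i => if unlift j0 j is Some j' then c i j' else - \sum_j' f (lift j0 j') * c i j'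
  | None => (j == j0)%:R end.
exists (option I), d', c' => M w.
pose w' j := w (lift j0 j) - w j0 \@ f (lift j0 j).
have cE i : \sum_j w j \@ c' (Some i) j = \sum_j w' j \@ c i j.
  rewrite (bigD1_ord j0) //= unlift_none ractNr ract_sumr.
  rewrite addrC -sumrB; apply: eq_bigr => j _.
  by rewrite liftK /w' ractBl ractA.
have c0E : \sum_j w j \@ c' None j = w j0.
  rewrite (bigD1 j0) //= eqxx ract1 big1 ?addr0 // => j jj.
  by rewrite (negPf jj) ract0.
have -> : (forall k, exists z, z \@ d' k = \sum_j w j \@ c' k j) <->
    (exists z, z \@ a = w j0) /\ solvable (A := R^c) B' w'.
  rewrite dcE; split=> [h|[h0 h1] [i|]].
  - split=> [|i]; first by have := h None; rewrite c0E.
    by have := h (Some i); rewrite cE.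
  - by rewrite cE; exact: h1.
  - by rewrite c0E.
have sumE (y : 'I_p.+1 -> M) j : \sum_i (B i j : R^c) *: y i =
    y i0 \@ (a * f j) + \sum_i y (lift i0 i) \@ B (lift i0 i) j.
  by rewrite (bigD1_ord i0) //= -fE.
have aj0 (z : M) : z \@ (a * f j0) = z \@ a by rewrite -fE.
split=> [[y yE]|[[z zE] [y yE]]].
  split.
    exists (\sum_i y i \@ e i); rewrite -yE ract_suml; apply: eq_bigr => i _.
    by rewrite ractA -eE.
  exists (y \o lift i0) => j; rewrite /w' -!yE !sumE aj0 ractDl ractA opprD addrACA subrr add0r.
  rewrite ract_suml -sumrB; apply: eq_bigr => i _.
  by rewrite ractA -ractBr.
(* Back substitution: the entries of the pivot column are [e i * a], so subtracting the [y i' \@ e]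
   from [z] solves equation [j0]. *)
pose Y i := if unlift i0 i is Some i' then y i' else z - \sum_i' y i' \@ e (lift i0 i').
exists Y => j; rewrite sumE {1}/Y unlift_none.
have -> : \sum_i Y (lift i0 i) \@ B (lift i0 i) j = \sum_i y i \@ B (lift i0 i) j.
  by apply: eq_bigr => i _; rewrite /Y liftK.
have aE : (z - \sum_i y i \@ e (lift i0 i)) \@ a = w j0 - \sum_i y i \@ B (lift i0 i) j0.
  rewrite ractBl zE ract_suml; congr (_ - _).
  by apply: eq_bigr => i _; rewrite ractA -eE.
case: (unliftP j0 j) => [j' ->|->]; last by rewrite aj0 aE subrK.
have := yE j'; rewrite -[w (lift j0 j')](subrK (w j0 \@ f (lift j0 j'))) -/(w' j') => <-.
rewrite -ractA aE ractBl addrAC -addrA [RHS]addrC; congr (_ + _).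
rewrite ract_suml -sumrB; apply: eq_bigr => i _.
by rewrite ractA -ractBr.
Qed.

(** If [c] is a multiple of [d] the condition always holds, and [(1, 0)] encodes truth. Otherwise
    [d = d' c], and [z d' c = x c] says that [c] kills [x - z d']. *)
Lemma div_ann_of_dvd (d c : R) : exists d' t, forall M (x : M),
  (exists z, z \@ d = x \@ c) <-> div_ann x d' t.
Proof.
have [/(val_lel vR)[c' ->]|/(val_lel vR)[d' ->]] := val_total vR (v d) (v c).
  exists 1, 0 => M x; split=> _; first by exists x; rewrite ract0.
  by exists (x \@ c'); rewrite ractA.
exists d', c => M x; split=> -[z zE]; exists z.
  by rewrite ractBl ractA zE subrr.
by move: zE; rewrite ractBl ractA => /eqP; rewrite subr_eq0 => /eqP.
Qed.

End Valued.

(** * Pairs of value sets as pp-types *)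

Section Types.
Variables (G : Type) (le : G -> G -> Prop) (add : G -> G -> G).
Variables (R : nzRingType) (v : R -> G).
Hypothesis vR : valued_ring le add v.
Implicit Types (M N : rmodType R) (a b c d t : R) (I J : set G).

Definition ann_set M (x : M) : set G := [set g | exists t, v t = g /\ x \@ t = 0].
Definition nondiv_set M (x : M) : set G :=
  [set g | exists d, v d = g /\ ~ exists z, z \@ d = x].

(** Elements of equal value are multiples of each other on either side, so annihilation, and
    likewise divisibility, depends on the value only. *)
Lemma ann_setE M (x : M) t : ann_set x (v t) <-> x \@ t = 0.
Proof.
split=> [[s [vs xs]]|xt]; last by exists t.
have /(val_ler vR)[b ->] : le (v s) (v t) by rewrite vs; exact: val_refl vR _.
by rewrite -ractA xs ract0l.
Qed.

Lemma nondiv_setE M (x : M) d : nondiv_set x (v d) <-> ~ exists z, z \@ d = x.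
Proof.
split=> [[e [ve xe]] [z zd]|xd]; last by exists d.
have /(val_lel vR)[b db] : le (v e) (v d) by rewrite ve; exact: val_refl vR _.
by apply: xe; exists (z \@ b); rewrite ractA -db.
Qed.

Definition up_closed I : Prop := forall g h, le g h -> I g -> I h.

Record proper_pair I J : Prop := ProperPair {
  proper_upl : up_closed I;
  proper_upr : up_closed J;
  proper_1l : ~ I (v 1);
  proper_1r : ~ J (v 1);
  proper_0l : I (v 0);
  proper_0r : J (v 0) }.

(** This fixes all pp-conditions on [x], and includes primeness: membership in [M d + ann t] is
    already caused by one of the two summands. In an arbitrary module the two value sets alone do
    not give this. *)
Definition has_type M (x : M) I J : Prop :=
  forall d t, div_ann x d t <-> (~ J (v d) \/ I (v t)).

Lemma has_type_sets M (x : M) I J : ~ I (v 1) -> J (v 0) -> has_type x I J ->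
  ann_set x = I /\ nondiv_set x = J.
Proof.
move=> nI1 J0 xIJ; split; apply/seteqP; split=> g; have [a <-] := val_surj vR g.
- move=> /ann_setE xa; have := (xIJ 0 a).1 (div_ann_of_ann _ xa).
  by case=> // /(_ J0).
- move=> Ia; apply/ann_setE; have [z] := (xIJ 0 a).2 (or_intror Ia).
  by rewrite ract0 subr0.
- move=> /nondiv_setE xa; apply: contrapT => nJa; apply: xa.
  have [z] := (xIJ a 1).2 (or_introl nJa); rewrite ract1 => /eqP.
  by rewrite subr_eq0 => /eqP ->; exists z.
- move=> Ja; apply/nondiv_setE => -[z zx].
  have : div_ann x a 1 by rewrite -zx; exact: div_ann_of_div.
  by move=> /xIJ[/(_ Ja)|].
Qed.

Lemma proper_sets M (x : M) : x <> 0 -> proper_pair (ann_set x) (nondiv_set x).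
Proof.
move=> x0; split.
- move=> g h; have [a <-] := val_surj vR g; have [b <-] := val_surj vR h.
  move=> /(val_ler vR)[c ->] /ann_setE xa; apply/ann_setE.
  by rewrite -ractA xa ract0l.
- move=> g h; have [a <-] := val_surj vR g; have [b <-] := val_surj vR h.
  move=> /(val_lel vR)[c ->] /nondiv_setE xa; apply/nondiv_setE => -[z zE].
  by apply: xa; exists (z \@ c); rewrite ractA.
- by move=> /ann_setE; rewrite ract1.
- by move=> /nondiv_setE; apply; exists x; rewrite ract1.
- by apply/ann_setE; rewrite ract0.
- by apply/nondiv_setE => -[z]; rewrite ract0 => /esym.
Qed.

Lemma lin_eval_unit M (x : M) (l : seq (unit * R)) :
  lin_eval (A := R^c) (fun _ => x) l = x \@ (\sum_(p <- l) p.2).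
Proof. by rewrite ract_sumr. Qed.

Lemma exists_lin1 M N (x : M) (y : N) : alg_compact N ->
  (forall d t, div_ann x d t -> div_ann y d t) -> exists f : M -> N, lin f /\ f x = y.
Proof.
move=> cN xy; have [|f [lf fx]] := @exists_lin _ _ _ unit (fun _ => x) (fun _ => y) cN; last first.
  by exists f; split=> //; exact: (fx tt).
move=> p q B D; have [I [d [c dcE]]] := solvable_diag vR B.
have E (L : rmodType R) (u : L) : solvable (A := R^c) B (fun j => lin_eval (fun _ => u) (D j)) <->
    forall i, exists z, z \@ d i = u \@ (\sum_j (\sum_(p <- D j) (p.2 : R) : R) * c i j).
  rewrite dcE; split=> h i; have [z zE] := h i; exists z.
    by rewrite zE ract_sumr; apply: eq_bigr => j _; rewrite lin_eval_unit ractA.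
  by rewrite zE ract_sumr; apply: eq_bigr => j _; rewrite lin_eval_unit ractA.
rewrite !E => h i; have [d' [t dtE]] := div_ann_of_dvd vR (d i)
  (\sum_j (\sum_(p <- D j) (p.2 : R) : R) * c i j).
by apply/dtE/xy/dtE.
Qed.

(* The lattice generated by the two chains of subgroups [M d] and [ann t] is
   distributive; hence a decomposition of [x] can be chosen to respect finitely
   many conditions satisfied by [x]. *)
Lemma split_div_ann M (x : M) (L : seq (R * R)) :
  (forall l, List.In l L -> div_ann x l.1 l.2) -> forall d t, div_ann x d t ->
  exists u w, [/\ u + w = x, exists z, z \@ d = u, w \@ t = 0 &
    forall l, List.In l L -> div_ann u l.1 l.2 /\ div_ann w l.1 l.2].
Proof.
elim: L => [|[d' t'] L IH] xL d t xdt.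
  case: xdt => z xz; exists (z \@ d), (x - z \@ d); split=> //.
    by rewrite addrC subrK.
  by exists z.
have {}IH := IH (fun l lL => xL l (or_intror lL)).
have x' : div_ann x d' t' by exact: (xL (d', t') (or_introl erefl)).
(* Since [x] satisfies the new condition, checking it on one summand is enough. *)
have auto u w : u + w = x -> div_ann u d' t' \/ div_ann w d' t' ->
    div_ann u d' t' /\ div_ann w d' t'.
  move=> uw [uE|wE]; split=> //.
    by have -> : w = x - u by [rewrite -uw addrC addKr]; exact: div_annB.
  by have -> : u = x - w by [rewrite -uw addrK]; exact: div_annB.
have [d'd|dd'] := val_total vR (v d') (v d).
  have [u [w [uw [z zu] wt uwL]]] := IH d t xdt; exists u, w; split=> //; first by exists z.
  move=> l /= [<-|]; last exact: uwL.
  apply: auto => //; left; move/(val_lel vR): d'd zu => [a ->] <-.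
  by rewrite -ractA; exact: div_ann_of_div.
have [tt'|t't] := val_total vR (v t) (v t').
  have [u [w [uw [z zu] wt uwL]]] := IH d t xdt; exists u, w; split=> //; first by exists z.
  move=> l /= [<-|]; last exact: uwL.
  apply: auto => //; right; move/(val_ler vR): tt' => [a ->].
  by apply: div_ann_of_ann; rewrite -ractA wt ract0l.
(* Here [d] divides [d'] and [t'] divides [t], so the new condition is the stronger one and the
   splitting is made along it instead. *)
have [u [w [uw [z zu] wt uwL]]] := IH d' t' x'; exists u, w; split=> //.
- by move/(val_lel vR): dd' zu => [a ->] <-; exists (z \@ a); rewrite ractA.
- by move/(val_ler vR): t't => [a ->]; rewrite -ractA wt ract0l.
move=> l /= [<-|]; last exact: uwL.
by split; [rewrite -zu; exact: div_ann_of_div|exact: div_ann_of_ann].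
Qed.

Lemma lin_closed_div_ann M V (i : V) d t :
  lin_closed (A := R^c) [set s : V -> M | div_ann (s i) d t].
Proof.
have cp : lin_closed (A := R^c) [set s : V -> M | exists z : unit -> M,
    lin_eval (A := R^c) (sum_fun s z) [:: (inl i, t); (inr tt, - (d * t))] = 0].
  apply: (lin_closed_proj (A := R^c) (V := V) (U := unit) (S := [set z : V + unit -> M |
    lin_eval (A := R^c) z [:: (inl i, t); (inr tt, - (d * t))] = 0])).
  exact: lin_closed_eq.
apply: (lin_closed_ext _ cp) => s /=.
have E (z : unit -> M) : lin_eval (A := R^c) (sum_fun s z) [:: (inl i, t); (inr tt, - (d * t))] =
    (s i - z tt \@ d) \@ t.
  rewrite /lin_eval !big_cons big_nil /= addr0 -/(ract _ _) -/(ract (z tt) _).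
  by rewrite ractNr ractBl ractA.
split=> [[z]|[z zE]]; first by rewrite E; exists (z tt).
by exists (fun _ => z); rewrite E.
Qed.

(** * Elements of an indecomposable algebraically compact module *)

Section Indec.
Variable N : rmodType R.
Hypotheses (cN : alg_compact N) (iN : indec N).

(** By compactness, [x = u + w] with [u] in [N d] and [w t = 0] can be chosen so that [u] and [w]
    inherit every condition true of [x]. Then [x] maps to [u] and to [w] under endomorphisms whose
    sum fixes [x] and so is invertible; locality makes one of the two left invertible, up to this
    automorphism. *)
Theorem div_ann_prime (x : N) d t : div_ann x d t -> (exists z, z \@ d = x) \/ x \@ t = 0.
Proof.
move=> xdt.
have [->|x0] := pselect (x = 0); first by right; rewrite ract0l.
(* [None] indexes the splitting itself, [Some l] the inheritance of one condition. *)
pose K := option {l : R * R | div_ann x l.1 l.2}.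
pose S (k : K) : set (bool -> N) := match k with
  | Some l => [set s | div_ann (s true) (sval l).1 (sval l).2 /\
                       div_ann (s false) (sval l).1 (sval l).2]
  | None => [set s | [/\ s true + s false = x, div_ann (s true) d 1 & div_ann (s false) 0 t]]
  end.
have div1 (y : N) e : div_ann y e 1 <-> exists z, z \@ e = y.
  split=> -[z zE]; exists z.
    by apply/eqP; rewrite eq_sym -subr_eq0 -zE ract1.
  by rewrite zE subrr ract0l.
have ann0 (y : N) s : div_ann y 0 s <-> y \@ s = 0.
  split=> [[z]|ys]; first by rewrite ract0 subr0.
  exact: div_ann_of_ann.
have [|ks|s sS] := lin_closed_compact cN (S := S).
- case=> [[[d' t'] l]|].
    exact: (lin_closedI (lin_closed_div_ann N true d' t')
      (lin_closed_div_ann N false d' t')).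
  have cb : lin_closed (A := R^c) [set s : bool -> N |
      lin_eval (A := R^c) s [:: (true, 1); (false, 1)] = x /\
      (div_ann (s true) d 1 /\ div_ann (s false) 0 t)].
    apply: lin_closedI; first exact: lin_closed_eq.
    exact: (lin_closedI (lin_closed_div_ann N true d 1)
      (lin_closed_div_ann N false 0 t)).
  apply: (lin_closed_ext _ cb) => s /=.
  rewrite /lin_eval !big_cons big_nil /= addr0 !scale1r.
  by split=> [[? []]|[]].
- pose L := pmap id [seq (if k is Some l then Some (sval l) else None) | k <- ks].
  have LP l : List.In l L -> div_ann x l.1 l.2.
    rewrite /L; elim: ks {L} => //= -[k|] ks IH //= [<-|//].
    exact: (svalP k).
  have [u [w [uw ud wt uwL]]] := split_div_ann LP xdt.
  exists (fun b : bool => if b then u else w) => -[l lks|_] /=; last first.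
    by split=> //; [exact/div1|exact/ann0].
  apply: uwL; rewrite /L; elim: ks lks {L LP} => //= k ks IH [->|/IH lL] /=; first by left.
  by case: k => [k|] //=; right.
have [f [lf fx]] := exists_lin1 cN (fun d' t' xdt' => (sS (Some (exist _ (d', t') xdt'))).1).
have [g [lg gx]] := exists_lin1 cN (fun d' t' xdt' => (sS (Some (exist _ (d', t') xdt'))).2).
have [xE /div1[z zE] /ann0 gt] := sS None.
have lh := lin_add lf lg.
have [|k [lk hk kh]] := indec_fix_bij cN iN lh _ x0; first by rewrite fx gx.
(* [k \o f] and [k \o g] add up to the identity. A left inverse of the first carries divisibility by
   [d] from [f x] back to [x]; a left inverse of the second carries back annihilation by [t]. *)
have [m [lm mE]] := indec_local cN iN (lin_comp lf lk).
have lmk := lin_comp lk lm.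
case: mE => /= mE.
  by left; exists (m (k z)); rewrite -(lin_ract d z lmk) /= zE -fx.
right; have := mE x.
have -> : x - k (f x) = k (g x).
  by apply/eqP; rewrite subr_eq -(linD lk) addrC; apply/eqP; rewrite -[LHS]hk.
by rewrite gx => <-; rewrite -(lin_ract t _ lmk) gt (lin0 lmk).
Qed.

Lemma has_type_self (x : N) : has_type x (ann_set x) (nondiv_set x).
Proof.
move=> d t; split=> [/div_ann_prime[xd|xt]|].
- by left=> /nondiv_setE; apply.
- by right; apply/ann_setE.
by case=> [/nondiv_setE/contrapT[z <-]|/ann_setE]; [exact: div_ann_of_div|exact: div_ann_of_ann].
Qed.

(** Write [d = d' c], the other case being absurd. By primeness [d'] divides [u + w], or [c] kills
    it, while neither holds for [u]. In the first case [d'] does not divide [w] either, so an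
    annihilator of [u] must kill [w]; a divisor of [u] divides [d'], hence [u + w] and [w]. The
    second case is dual. *)
Lemma linked_half (u w : N) c d : (exists z, z \@ d = (u + w) \@ c) ->
  ~ (exists z, z \@ d = u \@ c) ->
  (forall s, u \@ s = 0 -> w \@ s = 0) /\
  (forall s, (exists z, z \@ s = u) -> exists z, z \@ s = w).
Proof.
move=> [z zE] nu.
have nuc : u \@ c <> 0 by move=> uc; apply: nu; exists 0; rewrite ract0l uc.
have [/(val_lel vR)[c' cE]|/(val_lel vR)[d' dE]] := val_total vR (v d) (v c).
  by case: nu; exists (u \@ c'); rewrite ractA -cE.
have nud : ~ exists z, z \@ d' = u.
  by move=> [z' z'E]; apply: nu; exists z'; rewrite dE -ractA z'E.
have [[z0 z0E]|uwc] : (exists z, z \@ d' = u + w) \/ (u + w) \@ c = 0.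
- by apply: div_ann_prime; exists z; rewrite ractBl ractA -dE zE subrr.
- split=> s.
    move=> us; have [|[z1 z1E]|//] := @div_ann_prime w d' s.
      by exists z0; rewrite z0E opprD addrCA subrr addr0 ractNl us oppr0.
    by case: nud; exists (z0 - z1); rewrite ractBl z0E z1E addrK.
  move=> [z1 z1E]; have [/(val_lel vR)[r sE]|/(val_lel vR)[r d'E]] := val_total vR (v d') (v s).
    by case: nud; exists (z1 \@ r); rewrite ractA -sE.
  exists (z0 \@ r - z1); rewrite ractBl ractA -d'E z0E z1E.
  by rewrite addrC addKr.
- split=> s.
    move=> us; have [/(val_ler vR)[r cE]|/(val_ler vR)[r sE]] := val_total vR (v s) (v c).
      by case: nuc; rewrite cE -ractA us ract0l.
    have : (u + w) \@ s = 0 by rewrite sE -ractA uwc ract0l.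
    by rewrite ractDl us add0r.
  move=> [z1 z1E]; have [|//|wc] := @div_ann_prime w s c.
    by exists (- z1); rewrite ractNl z1E opprK addrC.
  by case: nuc; move: uwc; rewrite ractDl wc addr0.
Qed.

(** The hypotheses are symmetric in [u] and [w]: if [d] divided [w c], it would divide [u c] by
    subtraction. *)
Lemma linked_sets (u w : N) c d : (exists z, z \@ d = (u + w) \@ c) ->
  ~ (exists z, z \@ d = u \@ c) -> ann_set u = ann_set w /\ nondiv_set u = nondiv_set w.
Proof.
move=> uwd nu; have [uw1 uw2] := linked_half uwd nu.
have [||wu1 wu2] := @linked_half w u c d; first by rewrite addrC.
  move=> [z' z'E]; apply: nu; case: uwd => z zE; exists (z - z').
  by rewrite ractBl zE z'E ractDl addrK.
split; apply/seteqP; split=> g; have [a <-] := val_surj vR g.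
- by move=> /ann_setE/uw1/ann_setE.
- by move=> /ann_setE/wu1/ann_setE.
- by move=> /nondiv_setE ua; apply/nondiv_setE => /wu2/ua.
- by move=> /nondiv_setE ua; apply/nondiv_setE => /uw2/ua.
Qed.

Lemma lin_eval_bool M (x y : M) (l : seq (bool * R)) :
  lin_eval (A := R^c) (fun b : bool => if b then x else y) l =
  x \@ (\sum_(p <- l | p.1) p.2) + y \@ (\sum_(p <- l | ~~ p.1) p.2).
Proof.
rewrite /lin_eval (bigID (fun p : bool * R => p.1)) /= !ract_sumr.
by congr (_ + _); apply: eq_bigr => -[[] a].
Qed.

(** If every condition on [(x, y)] held of [(x, 0)], some endomorphism would fix [x] and kill [y],
    against invertibility. So some [d] divides [x c1 + y c2] but not [x c1]. *)
Lemma linked (x y : N) : x <> 0 -> y <> 0 ->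
  (exists r, [/\ y \@ r <> 0, ann_set x = ann_set (y \@ r) & nondiv_set x = nondiv_set (y \@ r)]) \/
  (exists r, [/\ x \@ r <> 0, ann_set y = ann_set (x \@ r) & nondiv_set y = nondiv_set (x \@ r)]).
Proof.
move=> x0 y0; apply: contrapT => nxy.
have [|f [lf fE]] := @exists_lin _ _ _ bool (fun b : bool => if b then x else y)
    (fun b : bool => if b then x else 0) cN; last first.
  have [g [lg fg gf]] := indec_fix_bij cN iN lf (fE true) x0.
  by apply: y0; rewrite -(fg y) (fE false) (lin0 lg).
move=> p q B D; have [I [d [c dcE]]] := solvable_diag vR B.
pose c1 i := \sum_j (\sum_(p <- D j | p.1) (p.2 : R) : R) * c i j.
pose c2 i := \sum_j (\sum_(p <- D j | ~~ p.1) (p.2 : R) : R) * c i j.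
have E (u w : N) : solvable (A := R^c) B
    (fun j => lin_eval (fun b : bool => if b then u else w) (D j)) <->
    forall i, exists z, z \@ d i = u \@ c1 i + w \@ c2 i.
  have Ei i : \sum_j lin_eval (A := R^c) (fun b : bool => if b then u else w) (D j) \@ c i j =
      u \@ c1 i + w \@ c2 i.
    rewrite /c1 /c2 !ract_sumr -big_split; apply: eq_bigr => j _.
    by rewrite lin_eval_bool ractDl !ractA.
  by rewrite dcE; split=> h i; have [z zE] := h i; exists z; rewrite zE Ei.
rewrite !E => h i; apply: contrapT; rewrite ract0l addr0 => nd; apply: nxy.
(* Factoring out the coefficient of smaller value gives [(x + y r) c1] or [(x r + y) c2], the shape
   that [linked_sets] requires. *)
have [/(val_lel vR)[r c2E]|/(val_lel vR)[r c1E]] := val_total vR (v (c1 i)) (v (c2 i)).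
  left; have [|xy1 xy2] := @linked_sets x (y \@ r) (c1 i) (d i) _ nd.
    by have [z zE] := h i; exists z; rewrite zE ractDl ractA -c2E.
  exists r; split=> // yr; apply: x0.
  by have /ann_setE : ann_set x (v 1); [rewrite xy1; apply/ann_setE; rewrite ract1|rewrite ract1].
right; have [||xy1 xy2] := @linked_sets (x \@ r) y (c2 i) (d i).
- by have [z zE] := h i; exists z; rewrite zE ractDl ractA -c1E.
- by rewrite ractA -c1E.
exists r; split=> // yr; apply: y0.
by have /ann_setE : ann_set y (v 1); [rewrite -xy1; apply/ann_setE; rewrite ract1|rewrite ract1].
Qed.

End Indec.

(** Equal types give maps [x] to [x'] and back; both composites fix a nonzero element, hence are
    automorphisms. *)
Theorem iso_of_type N N' (x : N) (x' : N') : alg_compact N -> indec N ->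
  alg_compact N' -> indec N' -> x <> 0 -> x' <> 0 ->
  ann_set x = ann_set x' -> nondiv_set x = nondiv_set x' ->
  exists f : N -> N', lin f /\ bijective f.
Proof.
move=> cN iN cN' iN' x0 x'0 eI eJ.
have tx := has_type_self cN iN x; have tx' := has_type_self cN' iN' x'.
have [|f [lf fx]] := @exists_lin1 _ _ x x' cN'.
  by move=> d t /tx; rewrite eI eJ => /tx'.
have [|g [lg gx]] := @exists_lin1 _ _ x' x cN.
  by move=> d t /tx'; rewrite -eI -eJ => /tx.
have [|k [lk fk _]] := indec_fix_bij cN iN (lin_comp lf lg) _ x0; first by rewrite /= fx.
have [|k' [lk' _ fk']] := indec_fix_bij cN' iN' (lin_comp lg lf) _ x'0; first by rewrite /= gx.
exists f; split=> //; exists (k \o g) => y; first exact: fk.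
have yE : f (g (k' y)) = y := fk' y.
by have kE : k (g (f (g (k' y)))) = g (k' y) := fk _; rewrite -{1}yE /= kE.
Qed.

(** Values cannot be subtracted, so [I - g] is a preimage and [J + g] an image under addition of
    [g]. *)
Definition shift_ann g I : set G := [set h | I (add g h)].
Definition shift_nondiv g J : set G := [set h | exists k, J k /\ h = add g k].

(** If [d] divides [r], both sides hold. Otherwise [d = d' r], and
    [(x r - z d) t = (x - z d') (r t)] reduces the condition on [x r] to one on [x]. *)
Lemma has_type_shift M (x : M) I J r : proper_pair I J -> has_type x I J -> ~ I (v r) ->
  has_type (x \@ r) (shift_ann (v r) I) (shift_nondiv (v r) J).
Proof.
move=> pIJ xIJ nIr d t.
have r0 : r <> 0 by move=> r0; apply: nIr; rewrite r0; exact: proper_0l pIJ.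
have rI a b : r * a = r * b -> a = b.
  move=> rab; have /(val_dom vR)[//|/eqP] : r * (a - b) = 0 by rewrite mulrBr rab subrr.
  by rewrite subr_eq0 => /eqP.
have [/(val_lel vR)[r' rE]|/(val_lel vR)[d' dE]] := val_total vR (v d) (v r).
  split=> _; last first.
    by rewrite rE -ractA; exact: div_ann_of_div.
  left=> -[k]; have [a <-] := val_surj vR k; rewrite -(val_mulE vR) => -[Ja de].
  have /(val_ler vR)[b bE] : le (v (r * a)) (v r).
    by rewrite -de; apply/(val_lel vR); exists r'.
  apply: (proper_1r pIJ); apply: (proper_upr pIJ) Ja; apply/(val_ler vR); exists b.
  by apply: rI; rewrite mulr1 mulrA.
have -> : div_ann (x \@ r) d t <-> div_ann x d' (r * t).
  split=> -[z zE]; exists z; first by rewrite -ractA ractBl ractA -dE.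
  by rewrite dE -ractA -ractBl ractA.
rewrite xIJ (val_mulE vR) dE.
suff -> : shift_nondiv (v r) J (v (d' * r)) <-> J (v d') by [].
split=> [[k]|Jd]; last by exists (v d'); split=> //; rewrite (val_mulE vR) (val_addC vR).
have [a <-] := val_surj vR k; rewrite (val_mulE vR) (val_addC vR) -!(val_mulE vR) => -[Ja e].
have /(val_ler vR)[b bE] : le (v (r * a)) (v (r * d')) by rewrite e; exact: val_refl vR _.
apply: (proper_upr pIJ) Ja; apply/(val_ler vR); exists b.
by apply: rI; rewrite bE mulrA.
Qed.

Lemma shift_sets M (x : M) I J r : proper_pair I J -> has_type x I J -> ~ I (v r) ->
  ann_set (x \@ r) = shift_ann (v r) I /\ nondiv_set (x \@ r) = shift_nondiv (v r) J.
Proof.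
move=> pIJ xIJ nIr; apply: has_type_sets; last exact: has_type_shift.
  by rewrite /shift_ann /= -(val_mulE vR) mulr1.
by exists (v 0); split; [exact: proper_0r pIJ|rewrite -(val_mulE vR) mulr0].
Qed.

End Types.

(** * Realisation of types *)

Section Realisation.
Variables (G : Type) (le : G -> G -> Prop) (add : G -> G -> G).
Variables (R : nzRingType) (v : R -> G).
Hypothesis vR : valued_ring le add v.
Variables I J : set G.
Hypothesis pIJ : proper_pair le v I J.

(* A reduced product of the modules [R / b s R], at the elements [b], where [b] and [s]
   range over the divisors allowed by [J] and the annihilators prescribed by [I]. *)
Lemma exists_has_type : exists (M : rmodType R) (x : M), has_type v x I J.
Proof.
pose iota := {p : R * R | ~ J (v p.1) /\ I (v p.2)}.
pose b (i : iota) := (sval i).1; pose s (i : iota) := (sval i).2.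
have bP i : ~ J (v (b i)) by case: (svalP i).
have sP i : I (v (s i)) by case: (svalP i).
have mk b' s' : ~ J (v b') -> I (v s') -> exists i, b i = b' /\ s i = s'.
  by move=> Jb Is; exists (exist _ (b', s') (conj Jb Is)).
pose V : lmodType R^c := iota -> (R^c)^o.
pose below (i j : iota) := le (v (b i)) (v (b j)) /\ le (v (s j)) (v (s i)).
(* Families that eventually, in the order of larger divisor [b] and smaller annihilator [s], are
   zero modulo [b j * s j]. *)
pose K : set V := [set f | exists i, forall j, below i j -> exists r : R, (f j : R) = b j * s j * r].
have below_trans i j k : below i j -> below j k -> below i k.
  move=> [bij sij] [bjk sjk]; split; first exact: (val_trans vR bij bjk).
  exact: (val_trans vR sjk sij).
have directed i j : exists k, below i k /\ below j k.
  have [b' [Jb' bi bj]] : exists b', [/\ ~ J (v b'), le (v (b i)) (v b') & le (v (b j)) (v b')].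
    have [bij|bji] := val_total vR (v (b i)) (v (b j)).
      by exists (b j); split=> //; exact: val_refl vR _.
    by exists (b i); split=> //; exact: val_refl vR _.
  have [s' [Is' si sj]] : exists s', [/\ I (v s'), le (v s') (v (s i)) & le (v s') (v (s j))].
    have [sij|sji] := val_total vR (v (s i)) (v (s j)).
      by exists (s i); split=> //; exact: val_refl vR _.
    by exists (s j); split=> //; exact: val_refl vR _.
  by have [k [bk sk]] := mk b' s' Jb' Is'; exists k; rewrite /below bk sk.
have sK : is_submod K.
  split.
  - have [i _] := mk 1 0 (proper_1r pIJ) (proper_0l pIJ).
    by exists i => j _; exists 0; rewrite mulr0.
  - move=> f g [i fi] [j gj]; have [k [ik jk]] := directed i j.
    exists k => l kl; have [r fr] := fi l (below_trans _ _ _ ik kl).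
    have [r' gr] := gj l (below_trans _ _ _ jk kl); exists (r + r').
    by rewrite mulrDr -fr -gr.
  - move=> a f [i fi]; exists i => j /fi[r fr]; exists (r * a).
    by rewrite mulrA -fr.
have [Q [p [lp sp kp]]] := exists_quotient sK.
pose x : V := b.
have actE (f : V) a j : (@ract R V f a) j = (f j : R) * a by [].
exists Q, (p x) => d t; split; last first.
  case=> [nJd|It].
    have [i [bi si]] := mk d 0 nJd (proper_0l pIJ).
    have ex j : exists z : R, le (v d) (v (b j)) -> b j = z * d.
      have [dj|nd] := pselect (le (v d) (v (b j))); last by exists 0.
      by have [z zE] := (val_lel vR d (b j)).1 dj; exists z.
    have [z zE] := choice ex.
    exists (p (z : V)); rewrite -(lin_ract d (z : V) lp) -(linB lp) -(lin_ract _ _ lp).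
    apply/kp; exists i => j [ij _]; exists 0.
    rewrite mulr0 actE; have -> : (((x - @ract R V z d) : V) j : R) = b j - z j * d by [].
    by rewrite -zE ?subrr ?mul0r // -bi.
  apply: div_ann_of_ann; rewrite -(lin_ract _ _ lp); apply/kp.
  have [i [bi si]] := mk 1 t (proper_1r pIJ) It.
  exists i => j [_ sij]; have [r tE] : exists r, t = s j * r by apply/(val_ler vR); rewrite -si.
  by exists r; rewrite actE -mulrA -tE.
(* A relation in the quotient holds from some index [i] on; at [i] itself it reads
   [(b i - z i * d) * t = b i * s i * r]. *)
move=> [q]; have [z <-] := sp q.
rewrite -(lin_ract d z lp) -(linB lp) -(lin_ract _ _ lp) => /kp[i /(_ i)[|r]].
  by split; exact: val_refl vR _.
rewrite actE; have -> : (((x - @ract R V z d) : V) i : R) = b i - (z i : R) * d by [].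
move=> zE; apply: contrapT => nJI.
have Jd : J (v d) by apply: contrapT => nJd; apply: nJI; left.
have nIt : ~ I (v t) by move=> It; apply: nJI; right.
have nle a : J (v a) -> ~ le (v a) (v (b i)).
  by move=> Ja ab; apply: (bP i); exact: (proper_upr pIJ ab Ja).
have Jzd : J (v ((z i : R) * d)).
  by apply: (proper_upr pIJ) Jd; apply/(val_lel vR); exists (z i).
have [/(val_ler vR)[q' qE]|/(nle _ Jzd)//] := val_total vR (v (b i)) (v ((z i : R) * d)).
have b0 : b i <> 0 by move=> b0; apply: (bP i); rewrite b0; exact: proper_0r pIJ.
have {}zE : (1 - q') * t = s i * r.
  have /(val_dom vR)[//|/eqP] : b i * ((1 - q') * t - s i * r) = 0.
    by rewrite mulrBr !mulrA mulrBr mulr1 -qE zE subrr.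
  by rewrite subr_eq0 => /eqP.
have le1 a : le (v 1) (v a) by apply/(val_ler vR); exists a; rewrite mul1r.
have v1 a : le (v a) (v 1) -> v a = v 1 by move=> a1; exact: (val_anti vR a1 (le1 a)).
(* Whichever of [q'] and [1 - q'] divides the other divides 1. In the first case [z i * d] has the
   value of [b i], which is not in [J]; in the second [t] has the value of [s i * r], which is in
   [I]. *)
have [/(val_ler vR)[c cE]|/(val_ler vR)[c cE]] := val_total vR (v q') (v (1 - q')).
  have /v1 vq : le (v q') (v 1).
    by apply/(val_ler vR); exists (1 + c); rewrite mulrDr mulr1 -cE addrC subrK.
  apply: (nle _ Jzd); rewrite qE (val_mulE vR) vq -(val_mulE vR) mulr1.
  exact: val_refl vR _.
have /v1 vq : le (v (1 - q')) (v 1).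
  by apply/(val_ler vR); exists (1 + c); rewrite mulrDr mulr1 -cE subrK.
apply: nIt; apply: (proper_upl pIJ) (sP i); apply: (val_trans vR (h := v (s i * r))).
  by apply/(val_ler vR); exists r.
rewrite -zE (val_mulE vR) vq -(val_mulE vR) mul1r.
exact: val_refl vR _.
Qed.

(** Among the endomorphisms of a compact module that fix [x], take a minimal idempotent [e]; [N] is
    its image. Minimality makes endomorphisms of [N] fixing [y] injective. For an idempotent [f] of
    [N], one of [f y] and [y - f y] satisfies no condition beyond those of [y], so it can be mapped
    back to [y]; then [f] or [1 - f] is injective, hence the identity. *)
Theorem exists_indec_type : exists (N : rmodType R) (x : N),
  [/\ alg_compact N, indec N, x <> 0, ann_set v x = I & nondiv_set v x = J].
Proof.
have [M0 [x0 tx0]] := exists_has_type.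
have [M [j [cM lj pj]]] := exists_pure_alg_compact M0.
pose x := j x0.
have tx : has_type v x I J.
  move=> d t; rewrite -tx0; split; first exact: div_ann_pure.
  exact: (div_ann_lin lj).
pose S := [set g : M -> M | lin g /\ g x = x].
have cS : lin_closed S.
  apply: lin_closedI; first exact: lin_closed_lin.
  apply: (lin_closed_ext _ (@lin_closed_eq _ M M [:: (x, 1)] x)) => g /=.
  by rewrite /lin_eval big_seq1 scale1r.
have [||e [[le' ex] ee eS]] := exists_minimal_idempotent cM cS.
- by exists id; split.
- move=> f g [lf fx] [lg gx]; split; first exact: lin_comp.
  by rewrite /= gx.
have eE m : e (e m) = e m by exact: (congr1 (fun f => f m) ee).
(* The image of [e] is presented as the quotient by its kernel, with section [i]. *)
have [N [p [lp sp kp]]] : exists (Q : rmodType R) (p : M -> Q),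
    [/\ lin p, forall q, exists m, p m = q & forall m, p m = 0 <-> e m = 0].
  apply: exists_quotient; split=> /= [|m n em en|a m em]; first exact: (lin0 le').
    by rewrite (linD le') em en addr0.
  by rewrite (linZ _ le') em scaler0.
have [r rE] := choice sp.
pose i q := e (r q).
have ip m : i (p m) = e m.
  apply/eqP; rewrite -subr_eq0 -(linB le'); apply/eqP/kp.
  by rewrite (linB lp) rE subrr.
have pe m : p (e m) = p m.
  by apply/eqP; rewrite -subr_eq0 -(linB lp); apply/eqP/kp; rewrite (linB le') eE subrr.
have pi : cancel i p by move=> q; rewrite /i pe rE.
have li : lin i.
  by move=> a u w; rewrite -{1}(rE u) -{1}(rE w) -lp ip le'.
have cN : alg_compact N := alg_compact_retract li lp pi cM.
pose y := p x.
have iy : i y = x by rewrite ip.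
have ty : has_type v y I J.
  move=> d t; rewrite -tx; split; last exact: div_ann_lin.
  by move=> /(div_ann_lin li); rewrite iy.
have nI1 := proper_1l pIJ; have J0 := proper_0r pIJ.
have [eI eJ] := has_type_sets vR nI1 J0 ty.
have y0 : y <> 0.
  by move=> y0; apply: nI1; rewrite -eI; apply/(ann_setE vR); rewrite ract1.
(* Extended to [i \o h \o p], the map belongs to [S], and minimality of [e] provides a left inverse
   on the image of [e]. *)
have fix_inj h : lin h -> h y = y -> forall q, h q = 0 -> q = 0.
  move=> lh hy q hq.
  have [|g [lg _] gE] := eS (i \o h \o p).
    split; first by apply: lin_comp; [exact: lp|exact: lin_comp].
    by rewrite /= -/y hy iy.
  rewrite -(pi q) -[i q]/(e (r q)) -(congr1 (fun f => f (r q)) gE) /=.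
  by rewrite pe rE hq (lin0 li) (lin0 lg) (lin0 lp).
exists N, y; split=> //; split; first by exists y.
move=> f lf ff.
have fE q : f (f q) = f q by exact: (congr1 (fun g => g q) ff).
have lf' : lin (fun q => q - f q) by apply: lin_sub => //; exact: lin_id.
(* If both parts satisfied a condition excluded by the type, weakening both to the divisor of least
   and the annihilator of greatest value would make their sum [y] satisfy an excluded one. *)
have typ_part : (forall d t, div_ann (f y) d t -> ~ J (v d) \/ I (v t)) \/
    (forall d t, div_ann (y - f y) d t -> ~ J (v d) \/ I (v t)).
  apply: contrapT => /not_orP[/existsNP[d1 /existsNP[t1 /not_implyP[dt1 /not_orP[/contrapT Jd1 nIt1]]]]].
  move=> /existsNP[d2 /existsNP[t2 /not_implyP[dt2 /not_orP[/contrapT Jd2 nIt2]]]].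
  have [d [Jd /(val_lel vR)[a1 d1E] /(val_lel vR)[a2 d2E]]] :
      exists d, [/\ J (v d), le (v d) (v d1) & le (v d) (v d2)].
    have [h|h] := val_total vR (v d1) (v d2); [exists d1|exists d2]; split=> //; exact: val_refl vR _.
  have [t [nIt /(val_ler vR)[c1 t1E] /(val_ler vR)[c2 t2E]]] :
      exists t, [/\ ~ I (v t), le (v t1) (v t) & le (v t2) (v t)].
    have [h|h] := val_total vR (v t1) (v t2); [exists t2|exists t1]; split=> //; exact: val_refl vR _.
  have : div_ann y d t.
    have -> : y = f y + (y - f y) by rewrite addrC subrK.
    apply: div_annD.
      by rewrite t1E; apply: (@div_ann_mono _ _ _ _ _ a1); rewrite -d1E.
    by rewrite t2E; apply: (@div_ann_mono _ _ _ _ _ a2); rewrite -d2E.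
  by move=> /ty[].
case: typ_part => yP.
  right=> q; have [|h [lh hy]] := exists_lin1 vR cN (x := f y) (y := y).
    by move=> d t /yP/ty.
  apply/esym/eqP; rewrite -subr_eq0; apply/eqP; apply: (fix_inj (h \o f)) => //.
    exact: lin_comp.
  by rewrite /= (linB lf) fE subrr (lin0 lh).
left=> q; have [|h [lh hy]] := exists_lin1 vR cN (x := y - f y) (y := y).
  by move=> d t /yP/ty.
apply: (fix_inj (h \o (fun q => q - f q))) => //; first exact: lin_comp.
by rewrite /= fE subrr (lin0 lh).
Qed.

End Realisation.

(** * The Ziegler spectrum *)

Section Isomorphism.
Variable R : nzRingType.
Implicit Types M N P : rmodType R.

Lemma isomorphic_refl M : isomorphic M M.
Proof.
have [f fE] := lin_linear (@lin_id _ M); exists f; exists id => x; rewrite fE //.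
Qed.

Lemma isomorphicP M N : isomorphic M N <-> exists f : M -> N, lin f /\ bijective f.
Proof.
split=> [[f bf]|[f [lf bf]]]; first by exists f; split=> //; exact: linear_lin.
by have [g gf] := lin_linear lf; exists g; exact: (eq_bij bf (fsym gf)).
Qed.

Lemma isomorphic_sym M N : isomorphic M N -> isomorphic N M.
Proof.
move=> /isomorphicP[f [lf [g fg gf]]]; apply/isomorphicP; exists g; split.
  exact: lin_bij lf fg gf.
by exists f.
Qed.

Lemma isomorphic_trans M N P : isomorphic M N -> isomorphic N P -> isomorphic M P.
Proof.
move=> /isomorphicP[f [lf bf]] /isomorphicP[g [lg bg]]; apply/isomorphicP.
by exists (g \o f); split; [exact: lin_comp|exact: bij_comp].
Qed.

Lemma isomorphic_eq M N : isomorphic M N -> isomorphic M = isomorphic N.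
Proof.
move=> MN; apply/funext => P; apply/propext; split; last exact: isomorphic_trans.
exact/isomorphic_trans/isomorphic_sym.
Qed.

Lemma indec_isomorphic M N : isomorphic M N -> indec M -> indec N.
Proof.
move=> /isomorphicP[f [lf [g fg gf]]] [[x x0] Mi].
have lg := lin_bij lf fg gf; split.
  by exists (f x) => fx0; apply: x0; rewrite -(fg x) fx0 (lin0 lg).
move=> e le ee; have eE y : e (e y) = e y by exact: (congr1 (fun h => h y) ee).
have [||e0|e1] := Mi (g \o e \o f).
- by apply: lin_comp => //; exact: lin_comp.
- by apply/funext => y /=; rewrite gf eE.
- by left=> y; have /= := e0 (g y); rewrite gf => /(congr1 f); rewrite gf (lin0 lf).
- by right=> y; have /= := e1 (g y); rewrite gf => /(congr1 f); rewrite !gf.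
Qed.

Lemma zg_eq (p q : zg R) : zg_class p = zg_class q -> p = q.
Proof.
by case: p q => [P HP] [Q HQ] /= e; subst Q; rewrite (Prop_irrelevance HP HQ).
Qed.

Lemma zg_classE (p : zg R) N : zg_class p N -> zg_class p = isomorphic N.
Proof. by have [M [_ _ ->]] := zg_classP p; exact: isomorphic_eq. Qed.

Lemma zg_class_nonempty (p : zg R) : exists N, zg_class p N.
Proof. by have [M [_ _ ->]] := zg_classP p; exists M; exact: isomorphic_refl. Qed.

Lemma zg_class_indec (p : zg R) N : zg_class p N -> alg_compact N /\ indec N.
Proof.
have [M [/indecomposableP iM /pure_injectiveP cM ->]] := zg_classP p => MN.
split; last exact: indec_isomorphic iM.
have /isomorphicP[f [lf [g fg gf]]] := MN.
exact: (alg_compact_retract (lin_bij lf fg gf) lf gf cM).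
Qed.

Lemma zg_point N : alg_compact N -> indec N -> exists p : zg R, zg_class p N.
Proof.
move=> cN iN.
have H : exists M : rmodType R, [/\ indecomposable M, pure_injective M & isomorphic N = isomorphic M].
  by exists N; split=> //; [exact/indecomposableP|exact/pure_injectiveP].
by exists (Zg H); exact: isomorphic_refl.
Qed.

Lemma exists_pp1 p q (B : 'I_p -> 'I_q -> R) (b : 'I_q -> R) : exists phi : pp_formula R 1,
  forall M (x : 'rV[M]_1), pp_sol phi x <-> solvable (A := R^c) B (fun j => x 0 0 \@ b j).
Proof.
exists (@PPFormula R 1 p q (col_mx (\matrix_(i, j) B i j) (\matrix_(i, j) - b j))) => M x.
rewrite pp_solP /=.
have -> : (fun i j => col_mx (\matrix_(i, j) B i j) (\matrix_(i < 1, j < q) - b j) (lshift 1 i) j) = B.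
  by apply/funext => i; apply/funext => j; rewrite col_mxEu mxE.
have -> // : (fun j => - \sum_k (col_mx (\matrix_(i, j) B i j)
    (\matrix_(i < 1, j < q) - b j) (rshift p k) j : R^c) *: x 0 k) = (fun j => x 0 0 \@ b j).
by apply/funext => j; rewrite big_ord1 col_mxEd mxE scaleNr opprK.
Qed.

Lemma zg_basicP (phi psi : pp_formula R 1) p : zg_basic phi psi p <->
  exists (N : rmodType R) (x : 'rV[N]_1), [/\ zg_class p N, pp_sol phi x & ~ pp_sol psi x].
Proof.
split=> [[N [pN [_ nsub]]]|[N [x [pN px nx]]]].
  exists N; apply: contrapT => nex; apply: nsub => x phix; split=> //.
  by apply: contrapT => nx; apply: nex; exists x.
exists N; split=> //; split; first by move=> y [].
by move=> /(_ x px)[].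
Qed.

End Isomorphism.

Section TypeSets.
Variables (G : Type) (le : G -> G -> Prop) (add : G -> G -> G).
Variables (R : nzRingType) (v : R -> G).
Hypothesis vR : valued_ring le add v.
Implicit Types (M N : rmodType R) (p q : zg R) (I J : set G).

Definition zg_type p I J : Prop := exists (N : rmodType R) (x : N),
  [/\ zg_class p N, x <> 0, ann_set v x = I & nondiv_set v x = J].

Lemma bij_sets M N (f : M -> N) x : lin f -> bijective f ->
  ann_set v (f x) = ann_set v x /\ nondiv_set v (f x) = nondiv_set v x.
Proof.
move=> lf [g fg gf]; have lg := lin_bij lf fg gf.
split; apply/seteqP; split=> h; have [a <-] := val_surj vR h.
- move=> /(ann_setE vR); rewrite -(lin_ract a x lf) => /(congr1 g).
  by rewrite fg (lin0 lg) => xa; apply/(ann_setE vR).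
- by move=> /(ann_setE vR) xa; apply/(ann_setE vR); rewrite -(lin_ract a x lf) xa (lin0 lf).
- move=> /(nondiv_setE vR) xa; apply/(nondiv_setE vR) => -[z zE]; apply: xa.
  by exists (f z); rewrite -(lin_ract a z lf) zE.
- move=> /(nondiv_setE vR) xa; apply/(nondiv_setE vR) => -[z zE]; apply: xa.
  by exists (g z); rewrite -(lin_ract a z lg) zE fg.
Qed.

Lemma zg_typeP p N I J : zg_class p N -> zg_type p I J ->
  exists x : N, [/\ x <> 0, ann_set v x = I & nondiv_set v x = J].
Proof.
move=> pN [M [x [pM x0 <- <-]]].
have : zg_class p N := pN; rewrite (zg_classE pM) => /isomorphicP[f [lf bf]].
have [eI eJ] := bij_sets x lf bf; exists (f x); split=> //.
by move=> fx; apply: x0; apply: (bij_inj bf); rewrite fx (lin0 lf).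
Qed.

Lemma zg_type_nonempty p : exists I J, zg_type p I J.
Proof.
have [N pN] := zg_class_nonempty p; have [_ [[x x0] _]] := zg_class_indec pN.
by exists (ann_set v x), (nondiv_set v x), N, x.
Qed.

Lemma zg_type_proper p I J : zg_type p I J -> proper_pair le v I J.
Proof. by move=> [N [x [_ x0 <- <-]]]; exact: (proper_sets vR). Qed.

Lemma zg_type_inj p q I J : zg_type p I J -> zg_type q I J -> p = q.
Proof.
move=> [N [x [pN x0 eI eJ]]] [N' [x' [qN' x'0 eI' eJ']]].
have [cN iN] := zg_class_indec pN; have [cN' iN'] := zg_class_indec qN'.
apply: zg_eq; rewrite (zg_classE pN) (zg_classE qN'); apply/isomorphic_eq/isomorphicP.
by apply: (iso_of_type vR cN iN cN' iN' x0 x'0); [rewrite eI eI'|rewrite eJ eJ'].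
Qed.

Lemma exists_zg_type I J : proper_pair le v I J -> exists p, zg_type p I J.
Proof.
move=> pIJ; have [N [x [cN iN x0 eI eJ]]] := exists_indec_type vR pIJ.
by have [p pN] := zg_point cN iN; exists p, N, x.
Qed.

Lemma zg_type_shift p I J g : zg_type p I J -> ~ I g ->
  zg_type p (shift_ann add g I) (shift_nondiv add g J).
Proof.
move=> [N [x [pN x0 <- <-]]]; have [r <-] := val_surj vR g => xr.
have [cN iN] := zg_class_indec pN.
have [eI eJ] := shift_sets vR (proper_sets vR x0) (has_type_self vR cN iN x) xr.
by exists N, (x \@ r); split=> //; move=> /(ann_setE vR).
Qed.

Lemma zg_type_linked p I J I' J' : zg_type p I J -> zg_type p I' J' ->
  (exists g, [/\ ~ I' g, I = shift_ann add g I' & J = shift_nondiv add g J']) \/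
  (exists g, [/\ ~ I g, I' = shift_ann add g I & J' = shift_nondiv add g J]).
Proof.
move=> [N [x [pN x0 <- <-]]] /(zg_typeP pN)[y [y0 <- <-]].
have [cN iN] := zg_class_indec pN.
have step (a b : N) r : a <> 0 -> a \@ r <> 0 -> ann_set v b = ann_set v (a \@ r) ->
    nondiv_set v b = nondiv_set v (a \@ r) -> exists g, [/\ ~ ann_set v a g,
      ann_set v b = shift_ann add g (ann_set v a)
      & nondiv_set v b = shift_nondiv add g (nondiv_set v a)].
  move=> a0 ar -> ->; exists (v r).
  have nar : ~ ann_set v a (v r) by move=> /(ann_setE vR).
  by have [-> ->] := shift_sets vR (proper_sets vR a0) (has_type_self vR cN iN a) nar.
by have [[r [yr e1 e2]]|[r [xr e1 e2]]] := linked vR cN iN x0 y0; [left|right]; exact: step e1 e2.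
Qed.

End TypeSets.

(** * Transfer between rings with the same values *)

Section Transfer.
Variables (G : Type) (le : G -> G -> Prop) (add : G -> G -> G).

Section OneRing.
Variables (R : nzRingType) (v : R -> G).
Hypothesis vR : valued_ring le add v.

Lemma val1_le g : le (v 1) g.
Proof. by have [a <-] := val_surj vR g; apply/(val_ler vR); exists a; rewrite mul1r. Qed.

Lemma val0_ge g : le g (v 0).
Proof. by have [a <-] := val_surj vR g; apply/(val_ler vR); exists 0; rewrite mulr0. Qed.

Lemma pp1_conditions (phi : pp_formula R 1) : exists (K : finType) (d t : K -> R),
  forall (M : rmodType R) (x : 'rV[M]_1),
    pp_sol phi x <-> forall k, div_ann (x 0 0) (d k) (t k).
Proof.
have [K [d [c dcE]]] := solvable_diag vR (fun i j => pp_mx phi (lshift 1 i) j).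
pose e k := \sum_j - (pp_mx phi (rshift (pp_bound phi) ord0) j) * c k j.
have ex k : exists dt : R * R, forall (M : rmodType R) (x : M),
    (exists z, z \@ d k = x \@ e k) <-> div_ann x dt.1 dt.2.
  by have [d' [t dtE]] := div_ann_of_dvd vR (d k) (e k); exists (d', t).
have [f fE] := choice ex.
exists K, (fun k => (f k).1), (fun k => (f k).2) => M x.
rewrite pp_solP dcE.
have E k : \sum_j (- (\sum_k0 (pp_mx phi (rshift (pp_bound phi) k0) j : R^c) *: x 0 k0)) \@ c k j =
    x 0 0 \@ e k.
  rewrite /e ract_sumr; apply: eq_bigr => j _.
  by rewrite big_ord1 -ractNr ractA.
split=> h k; first by apply/fE; have [z zE] := h k; exists z; rewrite zE E.
by have /fE[z zE] := h k; exists z; rewrite zE E.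
Qed.

Lemma zg_basic_type (phi psi : pp_formula R 1) (K L : finType) (d t : K -> R) (d' t' : L -> R) p :
  (forall (M : rmodType R) (x : 'rV[M]_1), pp_sol phi x <-> forall k, div_ann (x 0 0) (d k) (t k)) ->
  (forall (M : rmodType R) (x : 'rV[M]_1), pp_sol psi x <-> forall k, div_ann (x 0 0) (d' k) (t' k)) ->
  zg_basic phi psi p <-> exists I J, [/\ zg_type v p I J,
    forall k, ~ J (v (d k)) \/ I (v (t k)) & exists k, J (v (d' k)) /\ ~ I (v (t' k))].
Proof.
move=> phiE psiE; rewrite zg_basicP; split=> [[N [x [pN /phiE px nx]]]|].
  have [cN iN] := zg_class_indec pN; pose y := x 0 0.
  have y0 : y <> 0.
    by move=> y0; apply/nx/psiE => k; apply: div_ann_of_ann; rewrite -/y y0 ract0l.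
  exists (ann_set v y), (nondiv_set v y); split; first by exists N, y.
    by move=> k; apply/(has_type_self vR cN iN)/px.
  apply: contrapT => nk; apply/nx/psiE => k; apply/(has_type_self vR cN iN).
  have [Jk|] := pselect (nondiv_set v y (v (d' k))); last by left.
  by right; apply: contrapT => nIk; apply: nk; exists k.
move=> [_ [_ [[N [y [pN y0 <- <-]]] yphi [k [Jk nIk]]]]].
have [cN iN] := zg_class_indec pN.
exists N, (\row_(j < 1) y); split=> //.
  by apply/phiE => l; rewrite mxE; apply/(has_type_self vR cN iN)/yphi.
by move=> /psiE/(_ k); rewrite mxE => /(has_type_self vR cN iN)[].
Qed.

(** The complement of [J] is closed downwards, so a single bound outside [J] replaces finitely many
    conditions; [exists_lower] does the same for [I]. *)
Lemma exists_upper (K : finType) (P : G -> Prop) (f : K -> G) g0 : P g0 ->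
  exists g, P g /\ forall k, P (f k) -> le (f k) g.
Proof.
move=> Pg0.
suff [g [Pg gP]] : exists g, P g /\ forall k, k \in enum K -> P (f k) -> le (f k) g.
  by exists g; split=> // k; apply: gP; rewrite mem_enum.
elim: (enum K) => [|k s [g [Pg gP]]]; first by exists g0.
have [[Pk gk]|nk] := pselect (P (f k) /\ le g (f k)).
  exists (f k); split=> // l; rewrite inE => /orP[/eqP-> _|ls Pl].
    exact: val_refl vR _.
  exact: (val_trans vR (gP l ls Pl) gk).
exists g; split=> // l; rewrite inE => /orP[/eqP-> Pk|]; last exact: gP.
by have [gk|//] := val_total vR g (f k); case: nk.
Qed.

Lemma exists_lower (K : finType) (P : G -> Prop) (f : K -> G) g0 : P g0 ->
  exists g, P g /\ forall k, P (f k) -> le g (f k).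
Proof.
move=> Pg0.
suff [g [Pg gP]] : exists g, P g /\ forall k, k \in enum K -> P (f k) -> le g (f k).
  by exists g; split=> // k; apply: gP; rewrite mem_enum.
elim: (enum K) => [|k s [g [Pg gP]]]; first by exists g0.
have [[Pk kg]|nk] := pselect (P (f k) /\ le (f k) g).
  exists (f k); split=> // l; rewrite inE => /orP[/eqP-> _|ls Pl].
    exact: val_refl vR _.
  exact: (val_trans vR kg (gP l ls Pl)).
exists g; split=> // l; rewrite inE => /orP[/eqP-> Pk|]; last exact: gP.
by have [//|kg] := val_total vR g (f k); case: nk.
Qed.

(** Take for [phi] that [a] divides [x] and [x b = 0], and for [psi] that [x] lies in
    [M c + ann e]. *)
Lemma exists_basic (a b c e : R) : exists phi psi : pp_formula R 1, forall p,
  zg_basic phi psi p <-> exists I J, [/\ zg_type v p I J,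
    ~ J (v a) /\ I (v b) & J (v c) /\ ~ I (v e)].
Proof.
have [phi phiE] := exists_pp1 (fun (i : 'I_1) (j : 'I_2) => if j == 0 then a else 0)
  (fun j => if j == 0 then 1 else b).
have [psi psiE] := exists_pp1 (fun (i : 'I_1) (j : 'I_1) => c * e) (fun j => e).
have pE (M : rmodType R) (x : 'rV[M]_1) : pp_sol phi x <->
    forall k : bool, div_ann (x 0 0) (if k then a else 0) (if k then 1 else b).
  rewrite phiE; split=> [[y yE] k|h].
    have := yE ord0; have := yE ord_max; rewrite !big_ord1 /= -!/(ract _ _) ract0 ract1 => xb xa.
    by case: k; [rewrite -xa; exact: div_ann_of_div|exact: div_ann_of_ann].
  have [z] := h true; have [w] := h false; rewrite ract0 subr0 ract1 => xb xa.
  exists (fun _ => z) => j; rewrite big_ord1 -/(ract _ _); case: eqP => _.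
    by rewrite ract1; apply/eqP; rewrite eq_sym -subr_eq0 xa.
  by rewrite ract0 xb.
have qE (M : rmodType R) (x : 'rV[M]_1) : pp_sol psi x <->
    forall k : unit, div_ann (x 0 0) c e.
  rewrite psiE; split=> [[y yE] _|/(_ tt)[z zE]].
    have := yE ord0; rewrite big_ord1 -/(ract _ _) => yc.
    by exists (y ord0); rewrite ractBl ractA yc subrr.
  exists (fun _ => z) => j; rewrite big_ord1 -/(ract _ _); apply/eqP; rewrite eq_sym -subr_eq0.
  by rewrite -ractA -ractBl zE.
exists phi, psi => p; rewrite (zg_basic_type p pE qE); split.
  move=> [I [J [pIJ h [_ h']]]]; exists I, J; split=> //.
  have pr := zg_type_proper vR pIJ.
  have [|/=] := h true; last by move=> /(proper_1l pr).
  by have [/= /(_ (proper_0r pr))|] := h false.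
move=> [I [J [pIJ [Ja Ib] h]]]; exists I, J; split; [by []| |by exists tt].
by case; [left|right].
Qed.

End OneRing.

Section TwoRings.
Variables (R S : nzRingType) (v : R -> G) (w : S -> G).
Hypotheses (vR : valued_ring le add v) (wS : valued_ring le add w).

(** The values of 1 and 0 are the least and the greatest, hence determined by the order. *)
Lemma proper_pair_transfer I J : proper_pair le v I J -> proper_pair le w I J.
Proof.
have v1 : v 1 = w 1 by exact: (val_anti vR (val1_le vR _) (val1_le wS _)).
have v0 : v 0 = w 0 by exact: (val_anti vR (val0_ge wS _) (val0_ge vR _)).
by move=> [? ? ? ? ? ?]; split=> //; rewrite -?v1 -?v0.
Qed.

(** Two pairs of [p] differ by a shift. If [(I', J')] is the shifted one, [q] has it as well. If
    [(I, J)] is, realise [(I', J')] at some [q']: its shift [(I, J)] is a pair of both [q'] and [q],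
    so they coincide. *)
Lemma zg_type_sub (p : zg R) (q : zg S) I J I' J' :
  zg_type v p I J -> zg_type w q I J -> zg_type v p I' J' -> zg_type w q I' J'.
Proof.
move=> pIJ qIJ pIJ'.
have [[g [nIg IE JE]]|[g [nIg -> ->]]] := zg_type_linked vR pIJ pIJ'; last exact: (zg_type_shift wS).
have [q' q'IJ'] := exists_zg_type wS (proper_pair_transfer (zg_type_proper vR pIJ')).
suff -> : q = q' by [].
apply: (zg_type_inj wS qIJ); rewrite IE JE; exact: (zg_type_shift wS).
Qed.

(** A basic neighbourhood of [f p] shrinks to one given by four values: a bound for the divisors
    outside [J], a bound for the annihilators inside [I], and the two values of one violated
    condition of [psi]. Elements of [R] have these values too. *)
Lemma zg_open_preim (f : zg R -> zg S) :
  (forall p I J, zg_type v p I J <-> zg_type w (f p) I J) ->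
  forall V, zg_open V -> zg_open (fun p => V (f p)).
Proof.
move=> fE V oV p Vp; have [phi [psi [bp bV]]] := oV _ Vp.
have [K [d [t phiE]]] := pp1_conditions wS phi.
have [L [d' [t' psiE]]] := pp1_conditions wS psi.
have bE q := zg_basic_type wS q phiE psiE.
have /bE[I [J [pIJ cphi [l [Jl nIl]]]]] := bp.
have pr := zg_type_proper wS pIJ.
have [ga [nJa aP]] := exists_upper wS (fun k => w (d k)) (P := fun g => ~ J g) (proper_1r pr).
have [gb [Ib bP]] := exists_lower wS (fun k => w (t k)) (P := I) (proper_0l pr).
have [a aE] := val_surj vR ga; have [b bE'] := val_surj vR gb.
have [c cE] := val_surj vR (w (d' l)); have [e eE] := val_surj vR (w (t' l)).
have [phi' [psi' b'E]] := exists_basic vR a b c e.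
exists phi', psi'; split.
  by apply/b'E; exists I, J; rewrite aE bE' cE eE; split=> //; apply/fE.
move=> q /b'E[I1 [J1 [qIJ1 [nJ1a I1b] [J1c nI1e]]]]; apply/bV/bE.
have pr1 := zg_type_proper vR qIJ1.
exists I1, J1; split; first exact/fE.
  move=> k; have [nJk|Ik] := cphi k; [left|right].
    by move=> J1k; apply: nJ1a; rewrite aE; apply: (proper_upr pr1 (aP k nJk)).
  by apply: (proper_upl pr1 (bP k Ik)); rewrite -bE'.
by exists l; rewrite -cE -eE.
Qed.

End TwoRings.

Theorem zg_homeomorphic_of_valued (R S : nzRingType) (v : R -> G) (w : S -> G) :
  valued_ring le add v -> valued_ring le add w -> zg_homeomorphic R S.
Proof.
move=> vR wS.
have transfer (R1 R2 : nzRingType) (v1 : R1 -> G) (v2 : R2 -> G) :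
    valued_ring le add v1 -> valued_ring le add v2 ->
    exists f : zg R1 -> zg R2, forall p I J, zg_type v1 p I J <-> zg_type v2 (f p) I J.
  move=> vR1 vR2; suff /choice[f fP] : forall p : zg R1, exists q : zg R2,
      forall I J, zg_type v1 p I J <-> zg_type v2 q I J by exists f.
  move=> p; have [I [J pIJ]] := zg_type_nonempty v1 p.
  have [q qIJ] := exists_zg_type vR2 (proper_pair_transfer vR1 vR2 (zg_type_proper vR1 pIJ)).
  exists q => I' J'; split=> h; first exact: (zg_type_sub vR1 vR2 pIJ qIJ h).
  exact: (zg_type_sub vR2 vR1 qIJ pIJ h).
have [f fE] := transfer _ _ _ _ vR wS; have [g gE] := transfer _ _ _ _ wS vR.
exists f, g; split.
- move=> p; have [I [J pIJ]] := zg_type_nonempty v p.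
  by apply: (zg_type_inj vR (I := I) (J := J)) => //; apply/gE/fE.
- move=> p; have [I [J pIJ]] := zg_type_nonempty w p.
  by apply: (zg_type_inj wS (I := I) (J := J)) => //; apply/fE/gE.
- exact: (zg_open_preim vR wS fE).
- exact: (zg_open_preim wS vR gE).
Qed.

End Transfer.

(** * The value monoid of an invariant rank one uniserial domain *)

Section ValueMonoid.
Variable P : conomType.
Implicit Types x y z : P.

Definition mdvd x y : Prop := exists z, y = mmul x z.

(** These are the positive cones of nonzero archimedean totally ordered groups, written
    multiplicatively with [mdvd] as order; [conomType] adds commutativity and that only [mone] is
    invertible. *)
Definition archimedean_chain : Prop :=
  [/\ forall x y z, mmul x y = mmul x z -> y = z,
      forall x y, mdvd x y \/ mdvd y x,
      forall x y, x <> mone -> exists n, mdvd y (iter n (mmul x) mone)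
    & exists x, x <> mone].

(* [None] is the value of [0]. *)
Definition vle (g h : option P) : Prop :=
  match g, h with
  | _, None => True
  | Some x, Some y => mdvd x y
  | None, Some _ => False
  end.

Definition vadd (g h : option P) : option P :=
  match g, h with
  | Some x, Some y => Some (mmul x y)
  | _, _ => None
  end.

End ValueMonoid.

Section InvariantRing.
Variable R : nzRingType.
Hypotheses (R_domain : domain R) (R_uniserial : uniserial R).
Hypotheses (R_invariant : invariant_ring R) (R_rank_one : rank_one R).
Implicit Types a b c d e x y : R.

Definition rdvd a b : Prop := exists c, b = a * c.

Lemma rdvdE a b : rdvd a b <-> exists c, b = c * a.
Proof.
have inv := R_invariant a; split=> -[c ->].
  by have : range (fun r => r * a) (a * c) by [rewrite -inv; exists c]; move=> [r _ <-]; exists r.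
by have : range (fun r => a * r) (c * a) by [rewrite inv; exists c]; move=> [r _ <-]; exists r.
Qed.

Lemma swapr a c : exists c', c * a = a * c'.
Proof. by have [c' ->] : rdvd a (c * a) by [apply/rdvdE; exists c]; exists c'. Qed.

Lemma domM a b : a <> 0 -> b <> 0 -> a * b <> 0.
Proof. by move=> a0 b0 /R_domain[]. Qed.

Lemma domI a b c : a <> 0 -> a * b = a * c -> b = c.
Proof.
move=> a0 e; have /R_domain[//|/eqP] : a * (b - c) = 0 by rewrite mulrBr e subrr.
by rewrite subr_eq0 => /eqP.
Qed.

Lemma rdvd_refl a : rdvd a a.
Proof. by exists 1; rewrite mulr1. Qed.

Lemma rdvd_trans b a c : rdvd a b -> rdvd b c -> rdvd a c.
Proof. by move=> [x ->] [y ->]; exists (x * y); rewrite mulrA. Qed.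

Lemma rdvdM a a' b b' : rdvd a a' -> rdvd b b' -> rdvd (a * b) (a' * b').
Proof.
move=> [x ->] [y ->]; have [x' xE] := swapr b x.
by exists (x' * y); rewrite !mulrA -(mulrA a x b) xE !mulrA.
Qed.

Lemma rdvd_total a b : rdvd a b \/ rdvd b a.
Proof.
have ri x : right_ideal (rdvd x).
  split; first by exists 0; rewrite mulr0.
    by move=> _ _ [y ->] [z ->]; exists (y - z); rewrite mulrBr.
  by move=> _ r [y ->]; exists (y * r); rewrite mulrA.
have [ab|ba] := R_uniserial.1 _ _ (ri a) (ri b).
  by right; apply: ab; exact: rdvd_refl.
by left; apply: ba; exact: rdvd_refl.
Qed.

Lemma dom_mul1C a b : a * b = 1 -> b * a = 1.
Proof.
move=> ab; have a0 : a <> 0 by move=> a0; move/eqP: ab; rewrite a0 mul0r eq_sym oner_eq0.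
by apply: (domI a0); rewrite mulrA ab mul1r mulr1.
Qed.

Lemma rdvd1_unit a : rdvd a 1 <-> is_unit a.
Proof.
split=> [[b ab]|[b [ab _]]]; last by exists b.
by exists b; split=> //; exact: dom_mul1C.
Qed.

Lemma rdvd1_mulr a b : rdvd (a * b) 1 -> rdvd b 1.
Proof.
move=> [c e]; exists (c * a); rewrite mulrA.
by apply/esym/dom_mul1C; rewrite mulrA.
Qed.

Lemma jacobsonE x : @jacobson R x <-> ~ rdvd x 1.
Proof.
rewrite (jacobson_nonunit R_domain R_uniserial) /=.
by split=> nx; move: nx; rewrite rdvd1_unit.
Qed.

(** The elements divisible by all powers of [d] form a completely prime ideal. Were it nonzero, rank
    one would make it the Jacobson radical, which contains [d]; then [d = d^2 c], and [d] would be a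
    unit. *)
Lemma rdvd_exp_eventually_false d a : ~ rdvd d 1 -> a <> 0 -> exists n, ~ rdvd (d ^+ n) a.
Proof.
move=> nd a0; pose K := [set x | forall n, rdvd (d ^+ n) x].
have K_two_sided : two_sided_ideal K.
  split; split=> [n|x y Kx Ky n|x r Kx n]; try by exists 0; rewrite mulr0.
  - by have [c ->] := Kx n; have [c' ->] := Ky n; exists (c - c'); rewrite mulrBr.
  - by have [c ->] := Kx n; exists (c * r); rewrite mulrA.
  - by have [c ->] := Kx n; have [c' ->] := Ky n; exists (c - c'); rewrite mulrBr.
  - have /rdvdE[c ->] := Kx n; apply/rdvdE; exists (r * c); by rewrite mulrA.
have K_proper : K <> setT.
  by move=> KT; apply: nd; have : [set: R] 1 by []; rewrite -KT => /(_ 1%N); rewrite expr1.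
have K_prime x y : K (x * y) -> K x \/ K y.
  move=> Kxy; apply: contrapT => /not_orP[/existsNP[m xm] /existsNP[n yn]].
  (* With [d^m = x x'] and [d^n = y y'], the product [d^(m+n)] is [x y] times a multiple of [y']; if
     it divides [x y], then [y'] is a unit and [d^n] divides [y]. *)
  have [//|[x' xE]] := rdvd_total (d ^+ m) x; have [//|[y' yE]] := rdvd_total (d ^+ n) y.
  have ny' : ~ rdvd y' 1.
    by move=> [u yu]; apply: yn; exists u; rewrite yE -mulrA -yu mulr1.
  have x0 : x <> 0 by move=> x0; apply: xm; exists 0; rewrite mulr0.
  have y0 : y <> 0 by move=> y0; apply: yn; exists 0; rewrite mulr0.
  have [x'' x''E] := swapr y x'.
  have [e eE] := Kxy (m + n)%N.
  apply: ny'; apply: (@rdvd1_mulr x''); exists e.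
  apply: (domI (domM x0 y0)); rewrite mulr1 [LHS]eE exprD xE yE.
  by rewrite !mulrA -(mulrA x x' y) x''E !mulrA.
have [K0|K0] := pselect (K = [set 0]).
  by apply: contrapT => nex; apply: a0; have : K a by [move=> n; apply: contrapT => h; apply: nex; exists n]; rewrite K0.
have KJ := (R_rank_one K).1 (conj (And3 K_two_sided K_proper K_prime) K0).
have : K d by rewrite KJ; apply/jacobsonE.
move=> /(_ 2)[c dE]; case: nd; have [d0|d0] := pselect (d = 0).
  case: K0; apply/seteqP; split=> x /=; last by move=> -> n; exists 0; rewrite mulr0.
  by move=> /(_ 1%N)[r ->]; rewrite d0 mul0r.
by exists c; apply: (domI d0); rewrite mulr1 mulrA -expr2.
Qed.

Lemma rdvd_factor d a : ~ rdvd d 1 -> a <> 0 ->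
  exists m a', a = d ^+ m * a' /\ ~ rdvd d a'.
Proof.
move=> nd a0; have [n] := rdvd_exp_eventually_false nd a0.
elim: n => [[]|n IH nn]; first by exists a; rewrite mul1r.
have [[a' aE]|/IH//] := pselect (rdvd (d ^+ n) a).
exists n, a'; split=> // -[c cE]; apply: nn; exists c.
by rewrite aE cE mulrA -exprSr.
Qed.

(* Archimedean ordered groups are commutative (Hoelder): if [ab = bac] with [c] a
   nonunit, comparing [a] and [b] with powers of [d] bounds [c] by [d^2]. *)
Lemma commutator_bound a b c d : a <> 0 -> b <> 0 -> a * b = b * a * c ->
  d <> 0 -> ~ rdvd d 1 -> ~ rdvd (d * d) c.
Proof.
move=> a0 b0 abc d0 nd [e cE].
have [m [a' [aE na']]] := rdvd_factor nd a0; have [n [b' [bE nb']]] := rdvd_factor nd b0.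
have [//|[a'' a''E]] := rdvd_total d a'; have [//|[b'' b''E]] := rdvd_total d b'.
have nb'' : ~ rdvd b'' 1.
  by move=> [u bu]; apply: nb'; exists u; rewrite b''E -mulrA -bu mulr1.
have [a3 a3E] := swapr b a''.
(* The upper bound: [a b] divides [d^(m+n+2)], with the nonunit [b''] in the cofactor. Below,
   [d^(n+m)] divides [b a], so [d^2] dividing [c] would make [d^(n+m+2)] divide [a b], and [b''] a
   unit. *)
have E1 : d ^+ m * d * (d ^+ n * d) = a * b * (a3 * b'').
  have -> : d ^+ m * d = a * a'' by rewrite aE -mulrA -a''E.
  have -> : d ^+ n * d = b * b'' by rewrite bE -mulrA -b''E.
  by rewrite !mulrA -(mulrA a a'' b) a3E !mulrA.
have [g gE] : rdvd (d ^+ n * d ^+ m) (b * a).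
  by apply: rdvdM; [exists b'|exists a'].
have [g' g'E] := swapr (d * d) g.
apply: nb''; apply: (@rdvd1_mulr (g' * e * a3)).
apply/(rdvd1_unit _).2; exists 1; rewrite mulr1 mul1r.
suff -> : g' * e * a3 * b'' = 1 by [].
have dd0 : d ^+ n * d ^+ m * (d * d) <> 0.
  have dk k : d ^+ k <> 0 by elim: k => [|k IH]; [exact/eqP/oner_neq0|rewrite exprS; exact: domM].
  by do 2 apply: domM => //; exact: domM.
apply: (domI dd0); rewrite mulr1.
transitivity (a * b * (a3 * b'')).
  rewrite abc gE cE !mulrA; congr (_ * _ * _).
  by rewrite -(mulrA (d ^+ n * d ^+ m) d d) -(mulrA _ (d * d) g') -g'E !mulrA.
rewrite -E1 -exprSr -exprSr -exprD -exprD -expr2 -exprD.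
by congr (_ ^+ _); rewrite addSn !addnS addn0 addnC.
Qed.

(** Otherwise [a b = b a c] with [c] a nonunit. By [commutator_bound] no square of a nonunit divides
    [c], so [c] is irreducible and divides every nonunit. Then each nonzero element is a power of
    [c] up to a unit, and [a b] and [b a] have equal values after all. *)
Lemma rdvd_comm a b : rdvd (a * b) (b * a).
Proof.
have [->|a0] := pselect (a = 0); first by rewrite mul0r mulr0; exact: rdvd_refl.
have [->|b0] := pselect (b = 0); first by rewrite mul0r mulr0; exact: rdvd_refl.
apply: contrapT => nab; have [//|[c abc]] := rdvd_total (a * b) (b * a).
have nc : ~ rdvd c 1.
  by move=> [u cu]; apply: nab; exists u; rewrite abc -mulrA -cu mulr1.
have c0 : c <> 0 by move=> c0; apply: (domM a0 b0); rewrite abc c0 mulr0.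
have nsq d : d <> 0 -> ~ rdvd d 1 -> ~ rdvd (d * d) c by exact: commutator_bound abc.
have irr d e : c = d * e -> rdvd d 1 \/ rdvd e 1.
  move=> cE; apply: contrapT => /not_orP[nd ne].
  have d0 : d <> 0 by move=> d0; apply: c0; rewrite cE d0 mul0r.
  have e0 : e <> 0 by move=> e0; apply: c0; rewrite cE e0 mulr0.
  have [[f eE]|/rdvdE[f dE]] := rdvd_total d e.
    by apply: (nsq d) => //; exists f; rewrite cE eE mulrA.
  by apply: (nsq e) => //; apply/rdvdE; exists f; rewrite cE dE mulrA.
have cmin x : ~ rdvd x 1 -> rdvd c x.
  move=> nx; have [//|[y cE]] := rdvd_total c x.
  by have [//|[u yu]] := irr _ _ cE; exists u; rewrite cE -mulrA -yu mulr1.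
have pow x : x <> 0 -> exists m, rdvd (c ^+ m) x /\ rdvd x (c ^+ m).
  move=> x0; have [m [x' [xE nx']]] := rdvd_factor nc x0; exists m; split; first by exists x'.
  have [u xu] : rdvd x' 1 by apply: contrapT => /cmin.
  by exists u; rewrite xE -mulrA -xu mulr1.
have [m [ma am]] := pow a a0; have [n [nb bn]] := pow b b0.
apply: nab; apply: rdvd_trans (rdvdM am bn) _.
by rewrite -exprD addnC exprD; exact: rdvdM.
Qed.

Definition rep a : R := xget 0 [set b | rdvd a b /\ rdvd b a].

Lemma repP a : rdvd a (rep a) /\ rdvd (rep a) a.
Proof.
rewrite /rep; case: xgetP => [b _ //|/(_ a)]; case.
by split; exact: rdvd_refl.
Qed.

Lemma rep_eq a b : rep a = rep b <-> rdvd a b /\ rdvd b a.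
Proof.
have [a1 a2] := repP a; have [b1 b2] := repP b; split=> [e|[ab ba]].
  by split; [apply: (rdvd_trans a1); rewrite e|apply: (rdvd_trans b1); rewrite -e].
congr xget; apply/seteqP; split=> c /= [? ?]; split.
- exact: (rdvd_trans ba).
- exact: (rdvd_trans (b := a)).
- exact: (rdvd_trans ab).
- exact: (rdvd_trans (b := b)).
Qed.

Lemma rep_neq0 a : a <> 0 -> rep a <> 0.
Proof. by move=> a0 ra; have [_ [c cE]] := repP a; apply: a0; rewrite cE ra mul0r. Qed.

(** Values are chosen generators of the nonzero principal ideals: a subtype of [R], hence a choice
    type, as the monoid structures require. *)
Definition value := {a : R | (a != 0) && (rep a == a)}.
HB.instance Definition _ := Choice.on value.

Lemma rep_rep a : rep (rep a) = rep a.
Proof. by apply/rep_eq; have [? ?] := repP a. Qed.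

Lemma rep_value a : a <> 0 -> (rep a != 0) && (rep (rep a) == rep a).
Proof. by move=> a0; rewrite rep_rep eqxx andbT; exact/eqP/rep_neq0. Qed.

Definition value1 : value := exist _ (rep 1) (rep_value (elimN eqP (oner_neq0 R))).
(** At 0 this returns the default [value1]; [ring_value] treats 0 apart. *)
Definition to_value a : value := insubd value1 (rep a).

Lemma val_to_value a : a <> 0 -> sval (to_value a) = rep a.
Proof. by move=> a0; rewrite [LHS]insubdK //; exact: rep_value. Qed.

Lemma value_neq0 (p : value) : sval p <> 0.
Proof. by case/andP: (svalP p) => /eqP. Qed.

Arguments value_neq0 : clear implicits.

Lemma to_valueK (p : value) : to_value (sval p) = p.
Proof.
apply: val_inj; rewrite /= val_to_value; last exact: value_neq0.
by case/andP: (svalP p) => _ /eqP.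
Qed.

Lemma to_value_eq a b : a <> 0 -> b <> 0 ->
  to_value a = to_value b <-> rdvd a b /\ rdvd b a.
Proof.
move=> a0 b0; rewrite -rep_eq -!val_to_value //; split=> [->//|].
exact: val_inj.
Qed.

Definition value_mul (p q : value) : value := to_value (sval p * sval q).

Lemma to_valueM a b : a <> 0 -> b <> 0 -> to_value (a * b) = value_mul (to_value a) (to_value b).
Proof.
move=> a0 b0; rewrite /value_mul !val_to_value //.
apply/to_value_eq; try by apply: domM => //; exact: rep_neq0.
by have [? ?] := repP a; have [? ?] := repP b; split; exact: rdvdM.
Qed.

Lemma value_mulA : associative value_mul.
Proof.
move=> p q r; have p0 := value_neq0 p; have q0 := value_neq0 q; have r0 := value_neq0 r.
rewrite -(to_valueK p) -(to_valueK q) -(to_valueK r) -!to_valueM ?mulrA //; exact: domM.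
Qed.

Lemma value_mul1p : left_id (to_value 1) value_mul.
Proof.
move=> p; have p0 := value_neq0 p; rewrite -(to_valueK p) -to_valueM ?mul1r //.
exact/eqP/oner_neq0.
Qed.

Lemma value_mulp1 : right_id (to_value 1) value_mul.
Proof.
move=> p; have p0 := value_neq0 p; rewrite -(to_valueK p) -to_valueM ?mulr1 //.
exact/eqP/oner_neq0.
Qed.

Lemma value_unitm p q : value_mul p q = to_value 1 -> p = to_value 1 /\ q = to_value 1.
Proof.
have p0 := value_neq0 p; have q0 := value_neq0 q; have one0 : 1 <> 0 :> R by exact/eqP/oner_neq0.
move=> /to_value_eq[||pq1 _]; [exact: domM|exact: one0|].
have q1 := rdvd1_mulr pq1; have p1 : rdvd (sval p) 1.
  by have [c pc] := pq1; exists (sval q * c); rewrite mulrA.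
have div1 a : rdvd 1 a by exists a; rewrite mul1r.
by rewrite -{1}(to_valueK p) -{1}(to_valueK q); split; apply/to_value_eq.
Qed.

HB.instance Definition _ := Choice_isMonomialDef.Build value
  value_mulA value_mul1p value_mulp1 value_unitm.

Lemma value_mulC : commutative (@mmul value).
Proof.
move=> p q; have p0 := value_neq0 p; have q0 := value_neq0 q.
by apply/to_value_eq; [exact: domM|exact: domM|split; exact: rdvd_comm].
Qed.

HB.instance Definition _ := MonomialDef_isConomialDef.Build value value_mulC.

Lemma mdvd_value a b : a <> 0 -> b <> 0 -> mdvd (to_value a) (to_value b) <-> rdvd a b.
Proof.
move=> a0 b0; split=> [[p pE]|[c bE]].
  have p0 := value_neq0 p; move: pE; rewrite -(to_valueK p).
  rewrite -[mmul _ _]to_valueM // => /to_value_eq[||_ pb]; [exact: b0|exact: domM|].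
  by apply: rdvd_trans pb; exists (sval p).
have c0 : c <> 0 by move=> c0; apply: b0; rewrite bE c0 mulr0.
by exists (to_value c); rewrite bE to_valueM.
Qed.

Definition ring_value a : option value := if a == 0 then None else Some (to_value a).

Lemma ring_value_neq0 a : a <> 0 -> ring_value a = Some (to_value a).
Proof. by rewrite /ring_value; case: eqP. Qed.

Lemma ring_value0 : ring_value 0 = None.
Proof. by rewrite /ring_value eqxx. Qed.

Lemma vle_ring_value a b : vle (ring_value a) (ring_value b) <-> rdvd a b.
Proof.
have [->|b0] := pselect (b = 0).
  rewrite ring_value0; split=> _; first by exists 0; rewrite mulr0.
  by case: (ring_value a).
rewrite (ring_value_neq0 b0); have [->|a0] := pselect (a = 0).
  by rewrite ring_value0; split=> // -[c]; rewrite mul0r.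
by rewrite (ring_value_neq0 a0); exact: mdvd_value.
Qed.

Lemma ring_value_surj g : exists a, ring_value a = g.
Proof.
case: g => [p|]; last by exists 0; exact: ring_value0.
by exists (sval p); rewrite ring_value_neq0 ?to_valueK //; exact: value_neq0.
Qed.

Lemma ring_valued : valued_ring (@vle value) (@vadd value) ring_value.
Proof.
split.
- exact: R_domain.
- exact: ring_value_surj.
- move=> a b; have [->|a0] := pselect (a = 0); first by rewrite mul0r ring_value0.
  have [->|b0] := pselect (b = 0); first by rewrite mulr0 ring_value0; case: (ring_value a).
  by rewrite !ring_value_neq0 //; [rewrite to_valueM|exact: domM].
- exact: vle_ring_value.
- by move=> a b; rewrite vle_ring_value; exact: rdvdE.
- move=> g h; have [a <-] := ring_value_surj g; have [b <-] := ring_value_surj h.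
  by rewrite !vle_ring_value; exact: rdvd_total.
- move=> g h; have [a <-] := ring_value_surj g; have [b <-] := ring_value_surj h.
  rewrite !vle_ring_value => ab ba.
  have [a0|a0] := pselect (a = 0).
    by have [c ->] := ab; rewrite a0 mul0r.
  have b0 : b <> 0 by move=> b0; have [c cE] := ba; apply: a0; rewrite cE b0 mul0r.
  by rewrite !ring_value_neq0 //; congr Some; apply/to_value_eq.
- by move=> [p|] [q|] //=; rewrite value_mulC.
Qed.

Lemma value_archimedean_chain : archimedean_chain value.
Proof.
have one0 : 1 <> 0 :> R by exact/eqP/oner_neq0.
split.
- move=> p q r; have p0 := value_neq0 p; have q0 := value_neq0 q; have r0 := value_neq0 r.
  move=> /to_value_eq[||[c e1] [c' e2]]; [exact: domM|exact: domM|].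
  rewrite -(to_valueK q) -(to_valueK r); apply/to_value_eq => //; split.
    by exists c; apply: (domI p0); rewrite e1 mulrA.
  by exists c'; apply: (domI p0); rewrite e2 mulrA.
- move=> p q; have p0 := value_neq0 p; have q0 := value_neq0 q.
  by rewrite -(to_valueK p) -(to_valueK q) !mdvd_value //; exact: rdvd_total.
- move=> p q p1; have p0 := value_neq0 p; have q0 := value_neq0 q.
  have np : ~ rdvd (sval p) 1.
    move=> pu; apply: p1; rewrite -(to_valueK p); apply/to_value_eq => //; split=> //.
    by exists (sval p); rewrite mul1r.
  have [n nq] := rdvd_exp_eventually_false np q0; exists n.
  have [//|qn] := rdvd_total (sval p ^+ n) (sval q).
  have pn k : sval p ^+ k <> 0 by elim: k => [//|k IH]; rewrite exprS; exact: domM.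
  have -> : iter n (mmul p) mone = to_value (sval p ^+ n).
    elim: {nq qn} n => [//|n IH]; rewrite iterS IH exprS to_valueM //.
    by rewrite to_valueK.
  by rewrite -(to_valueK q); apply/mdvd_value.
- have [_ J0] := (R_rank_one (@jacobson R)).2 erefl.
  have [x [Jx x0]] : exists x, @jacobson R x /\ x <> 0.
    apply: contrapT => nx; apply: J0; apply/seteqP; split=> x /=.
      by move=> Jx; apply: contrapT => x0; apply: nx; exists x.
    by move=> ->; apply/jacobsonE => -[c /eqP]; rewrite mul0r oner_eq0.
  exists (to_value x) => /to_value_eq[||x1 _] //.
  by move/jacobsonE: Jx.
Qed.

Theorem exists_value_monoid : exists (P : conomType) (v : R -> option P),
  valued_ring (@vle P) (@vadd P) v /\ archimedean_chain P.
Proof.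
exists value, ring_value; split; first exact: ring_valued.
exact: value_archimedean_chain.
Qed.

End InvariantRing.

(** * A valuation domain with prescribed value monoid *)

Section ClassicalInverse.
Variable A : comNzRingType.
Hypothesis A_integral : GRing.integral_domain_axiom A.

(** A copy of [A] tagged with the proof of integrality, so that canonical instances can depend on
    that proof. It serves both for the monoid algebra and for its localisation. *)
Definition idomain_of (_ : GRing.integral_domain_axiom A) : Type := A.
Local Notation D := (idomain_of A_integral).
HB.instance Definition _ := GRing.ComNzRing.copy D A.

Definition cunit : {pred D} := fun x => `[< exists y : D, y * x = 1 >].
Definition cinv (x : D) : D := if cunit x then xget x [set y | y * x = 1] else x.

Lemma cmulVx : {in cunit, left_inverse 1 cinv *%R}.
Proof.
move=> x ux; rewrite /cinv [cunit x]ux; have [y yx] := asboolP _ ux.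
by case: xgetP => [z _ //|/(_ y)].
Qed.

Lemma cunitPl (x y : D) : y * x = 1 -> cunit x.
Proof. by move=> yx; apply/asboolP; exists y. Qed.

Lemma cinv_out : {in [predC cunit], cinv =1 id}.
Proof. by move=> x; rewrite inE /cinv => nx; rewrite -[cunit x]/(x \in cunit) (negPf nx). Qed.

HB.instance Definition _ := GRing.ComNzRing_hasMulInverse.Build D cmulVx cunitPl cinv_out.
HB.instance Definition _ := GRing.ComUnitRing_isIntegral.Build D A_integral.

End ClassicalInverse.

(** * Localisation of the monoid algebra at its augmentation *)

Section ValuationRing.
Variable P : conomType.
Hypothesis P_chain : archimedean_chain P.
Implicit Types (m n k : P).
Local Notation A := {malg rat[P]}.
Local Notation X m := (mkmalgU m 1 : A).

Lemma mmulI m n k : mmul m n = mmul m k -> n = k.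
Proof. by case: P_chain => + _ _ _; apply. Qed.

Lemma mdvd_total m n : mdvd m n \/ mdvd n m.
Proof. by case: P_chain. Qed.

Lemma mdvd_anti m n : mdvd m n -> mdvd n m -> m = n.
Proof.
move=> [z ->] [z' e]; have [-> _] : z = mone /\ z' = mone; last by rewrite mulm1.
by apply: unitm; apply: (@mmulI m); rewrite mulmA mulm1 -e.
Qed.

Lemma mcoeff_monomialM m n (g : A) : (X m * g)@_(mmul m n) = g@_n.
Proof.
rewrite mcoeffMl msuppU1 big_seq_fset1 mcoeffU1 eqxx.
rewrite (eq_bigr (fun k => g@_k *+ (k == n))); last first.
  move=> k _; rewrite mul1r; congr (_ *+ nat_of_bool _).
  by apply/eqP/eqP => [/mmulI//|->].
case: (msuppP g n) => [ng|ng].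
  by rewrite (big_fsetD1 n) //= eqxx big1_fset ?addr0 // => k; rewrite in_fsetD1 => /andP[/negPf->].
rewrite big_seq big1 // => k kg; case: eqP => // kn.
by rewrite kn (negPf ng) in kg.
Qed.

Lemma mcoeff_monomialM_dvd m n (g : A) : (X m * g)@_n != 0 -> mdvd m n.
Proof.
rewrite mcoeff_neq0 => /msuppM_le[k1 [k2 [+ _ ->]]].
by rewrite msuppU1 in_fset1 => /eqP ->; exists k2.
Qed.

Lemma monomialM m n : X m * X n = X (mmul m n).
Proof. by rewrite malgM_def fgmulUU mulr1. Qed.

(** The support is finite and totally ordered by divisibility, so its least monomial divides all the
    others; what remains has a nonzero constant coefficient. *)
Lemma malg_factor (f : A) : f <> 0 -> exists m g, f = X m * g /\ g@_mone <> 0.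
Proof.
move=> f0.
have [m [mf mmin]] : exists m, m \in msupp f /\ forall k, k \in msupp f -> mdvd m k.
  have : msupp f != fset0 by rewrite msupp_eq0; apply/eqP.
  move=> /fset0Pn[m0 m0f].
  suff : forall s : seq P, exists m, m \in m0 :: s /\ forall k, k \in m0 :: s -> mdvd m k.
    move=> /(_ (msupp f))[m [mm0 mP]]; exists m; split.
      by move: mm0; rewrite inE => /orP[/eqP->|].
    by move=> k kf; apply: mP; rewrite inE kf orbT.
  elim=> [|k s [m [ms mP]]].
    exists m0; split; first by rewrite inE eqxx.
    by move=> k; rewrite inE => /eqP ->; exists mone; rewrite mulm1.
  have [mk|km] := mdvd_total m k.
    exists m; split; first by move: ms; rewrite !inE => /orP[->|->]; rewrite ?orbT.
    move=> l; rewrite !inE => /or3P[/eqP->|/eqP->//|ls]; apply: mP.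
      by rewrite inE eqxx.
    by rewrite inE ls orbT.
  exists k; split; first by rewrite !inE eqxx orbT.
  move=> l ls; have [->|lk] := eqVneq l k; first by exists mone; rewrite mulm1.
  have [z ->] : mdvd m l by apply: mP; move: ls; rewrite !inE (negPf lk).
  by case: km => z' ->; exists (mmul z' z); rewrite mulmA.
have ex k : exists z, k \in msupp f -> k = mmul m z.
  by case: (boolP (k \in msupp f)) => [/mmin[z ->]|_]; [exists z|exists mone].
have [q qE] := choice ex.
pose g : A := \sum_(k <- msupp f) mkmalgU (q k) f@_k.
have fE : f = X m * g.
  rewrite [LHS]monalgE /g mulr_sumr big_seq [RHS]big_seq; apply: eq_bigr => k kf.
  by rewrite malgM_def fgmulUU mul1r -qE.
exists m, g; split=> //; rewrite -(mcoeff_monomialM m) -fE mulm1.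
by apply/eqP; rewrite mcoeff_neq0.
Qed.

(** A product of monomials is [mone] only if both factors are, so the constant coefficient is
    multiplicative. *)
Lemma mcoeff1M (f g : A) : (f * g)@_mone = f@_mone * g@_mone.
Proof. exact: (rmorphM (mcoeff mone : {rmorphism A -> rat})). Qed.

Lemma malg_integral : GRing.integral_domain_axiom A.
Proof.
move=> f g fg; rewrite -[_ || _]negbK negb_or; apply/negP => /andP[/eqP f0 /eqP g0].
have [m [f' [fE f'0]]] := malg_factor f0; have [n [g' [gE g'0]]] := malg_factor g0.
have : (f' * g')@_mone <> 0.
  by rewrite mcoeff1M; apply/eqP; rewrite mulf_neq0 //; apply/eqP.
rewrite -(mcoeff_monomialM (mmul m n)) -monomialM.
have -> : X m * X n * (f' * g') = f * g by rewrite fE gE mulrACA.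
by rewrite fg mcoeff0.
Qed.

Local Notation K := {fraction (idomain_of malg_integral)}.
Definition emb (f : A) : K := @FracField.tofrac (idomain_of malg_integral) f.

Lemma embM f g : emb (f * g) = emb f * emb g. Proof. exact: tofracM. Qed.
Lemma embB f g : emb (f - g) = emb f - emb g. Proof. exact: tofracB. Qed.
Lemma emb1 : emb 1 = 1. Proof. exact: tofrac1. Qed.
Lemma emb0 : emb 0 = 0. Proof. exact: tofrac0. Qed.
Lemma emb_inj f g : emb f = emb g -> f = g.
Proof. by move=> /eqP; rewrite /emb tofrac_eq => /eqP. Qed.
Lemma emb_neq0 f : f <> 0 -> emb f != 0.
Proof. by move=> f0; apply/eqP; rewrite -emb0 => /emb_inj. Qed.
Lemma emb_neq0_coeff f : f@_mone <> 0 -> emb f != 0.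
Proof. by move=> f0; apply: emb_neq0 => e; apply: f0; rewrite e mcoeff0. Qed.

(** Denominators are the elements outside the kernel of the constant coefficient, which is a prime
    ideal because [rat] is a field. *)
Definition vring_pred (x : K) : bool :=
  `[< exists f g : A, g@_mone <> 0 /\ x = emb f / emb g >].

Lemma vring_subring : subring_closed vring_pred.
Proof.
split.
- apply/asboolP; exists 1, 1; rewrite emb1 divr1; split=> //.
  by rewrite mcoeff1 eqxx; apply/eqP; rewrite oner_eq0.
- move=> _ _ /asboolP[f [g [g0 ->]]] /asboolP[f' [g' [g'0 ->]]]; apply/asboolP.
  exists (f * g' - f' * g), (g * g'); split.
    by rewrite mcoeff1M; apply/eqP; rewrite mulf_neq0 //; apply/eqP.
  rewrite embB !embM -mulNr addf_div ?emb_neq0_coeff //.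
  by rewrite mulNr.
- move=> _ _ /asboolP[f [g [g0 ->]]] /asboolP[f' [g' [g'0 ->]]]; apply/asboolP.
  exists (f * f'), (g * g'); split.
    by rewrite mcoeff1M; apply/eqP; rewrite mulf_neq0 //; apply/eqP.
  by rewrite !embM invfM mulrACA.
Qed.

HB.instance Definition _ := GRing.isSubringClosed.Build K vring_pred vring_subring.

Definition vring0 := {x : K | vring_pred x}.
HB.instance Definition _ := SubChoice.on vring0.
HB.instance Definition _ := [SubChoice_isSubComNzRing of vring0 by <:].

Lemma vring_integral : GRing.integral_domain_axiom vring0.
Proof.
move=> x y /(congr1 val)/eqP; rewrite rmorphM rmorph0 mulf_eq0.
by rewrite -!(inj_eq val_inj) !rmorph0.
Qed.

Definition vring : idomainType := idomain_of vring_integral.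

Implicit Types (x y z u : vring).

Definition to_frac x : K := val (x : vring0).

Lemma to_fracM x y : to_frac (x * y) = to_frac x * to_frac y.
Proof. exact: (rmorphM (val : vring0 -> K)). Qed.
Lemma to_frac1 : to_frac 1 = 1.
Proof. exact: (rmorph1 (val : vring0 -> K)). Qed.
Lemma to_frac0 : to_frac 0 = 0.
Proof. exact: (rmorph0 (val : vring0 -> K)). Qed.
Lemma to_frac_inj x y : to_frac x = to_frac y -> x = y.
Proof. exact: val_inj. Qed.

Lemma exists_frac (f g : A) : g@_mone <> 0 -> exists x, to_frac x = emb f / emb g.
Proof.
move=> g0; have fg : vring_pred (emb f / emb g) by apply/asboolP; exists f, g.
by exists (exist (fun x : K => vring_pred x) _ fg : vring0).
Qed.

Lemma fracP x : exists f g : A, g@_mone <> 0 /\ to_frac x = emb f / emb g.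
Proof. by have /asboolP[f [g fg]] := svalP (x : vring0); exists f, g. Qed.

Lemma exists_monomial m : exists x, to_frac x = emb (X m).
Proof.
have [|x xE] := @exists_frac (X m) 1; first by rewrite mcoeff1 eqxx; apply/eqP/oner_neq0.
by exists x; rewrite xE emb1 divr1.
Qed.

Definition monomial m : vring := xget 0 [set x | to_frac x = emb (X m)].

Lemma to_frac_monomial m : to_frac (monomial m) = emb (X m).
Proof.
by rewrite /monomial; case: xgetP => [x _ //|no]; have [x /(no x)] := exists_monomial m.
Qed.

Lemma monomialD m n : monomial (mmul m n) = monomial m * monomial n.
Proof.
by apply: to_frac_inj; rewrite to_fracM !to_frac_monomial -embM monomialM.
Qed.

(** After clearing the denominator [g], compare coefficients at [n]: the left side has the nonzero
    constant coefficient of [g], and the right side lives on multiples of [m]. *)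
Lemma monomial_dvd m n x : monomial n = monomial m * x -> mdvd m n.
Proof.
have [f [g [g0 xE]]] := fracP x.
move=> /(congr1 to_frac); rewrite to_fracM !to_frac_monomial xE mulrA => e.
have {}e : X n * g = X m * f.
  by apply: emb_inj; rewrite !embM e divfK // emb_neq0_coeff.
apply: (@mcoeff_monomialM_dvd _ _ f).
by have := mcoeff_monomialM n mone g; rewrite mulm1 -e => ->; apply/eqP.
Qed.

Definition invertible u : Prop := exists u', u * u' = 1.

(** In [f / g] with [f = X m * f'], both [f'] and [g] are admissible denominators, so [f' / g] is
    invertible. *)
Lemma monomial_factor x : x <> 0 -> exists m u, invertible u /\ x = monomial m * u.
Proof.
move=> x0; have [f [g [g0 xE]]] := fracP x.
have f0 : f <> 0.
  by move=> f0; apply: x0; apply: to_frac_inj; rewrite xE f0 emb0 mul0r to_frac0.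
have [m [f' [fE f'0]]] := malg_factor f0.
have [u uE] := exists_frac f' g0; have [u' u'E] := exists_frac g f'0.
exists m, u; split.
  exists u'; apply: to_frac_inj.
  by rewrite to_fracM to_frac1 uE u'E mulrA divfK ?divff // emb_neq0_coeff.
by apply: to_frac_inj; rewrite to_fracM to_frac_monomial xE uE fE embM mulrA.
Qed.

Lemma monomial_neq0 m : monomial m <> 0.
Proof.
move=> /(congr1 to_frac)/eqP; rewrite to_frac_monomial to_frac0 -emb0 => /eqP /emb_inj.
by move=> /(congr1 (mcoeff m)); rewrite mcoeffU1 eqxx mcoeff0 => /eqP; rewrite oner_eq0.
Qed.

Lemma invertible_neq0 u : invertible u -> u <> 0.
Proof. by move=> [u' uu'] u0; move/eqP: uu'; rewrite u0 mul0r eq_sym oner_eq0. Qed.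

Lemma invertibleM u z : invertible u -> invertible z -> invertible (u * z).
Proof. by move=> [u' uu'] [z' zz']; exists (u' * z'); rewrite mulrACA uu' zz' mulr1. Qed.

Lemma monomial_uniq m n u z : invertible u -> invertible z ->
  monomial m * u = monomial n * z -> m = n.
Proof.
have half (k l : P) a b : invertible a -> monomial k * a = monomial l * b -> mdvd l k.
  move=> [a' aa'] e; apply: (@monomial_dvd _ _ (b * a')).
  by rewrite mulrA -e -mulrA aa' mulr1.
by move=> iu iz e; apply: mdvd_anti; [apply: (half _ _ z u)|apply: (half _ _ u z)].
Qed.

Definition vring_value x : option P :=
  if x == 0 then None else Some (xget mone [set m | exists2 u, invertible u & x = monomial m * u]).

Lemma vring_value0 : vring_value 0 = None.
Proof. by rewrite /vring_value eqxx. Qed.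

Lemma vring_valueE m u : invertible u -> vring_value (monomial m * u) = Some m.
Proof.
move=> iu; rewrite /vring_value mulf_eq0.
have /eqP/negPf -> := @monomial_neq0 m; have /eqP/negPf -> := invertible_neq0 iu.
congr Some; case: xgetP => [n _ [z iz e]|/(_ m)]; last by case; exists u.
exact/esym/(monomial_uniq iu iz e).
Qed.

Lemma vring_valueP x : x = 0 \/
  exists m u, [/\ invertible u, x = monomial m * u & vring_value x = Some m].
Proof.
have [->|x0] := pselect (x = 0); [by left|right].
by have [m [u [iu xE]]] := monomial_factor x0; exists m, u; rewrite xE vring_valueE.
Qed.

Lemma vle_vring_value x y : vle (vring_value x) (vring_value y) <-> exists z, y = x * z.
Proof.
have [->|[n [z [[z' zz'] yE ->]]]] := vring_valueP y.
  rewrite vring_value0; split=> _; first by exists 0; rewrite mulr0.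
  by case: (vring_value x).
have iz : invertible z by exists z'.
have [->|[m [u [[u' uu'] xE ->]]]] := vring_valueP x.
  rewrite vring_value0; split=> // -[a]; rewrite mul0r yE => /eqP.
  rewrite mulf_eq0 => /orP[/eqP/monomial_neq0//|/eqP z0].
  by case: (invertible_neq0 iz).
rewrite /= xE yE; split=> [[k ->]|[a e]].
  exists (monomial k * (u' * z)); rewrite monomialD -!mulrA; congr (_ * _).
  by rewrite mulrCA (mulrA u) uu' mul1r.
apply: (@monomial_dvd _ _ (u * a * z')).
by rewrite !mulrA -e -mulrA zz' mulr1.
Qed.

Lemma vring_value_surj g : exists x, vring_value x = g.
Proof.
case: g => [m|]; last by exists 0; exact: vring_value0.
exists (monomial m * 1); apply: vring_valueE; exists 1; exact: mulr1.
Qed.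

Lemma vring_valued : valued_ring (@vle P) (@vadd P) vring_value.
Proof.
have total x y : vle (vring_value x) (vring_value y) \/ vle (vring_value y) (vring_value x).
  case: (vring_value x) (vring_value y) => [m|] [n|] /=; try by [left|right].
  exact: mdvd_total.
split.
- by move=> x y /eqP; rewrite mulf_eq0 => /orP[/eqP|/eqP]; [left|right].
- exact: vring_value_surj.
- move=> x y; have [->|[m [u [iu xE ->]]]] := vring_valueP x; first by rewrite mul0r vring_value0.
  have [->|[n [z [iz yE ->]]]] := vring_valueP y; first by rewrite mulr0 vring_value0.
  by rewrite xE yE mulrACA -monomialD vring_valueE //; exact: invertibleM.
- exact: vle_vring_value.
- move=> x y; rewrite vle_vring_value.
  by split=> -[z ->]; exists z; rewrite mulrC.
- move=> g h; have [x <-] := vring_value_surj g; have [y <-] := vring_value_surj h.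
  exact: total.
- move=> [m|] [n|] //= mn nm; congr Some; exact: mdvd_anti.
- by move=> [m|] [n|] //=; rewrite mulmC.
Qed.

Lemma invertible_is_unit x : invertible x <-> is_unit x.
Proof.
by split=> [[y xy]|[y [xy _]]]; exists y => //; split=> //; rewrite mulrC.
Qed.

Lemma vring_dvd_total x y : (exists z, y = x * z) \/ (exists z, x = y * z).
Proof. by rewrite -!vle_vring_value; exact: (val_total vring_valued). Qed.

Lemma vring_right_chain (I J : set vring) : right_ideal I -> right_ideal J ->
  I `<=` J \/ J `<=` I.
Proof.
move=> [_ _ Im] [_ _ Jm]; have [IJ|nIJ] := pselect (I `<=` J); [by left|right=> y Jy].
have [x [Ix nJx]] : exists x, I x /\ ~ J x.
  by apply: contrapT => nx; apply: nIJ => x Ix; apply: contrapT => nJx; apply: nx; exists x.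
have [[z ->]|[z xE]] := vring_dvd_total x y; first exact: Im.
by case: nJx; rewrite xE; exact: Jm.
Qed.

Lemma vring_valuation_domain : valuation_domain vring.
Proof. by move=> I J [rI _] [rJ _]; exact: vring_right_chain. Qed.

Lemma vring_uniserial : uniserial vring.
Proof.
split; first exact: vring_right_chain.
have l2r (I : set vring) : left_ideal I -> right_ideal I.
  by move=> [I0 IB Im]; split=> // x r Ix; rewrite mulrC; exact: Im.
by move=> I J /l2r rI /l2r rJ; exact: vring_right_chain.
Qed.

(** Let [Q] be completely prime with a nonzero element [q]. The value of a nonzero nonunit [x] is
    not [mone], so by the archimedean property [q] divides some power of [x], and primeness puts [x]
    in [Q]. *)
Lemma vring_rank_one : rank_one vring.
Proof.
have JE := jacobson_nonunit (val_dom vring_valued) vring_uniserial.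
have nuM x y : ~ is_unit x -> ~ is_unit (x * y).
  by rewrite -!invertible_is_unit => nx [z xyz]; apply: nx; exists (y * z); rewrite mulrA.
have J_right : right_ideal [set x : vring | ~ is_unit x].
  split=> /=.
  - by rewrite -invertible_is_unit => /invertible_neq0.
  - move=> x y nx ny; have [[z ->]|[z ->]] := vring_dvd_total x y.
      by rewrite -[L in L - _]mulr1 -mulrBr; exact: nuM.
    by rewrite -[L in _ - L]mulr1 -mulrBr; exact: nuM.
  - by move=> x r nx; exact: nuM.
have idT (I : set vring) x : right_ideal I -> I x -> is_unit x -> I = setT.
  move=> [_ _ Im] Ix [y [xy _]]; apply/seteqP; split=> z // _.
  by rewrite -[z]mul1r -xy -mulrA; exact: Im.
have unit1 : is_unit (1 : vring) by exists 1; rewrite mulr1.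
move=> Q; split=> [[[[Qr Ql] QT Qprime] Q0]|->]; last first.
  rewrite JE; split.
    split.
    - split=> //; case: J_right => J0 JB Jm; split=> // x r nx.
      by rewrite mulrC; exact: Jm.
    - by move=> JT; have : [set: vring] 1 by []; rewrite -JT => /(_ unit1).
    - move=> x y /= nxy; apply: contrapT => /not_orP[/contrapT ux /contrapT uy]; apply: nxy.
      by move: ux uy; rewrite -!invertible_is_unit; exact: invertibleM.
  case: P_chain => _ _ _ [m m1] J0.
  have : [set x : vring | ~ is_unit x] (monomial m).
    rewrite /= -invertible_is_unit => iu; apply: m1.
    apply: (@monomial_uniq _ _ 1 (monomial m)) => //; first by exists 1; rewrite mulr1.
    by rewrite mulr1 -monomialD mul1m.
  by rewrite J0; exact: monomial_neq0.
rewrite JE; apply/seteqP; split=> [x Qx ux|x nx]; first exact/QT/(idT _ _ Qr Qx ux).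
have [q [Qq q0]] : exists q, Q q /\ q <> 0.
  apply: contrapT => nq; apply: Q0; apply/seteqP; split=> y /=.
    by move=> Qy; apply: contrapT => y0; apply: nq; exists y.
  by move=> ->; case: Qr.
have [->|[m [u [iu xE _]]]] := vring_valueP x; first by case: Qr.
have [//|[n [w [iw qE _]]]] := vring_valueP q.
have m1 : m <> mone.
  move=> m1; apply: nx; apply/invertible_is_unit; rewrite xE m1.
  by apply: invertibleM => //; exists (monomial mone); rewrite -monomialD mul1m;
    apply: to_frac_inj; rewrite to_frac_monomial to_frac1 -emb1.
have [_ _ /(_ m n m1)[k nk] _] := P_chain.
have pow i : exists2 c, invertible c & x ^+ i = monomial (iter i (mmul m) mone) * c.
  elim: i => [|i [c ic IH]].
    exists 1; first by exists 1; rewrite mulr1.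
    by rewrite mulr1; apply: to_frac_inj; rewrite to_frac_monomial to_frac1 -emb1.
  exists (u * c); first exact: invertibleM.
  by rewrite exprS IH xE iterS monomialD mulrACA.
have Qpow : Q (x ^+ k).
  have [c ic ->] := pow k.
  have [z ->] : exists z, monomial (iter k (mmul m) mone) * c = q * z.
    by apply/vle_vring_value; rewrite qE !vring_valueE.
  by case: Qr => _ _; apply.
(* The induction ends at the zeroth power: 1 in [Q] contradicts properness. *)
elim: (k) Qpow => [|i IH]; first by move=> Q1; case: QT; exact: (idT _ 1).
by rewrite exprS => /Qprime[].
Qed.

End ValuationRing.

Theorem exists_valuation_domain (P : conomType) : archimedean_chain P ->
  exists (S : idomainType) (w : S -> option P),
    [/\ valuation_domain S, rank_one S & valued_ring (@vle P) (@vadd P) w].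
Proof.
move=> P_chain; exists (vring P_chain), (vring_value (P_chain := P_chain)); split.
- exact: vring_valuation_domain.
- exact: vring_rank_one.
- exact: vring_valued.
Qed.

Theorem mainTheorem6 (R : nzRingType) (R_domain : domain R)
    (R_uniserial : uniserial R) (R_invariant : invariant_ring R)
    (R_rank_one : rank_one R) :
  exists S : idomainType,
    [/\ valuation_domain S, rank_one S & zg_homeomorphic R S].
Proof.
have [P [v [vR P_chain]]] := exists_value_monoid R_domain R_uniserial R_invariant R_rank_one.
have [S [w [vS rS wS]]] := exists_valuation_domain P_chain.
by exists S; split=> //; exact: zg_homeomorphic_of_valued vR wS.
Qed.
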